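(* There are absolute constants (hidden in the $O(\cdot)$ and $\Omega(\cdot)$ below) such that the following holds. Let $\mathbf{B}\in\mathbb{R}^{m\times n}$ be nonzero and let $0<\Delta\le 1/2$ be an error parameter. Let $q=\frac{4}{\Delta}\log\frac{n}{\Delta}$ (rounded up to an integer), $B=\log\frac{n}{\Delta}$, and let $\mathbf{z}\in\{-1,1\}^n$ be chosen randomly by independently selecting each entry to be $1$ with probability $1/2$ and $-1$ otherwise. If the Lanczos algorithm (see context) is run with $f(x)=x^q$ on the matrix $\mathbf{B}^T\mathbf{B}$ and input vector $\mathbf{z}$ for $O\left(\sqrt{1/\Delta}\log\frac{n}{\Delta}\right)$ iterations on a computer satisfying Requirements 1 and 2 (see context) with precision $\epsilon_{mach}=2^{-\Omega(B)}$ (e.g. a computer with $\Omega(B)$ bits of precision), then with probability $\ge 1/2$ the computed $\mathbf{y}=\mathbf{Q}\mathbf{T}^q\mathbf{e}_1$ satisfies $$\frac{\|\mathbf{B}\mathbf{y}\|}{\|\mathbf{y}\|}\ge(1-\Delta)\max_{\mathbf{x}\neq\mathbf{0}}\frac{\|\mathbf{B}\mathbf{x}\|}{\|\mathbf{x}\|}=(1-\Delta)\|\mathbf{B}\|.$$ Moreover $\mathbf{y}$ takes $$O\left(\mathrm{mv}(\mathbf{B})\sqrt{1/\Delta}\log\tfrac{n}{\Delta}+\left(\sqrt{1/\Delta}\log\tfrac{n}{\Delta}\right)^2B+\left(\sqrt{1/\Delta}\log\tfrac{n}{\Delta}\right)B^2\right)$$ time to compute. Consequently, if this randomized procedure is repeated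 $O(\log(1/\delta))$ times (for $0<\delta<1$) and the $\mathbf{y}$ maximizing $\|\mathbf{B}\mathbf{y}\|/\|\mathbf{y}\|$ is selected, then it satisfies the guarantee with probability $1-\delta$.
   Context: $\|\cdot\|$ is the Euclidean norm for vectors and the spectral norm for matrices. Floating-point model. $\mathrm{fl}(\cdot)$ denotes the computed result. Requirement 1: for $\circ\in\{+,-,\times,\div\}$, $\mathrm{fl}(x\circ y)=(1+\delta)(x\circ y)$ and $\mathrm{fl}(\sqrt{x})=(1+\delta)\sqrt{x}$ with $|\delta|\le\epsilon_{mach}$. Requirement 2 (for the matrix $\mathbf{A}=\mathbf{B}^T\mathbf{B}$ to which Lanczos is applied): for every $\mathbf{w}\in\mathbb{R}^n$, $\|\mathrm{fl}(\mathbf{A}\mathbf{w})-\mathbf{A}\mathbf{w}\|\le 2n^{3/2}\|\mathbf{A}\|\|\mathbf{w}\|\epsilon_{mach}$. Overflow and underflow are ignored. Runtimes are in the unit-cost RAM model, the scalar function $f$ can be evaluated to relative error $\epsilon_{mach}$ in $O(1)$ time; $\mathrm{mv}(\mathbf{B})$ is the time to multiply $\mathbf{B}$ (or $\mathbf{B}^T$) by a vector to the required precision, with $\mathrm{mv}(\mathbf{B})=\Omega(n)$. Lanczos algorithm (input symmetric $\mathbf{A}$, number of iterations $k$, vector $\mathbf{x}$, function $f$): set $\mathbf{q}_0=\mathbf{0}$, $\mathbf{q}_1=\mathbf{x}/\|\mathbf{x}\|$, $\beta_1=0$. For $i=1,\dots,k$: $\mathbf{q}_{i+1}\leftarrow\mathbf{A}\mathbf{q}_i-\beta_i\mathbf{q}_{i-1}$;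 $\alpha_i\leftarrow\langle\mathbf{q}_{i+1},\mathbf{q}_i\rangle$; $\mathbf{q}_{i+1}\leftarrow\mathbf{q}_{i+1}-\alpha_i\mathbf{q}_i$; $\beta_{i+1}\leftarrow\|\mathbf{q}_{i+1}\|$; if $\beta_{i+1}=0$ exit the loop; $\mathbf{q}_{i+1}\leftarrow\mathbf{q}_{i+1}/\beta_{i+1}$. Let $\mathbf{T}$ be the symmetric tridiagonal matrix with diagonal $\alpha_1,\dots,\alpha_k$ and off-diagonal $\beta_2,\dots,\beta_k$, and $\mathbf{Q}=[\mathbf{q}_1,\dots,\mathbf{q}_k]$ (if the loop exits early at iteration $i$, use the first $i$ coefficients and vectors). Return $\mathbf{Q}f(\mathbf{T})\mathbf{e}_1$ (up to the scalar factor $\|\mathbf{x}\|$, which does not affect the ratio above). The final step is carried out in floating point using the Gu–Eisenstat tridiagonal eigendecomposition: for $ck^3\log k\cdot\epsilon_{mach}\le\epsilon_1\le 1/2$ ($c$ a fixed constant) it computes in $O(k^2\log\frac{k}{\epsilon_1}+k\log^2\frac{k}{\epsilon_1})$ time matrices $\tilde{\mathbf{V}}$ and diagonal $\tilde{\mathbf{\Lambda}}$ with $\|\tilde{\mathbf{V}}\tilde{\mathbf{\Lambda}}\tilde{\mathbf{V}}^T-\mathbf{T}\|\le\epsilon_1\|\mathbf{T}\|$ and $\|\tilde{\mathbf{V}}^T\tilde{\mathbf{V}}-\mathbf{I}\|\le\epsilon_1$; it is called with $\epsilon_1=2^{-\Theta(B)}$ for a suitable hidden constant, and $f(\mathbf{T})\mathbf{e}_1$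 is computed as $\tilde{\mathbf{V}}f(\tilde{\mathbf{\Lambda}})\tilde{\mathbf{V}}^T\mathbf{e}_1$. Asymptotic notation: the number of iterations and $\log(1/\epsilon_{mach})$ are taken to be suitable (sufficiently large) absolute constants times the indicated expressions, where each expression inside $O(\cdot)$ or $\Omega(\cdot)$ is read as at least $1$. $\log$ is the natural logarithm. *)

(* Defs.v *)
From HB Require Import structures.
From mathcomp Require Import all_boot all_order all_algebra.
From mathcomp Require Import classical_sets reals exp.

Set Implicit Arguments.
Unset Strict Implicit.
Unset Printing Implicit Defensive.

Import Order.TTheory GRing.Theory Num.Theory.
Local Open Scope classical_set_scope.
Local Open Scope ring_scope.

Section Norms.
Context {R : realType}.

(* MathComp-Analysis' canonical norm on matrices is the max norm, hence the
   explicit Euclidean norm. *)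
Definition enorm n (v : 'cV[R]_n) : R := Num.sqrt (\sum_i v i 0 ^+ 2).

Definition stretch m n (M : 'M[R]_(m, n)) (x : 'cV[R]_n) : R :=
  enorm (M *m x) / enorm x.

Definition specnorm m n (M : 'M[R]_(m, n)) : R :=
  sup [set stretch M x | x in [set x : 'cV[R]_n | x != 0]].

Definition sym_tridiag k (T : 'M[R]_k) : Prop :=
  T^T = T /\ forall i j : 'I_k, (i.+1 < j)%N -> T i j = 0.

(* An expression inside O(.), Omega(.) or Theta(.) is read as at least 1. *)
Definition at1 (x : R) : R := Num.max 1 x.

Definition natceil (x : R) : nat := absz (Num.ceil x).

(* Probability of E under independent fair coin flips indexed by I. *)
Definition coin_pr (I : finType) (E : pred {ffun I -> bool}) : R :=
  \sum_(s : {ffun I -> bool} | E s) \prod_(i : I) (1 / 2).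

End Norms.

(* Unit-cost computations: the computed value together with the number of
   machine steps spent. *)
Definition computation (T : Type) : Type := (T * nat)%type.

Definition value T (c : computation T) : T := c.1.
Definition time T (c : computation T) : nat := c.2.

Definition ret T (x : T) : computation T := (x, 0%N).
Definition tick T (x : T) : computation T := (x, 1%N).
Definition bind S T (c : computation S) (f : S -> computation T) : computation T :=
  (value (f (value c)), (time c + time (f (value c)))%N).

Notation "'let*' x ':=' c 'in' d" := (bind c (fun x => d))
  (at level 200, x name, c at level 200, d at level 200,
   format "'[v' 'let*'  x  ':='  c  'in' '/' d ']'").

Inductive arith := Add | Sub | Mul | Div.

Section Machine.
Context {R : realType}.

Definition exact_op (o : arith) (x y : R) : R :=
  match o with Add => x + y | Sub => x - y | Mul => x * y | Div => x / y end.

(* fl_op o x y is fl(x o y), and fl_sqrt x is fl(sqrt x). *)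
Record fpu := Fpu {
  fl_op : arith -> R -> R -> R;
  fl_sqrt : R -> R
}.

Definition rel_approx (eps computed exact : R) : Prop :=
  exists2 d : R, `|d| <= eps & computed = (1 + d) * exact.

(* Requirement 1; nothing is assumed about division by 0 or about square roots
   of negative numbers. *)
Definition requirement1 (eps : R) (F : fpu) : Prop :=
  (forall o x y, (o = Div -> y != 0) ->
     rel_approx eps (fl_op F o x y) (exact_op o x y)) /\
  (forall x, 0 <= x -> rel_approx eps (fl_sqrt F x) (Num.sqrt x)).

(* Multiplication by B^T B is performed as a multiplication by B followed by a
   multiplication by B^T. *)
Definition mul_gram m n (mulB : 'cV[R]_n -> computation 'cV[R]_m)
    (mulBt : 'cV[R]_m -> computation 'cV[R]_n) (w : 'cV[R]_n) : computation 'cV[R]_n :=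
  let* u := mulB w in mulBt u.

(* Requirement 2, for a routine mulA multiplying by the matrix A. *)
Definition requirement2 n (eps : R) (A : 'M[R]_n)
    (mulA : 'cV[R]_n -> computation 'cV[R]_n) : Prop :=
  forall w, enorm (value (mulA w) - A *m w)
    <= 2 * n%:R `^ (3 / 2) * specnorm A * enorm w * eps.

Definition eval_spec (eps C_f : R) (f : R -> R) (evalf : R -> computation R) : Prop :=
  forall x, rel_approx eps (value (evalf x)) (f x) /\
    (time (evalf x))%:R <= C_f.

(* The tridiagonal eigensolver: solver k T eps1 returns V together with the
   diagonal of Lambda. *)
Definition eigensolver : Type :=
  forall k : nat, 'M[R]_k -> R -> computation ('M[R]_k * 'rV[R]_k).

Definition eigensolver_spec (eps c_ge C_ge : R) (solver : eigensolver) : Prop :=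
  forall (k : nat) (T : 'M[R]_k) (eps1 : R),
    (0 < k)%N -> sym_tridiag T -> 0 < eps1 ->
    c_ge * k%:R ^+ 3 * ln k%:R * eps <= eps1 -> eps1 <= 1 / 2 ->
    let VL := value (solver k T eps1) in
    [/\ specnorm (VL.1 *m diag_mx VL.2 *m VL.1^T - T) <= eps1 * specnorm T,
        specnorm (VL.1^T *m VL.1 - 1%:M) <= eps1
      & (time (solver k T eps1))%:R
          <= C_ge * at1 (k%:R ^+ 2 * ln (k%:R / eps1)
                         + k%:R * ln (k%:R / eps1) ^+ 2)].

Section FloatingPoint.
Variable F : fpu.

Definition fadd x y : computation R := tick (fl_op F Add x y).
Definition fsub x y : computation R := tick (fl_op F Sub x y).
Definition fmul x y : computation R := tick (fl_op F Mul x y).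
Definition fdiv x y : computation R := tick (fl_op F Div x y).
Definition fsqrt x : computation R := tick (fl_sqrt F x).

(* Entrywise computation of a vector; storing an entry costs one step. *)
Definition mkcol n (e : 'I_n -> computation R) : computation 'cV[R]_n :=
  (\col_i value (e i), (\sum_i (time (e i)).+1)%N).

Definition fdot n (u v : 'cV[R]_n) : computation R :=
  foldl (fun acc i =>
           let* s := acc in let* p := fmul (u i 0) (v i 0) in fadd s p)
        (tick 0) (enum 'I_n).

Definition fnorm n (v : 'cV[R]_n) : computation R := let* s := fdot v v in fsqrt s.

(* w - a v *)
Definition faxpy n (w : 'cV[R]_n) (a : R) (v : 'cV[R]_n) : computation 'cV[R]_n :=
  mkcol (fun i => let* p := fmul a (v i 0) in fsub (w i 0) p).

Definition fscale n (v : 'cV[R]_n) (b : R) : computation 'cV[R]_n :=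
  mkcol (fun i => fdiv (v i 0) b).

Definition fmulmx m n (M : 'M[R]_(m, n)) (v : 'cV[R]_n) : computation 'cV[R]_m :=
  mkcol (fun i => fdot (row i M)^T v).

Section Lanczos.
Variables (n : nat) (mulA : 'cV[R]_n -> computation 'cV[R]_n).

(* With q = q_i, qprev = q_{i-1} and beta = beta_i, performs the iterations i,
   i + 1, ... (at most fuel of them) and returns the list of the triples
   (q_i, alpha_i, beta_i). *)
Fixpoint lanczos_loop (fuel : nat) (qprev q : 'cV[R]_n) (beta : R) :
    computation (seq ('cV[R]_n * R * R)) :=
  if fuel isn't fuel'.+1 then ret [::] else
  let* w0 := mulA q in
  let* w1 := faxpy w0 beta qprev in
  let* alpha := fdot w1 q in
  let* w2 := faxpy w1 alpha q in
  let* beta' := fnorm w2 in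
  let* stop := tick (beta' == 0) in
  if stop then ret [:: (q, alpha, beta)] else
  let* q' := fscale w2 beta' in
  let* rest := lanczos_loop fuel' q q' beta' in
  tick ((q, alpha, beta) :: rest).

Definition lanczos_iterations (k : nat) (x : 'cV[R]_n) :
    computation (seq ('cV[R]_n * R * R)) :=
  let* nx := fnorm x in
  let* q1 := fscale x nx in
  lanczos_loop k 0 q1 0.

Definition entry0 : 'cV[R]_n * R * R := (0, 0, 0).
Definition vec_at l i : 'cV[R]_n := (nth entry0 l i).1.1.
Definition alpha_at l i : R := (nth entry0 l i).1.2.
Definition beta_at l i : R := (nth entry0 l i).2.

Definition Qmx (l : seq ('cV[R]_n * R * R)) : 'M[R]_(n, size l) :=
  \matrix_(i, j) vec_at l j i 0.

Definition Tmx (l : seq ('cV[R]_n * R * R)) : 'M[R]_(size l) :=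
  \matrix_(i, j)
    if i == j then alpha_at l i
    else if j == i.+1 :> nat then beta_at l j
    else if i == j.+1 :> nat then beta_at l i
    else 0.

(* V f(Lambda) V^T e_1, evaluated from right to left *)
Definition apply_fun (evalf : R -> computation R) k (V : 'M[R]_k) (L : 'rV[R]_k) :
    computation 'cV[R]_k :=
  let* e1 := mkcol (fun i : 'I_k => ret (i == 0%N :> nat)%:R) in
  let* u := fmulmx V^T e1 in
  let* w := mkcol (fun i => let* d := evalf (L 0 i) in fmul d (u i 0)) in
  fmulmx V w.

Definition lanczos (solver : eigensolver) (eps1 : R) (evalf : R -> computation R)
    (k : nat) (x : 'cV[R]_n) : computation 'cV[R]_n :=
  let* l := lanczos_iterations k x in
  let* VL := solver _ (Tmx l) eps1 in
  let* w := apply_fun evalf VL.1 VL.2 in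
  fmulmx (Qmx l) w.

Definition sign_vector (s : {ffun 'I_n -> bool}) : computation 'cV[R]_n :=
  mkcol (fun i => tick (if s i then 1 else -1)).

Definition random_lanczos (solver : eigensolver) (eps1 : R)
    (evalf : R -> computation R) (k : nat) (s : {ffun 'I_n -> bool}) : computation 'cV[R]_n :=
  let* z := sign_vector s in
  lanczos solver eps1 evalf k z.

End Lanczos.
End FloatingPoint.
End Machine.

Arguments fpu : clear implicits.
Arguments eigensolver : clear implicits.

(* Main.v *)
(* With A = B^T B and z = the sign vector, the exact power y = A^q z satisfies
   |By|/|y| >= (1 - Delta/2) |B|: the sequence |z|, |Bz|, |Az|, |BAz|, ... is
   log-convex, so the last ratio is at least the geometric mean
   (|y|/|z|)^(1/(2q)), and |y| >= |B|^(2q) |<v, z>| for a unit top singular vector v.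
   Flipping the sign of z at the largest coordinate of v changes <v, z> by twice
   that coordinate, so for at least half of the sign vectors |<v, z>| is bounded
   below by it.

   It remains to show that k steps of finite-precision Lanczos approximate
   A^q z up to |A|^q times a small power of Delta/n. The computed vectors satisfy
   the three-term recurrence A Q = Q T + (small), and consecutive ones are nearly
   orthonormal, although orthogonality is lost globally. Expanding x^q in
   Chebyshev polynomials with nonnegative coefficients chebc q j, the terms of
   degree j < k are reproduced exactly up to an error which propagates through the
   Chebyshev recurrence, and the terms of degree j >= k have a tiny total weight.
   Both claims need |T| <= |A| up to a small relative error. That bound uses no global
   orthogonality: if s solves the leading J equations of (theta - T) s = 0 and
   g = sum_l s_l q_l, then <g, (theta - A) g> differs from the Schur complement
   of theta - T at coordinate J by terms involving only neighbouring q_l, so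
   theta - A >= 0 forces that Schur complement to be nearly nonnegative, and
   theta is adjusted by a small amount at each of the k steps. *)
From HB Require Import structures.
Require Import Defs.
From mathcomp Require Import all_boot all_order all_algebra.
From mathcomp Require Import boolp classical_sets reals sequences exp.
From mathcomp Require Import ring lra zify.

Set Implicit Arguments.
Unset Strict Implicit.
Unset Printing Implicit Defensive.

Import Order.TTheory GRing.Theory Num.Theory.
Local Open Scope ring_scope.

(** * Euclidean and spectral norms *)

Section Euclidean.
Context {R : realType}.

(** No spectral theorem is used. Symmetric matrices are compared through quadratic forms, the top
    singular vector is a kernel vector of |B|^2 - B^T B, and Chebyshev polynomials of a contraction
    are bounded by Pell's identity T_j^2 + (1 - x^2) U_{j-1}^2 = 1. All accuracy is counted in
    powers of N = n/Delta >= 2. The exact power A^q q_1 is only known to have norm at least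
    |A|^q/(2n), and a relative error Delta/4 is allowed, so the Lanczos error has to stay below
    |A|^q/(8N). Iteration count, q, numerical constants and precisions are each bounded by a power
    of N, and exponents are compared. They are fixed in the order iterations, eigensolver accuracy,
    machine precision. The bound on |T| presupposes some bound on its entries, so the coefficients
    are controlled twice: crudely, beta_i <= (1 + 7k)|A|, by following single iterations, and then
    sharply, |T| <= (1 + small)|A|. The small term has to survive a q-th power. Early exit needs no
    separate analysis of the power: vectors past the end of the list default to 0, so the recurrence
    then holds for the last column as well. *)

Definition dot n (u v : 'cV[R]_n) : R := \sum_i u i 0 * v i 0.

Section Dot.
Variable n : nat.
Implicit Types u v w : 'cV[R]_n.

Lemma dotC u v : dot u v = dot v u.
Proof. by apply: eq_bigr => i _; rewrite mulrC. Qed.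

Lemma dotDl u v w : dot (u + v) w = dot u w + dot v w.
Proof. by rewrite -big_split; apply: eq_bigr => i _; rewrite mxE mulrDl. Qed.

Lemma dotZl a u v : dot (a *: u) v = a * dot u v.
Proof. by rewrite mulr_sumr; apply: eq_bigr => i _; rewrite mxE mulrA. Qed.

Lemma dotNl u v : dot (- u) v = - dot u v.
Proof. by rewrite -scaleN1r dotZl mulN1r. Qed.

Lemma dotBl u v w : dot (u - v) w = dot u w - dot v w.
Proof. by rewrite dotDl dotNl. Qed.

Lemma dotDr u v w : dot w (u + v) = dot w u + dot w v.
Proof. by rewrite !(dotC w) dotDl. Qed.

Lemma dotZr a u v : dot u (a *: v) = a * dot u v.
Proof. by rewrite !(dotC u) dotZl. Qed.

Lemma dotNr u v : dot u (- v) = - dot u v.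
Proof. by rewrite !(dotC u) dotNl. Qed.

Lemma dotBr u v w : dot w (u - v) = dot w u - dot w v.
Proof. by rewrite !(dotC w) dotBl. Qed.

Lemma dot0l v : dot 0 v = 0.
Proof. by rewrite -(scale0r 0) dotZl mul0r. Qed.

Lemma dot0r v : dot v 0 = 0.
Proof. by rewrite dotC dot0l. Qed.

Definition dotE := (dotDl, dotDr, dotBl, dotBr, dotNl, dotNr, dotZl, dotZr, dot0l, dot0r).

Lemma dot_suml (I : finType) (P : pred I) (f : I -> 'cV[R]_n) v :
  dot (\sum_(i | P i) f i) v = \sum_(i | P i) dot (f i) v.
Proof.
by elim/big_rec2: _ => [|i a b _ <-]; rewrite ?dotDl ?dot0l.
Qed.

Lemma dot_ge0 v : 0 <= dot v v.
Proof. by apply: sumr_ge0 => i _; rewrite -expr2 sqr_ge0. Qed.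

Lemma dot_eq0 v : dot v v = 0 -> v = 0.
Proof.
move/eqP; rewrite psumr_eq0 => [/allP h|i _]; last by rewrite -expr2 sqr_ge0.
apply/matrixP => i j; rewrite ord1 !mxE; apply/eqP.
by have := h i (mem_index_enum i); rewrite mulf_eq0 orbb.
Qed.

Lemma enorm_sqr v : enorm v ^+ 2 = dot v v.
Proof.
rewrite /enorm sqr_sqrtr; first by apply: eq_bigr => i _; rewrite expr2.
by apply: sumr_ge0 => i _; rewrite sqr_ge0.
Qed.

Lemma enorm_ge0 v : 0 <= enorm v.
Proof. exact: sqrtr_ge0. Qed.
Hint Resolve enorm_ge0 : core.

Lemma enormE v : enorm v = Num.sqrt (dot v v).
Proof. by rewrite -enorm_sqr sqrtr_sqr ger0_norm. Qed.

Lemma enorm0 : enorm (0 : 'cV[R]_n) = 0.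
Proof. by rewrite enormE dot0l sqrtr0. Qed.

Lemma enorm_eq0 v : (enorm v == 0) = (v == 0).
Proof.
apply/eqP/eqP => [h|->]; last exact: enorm0.
by apply: dot_eq0; rewrite -enorm_sqr h expr0n.
Qed.

Lemma enorm_gt0 v : (0 < enorm v) = (v != 0).
Proof. by rewrite lt0r enorm_ge0 andbT enorm_eq0. Qed.

Lemma enormZ a v : enorm (a *: v) = `|a| * enorm v.
Proof.
by rewrite !enormE dotZl dotZr mulrA -expr2 sqrtrM ?sqr_ge0// sqrtr_sqr.
Qed.

Lemma enormN v : enorm (- v) = enorm v.
Proof. by rewrite -scaleN1r enormZ normrN1 mul1r. Qed.

Lemma enorm_le v c : 0 <= c -> (enorm v <= c) = (dot v v <= c ^+ 2).
Proof. by move=> c0; rewrite -enorm_sqr ler_sqr ?nnegrE. Qed.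

End Dot.

(** Stated without a sign condition on c, so that it yields Cauchy-Schwarz both for the inner
    product and for any positive semidefinite form. *)
Lemma discr_le (a b c : R) :
  (forall t, 0 <= a + 2 * t * b + t ^+ 2 * c) -> b ^+ 2 <= a * c.
Proof.
move=> h; have a0 : 0 <= a by have := h 0; rewrite !(mulr0, mul0r, expr0n, addr0).
have [c0|c0|c0] := ltgtP c 0.
(* For c < 0 this t makes t c = c - a - 2|b|, so the quadratic equals a(1 - t) - 2t(|b| - b) + t c,
   which is negative. *)
- exfalso; pose t := 1 + (a + 2 * `|b|) / - c.
  have ct : t * c = c - a - 2 * `|b| by rewrite /t; field; rewrite lt_eqF.
  have t1 : 1 <= t.
    by rewrite lerDl divr_ge0 ?addr_ge0 ?mulr_ge0// oppr_ge0 ltW.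
  clearbody t.
  have h1 : 0 <= a * (t - 1) by rewrite mulr_ge0 // subr_ge0.
  have h2 : 0 <= t * (`|b| - b) by rewrite mulr_ge0 ?subr_ge0 ?ler_norm//; lra.
  have h3 : t * c < 0 by rewrite pmulr_rlt0//; lra.
  have e : t ^+ 2 * c = t * (t * c) by ring.
  by have := h t; rewrite e ct; lra.
- have := h (- b / c); rewrite !exprMn exprVn sqrrN => h1.
  suff : 0 <= a - b ^+ 2 / c by rewrite subr_ge0 ler_pdivrMr.
  by apply: le_trans h1 _; rewrite le_eqVlt; apply/orP; left; apply/eqP; field; rewrite gt_eqF.
- rewrite c0 mulr0; have [->|b0] := eqVneq b 0; first by rewrite expr0n.
  have := h (- (a + 1) / (2 * b)); rewrite c0 mulr0 addr0.
  have -> : 2 * (- (a + 1) / (2 * b)) * b = - (a + 1) by field.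
  by lra.
Qed.

Lemma CauchySchwarz_sqr n (u v : 'cV[R]_n) : dot u v ^+ 2 <= dot u u * dot v v.
Proof.
apply: discr_le => t; have := dot_ge0 (u + t *: v).
by rewrite !dotE (dotC v u); congr (_ <= _); ring.
Qed.

Lemma dot_le n (u v : 'cV[R]_n) : `|dot u v| <= enorm u * enorm v.
Proof.
rewrite -ler_sqr ?nnegrE ?mulr_ge0 ?enorm_ge0//.
by rewrite exprMn !enorm_sqr real_normK ?num_real// CauchySchwarz_sqr.
Qed.

Lemma enormD n (u v : 'cV[R]_n) : enorm (u + v) <= enorm u + enorm v.
Proof.
rewrite enorm_le ?addr_ge0 ?enorm_ge0// !dotE (dotC v u) sqrrD !enorm_sqr.
by have := ler_norm (dot u v); have := dot_le u v; lra.
Qed.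

Lemma enormB n (u v : 'cV[R]_n) : enorm (u - v) <= enorm u + enorm v.
Proof. by rewrite -(enormN v) enormD. Qed.

Lemma enorm_sum n (I : Type) (r : seq I) (P : pred I) (f : I -> 'cV[R]_n) :
  enorm (\sum_(i <- r | P i) f i) <= \sum_(i <- r | P i) enorm (f i).
Proof.
elim/big_rec2: _ => [|i a b _ h]; first by rewrite enorm0.
by apply: le_trans (enormD _ _) _; rewrite lerD2l.
Qed.

Lemma le_enorm_diff n (u v : 'cV[R]_n) : enorm u <= enorm v + enorm (u - v).
Proof. by rewrite -[X in enorm X <= _](subrK v) addrC enormD. Qed.

Lemma coord_le n (v : 'cV[R]_n) i : `|v i 0| <= enorm v.
Proof.
rewrite -ler_sqr ?nnegrE ?enorm_ge0// enorm_sqr real_normK ?num_real//.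
rewrite /dot (bigD1 i)//= -expr2 lerDl; apply: sumr_ge0 => j _.
by rewrite -expr2 sqr_ge0.
Qed.

Lemma enorm_pointwise n (u v : 'cV[R]_n) (c : R) :
  0 <= c -> (forall i, `|u i 0| <= c * `|v i 0|) -> enorm u <= c * enorm v.
Proof.
move=> c0 h; rewrite enorm_le ?mulr_ge0 ?enorm_ge0// exprMn enorm_sqr mulr_sumr.
apply: ler_sum => i _; rewrite -!expr2 -exprMn.
by rewrite -[leLHS]real_normK ?num_real// -[leRHS]real_normK ?num_real// ler_sqr
  ?nnegrE// normrM (ger0_norm c0).
Qed.

Lemma dot_mulmx m n (M : 'M[R]_(m, n)) u v : dot (M *m u) v = dot u (M^T *m v).
Proof.
rewrite /dot.
under eq_bigr do rewrite mxE mulr_suml.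
rewrite exchange_big; apply: eq_bigr => j _; rewrite mxE mulr_sumr.
by apply: eq_bigr => i _; rewrite !mxE; ring.
Qed.

Lemma mulmx_col m n (M : 'M[R]_(m, n)) (x : 'cV[R]_n) :
  M *m x = \sum_j x j 0 *: col j M.
Proof.
apply/matrixP => i j; rewrite ord1 mxE summxE.
by apply: eq_bigr => l _; rewrite !mxE mulrC.
Qed.

(** Squared Frobenius norm. It bounds the set of stretches, so that the supremum in [specnorm] is
    meaningful, and it is the norm in which entrywise rounding errors of a product come out
    naturally. *)
Definition fnorm2 m n (M : 'M[R]_(m, n)) : R := \sum_i \sum_j M i j ^+ 2.

Lemma fnorm2_ge0 m n (M : 'M[R]_(m, n)) : 0 <= fnorm2 M.
Proof. by apply: sumr_ge0 => i _; apply: sumr_ge0 => j _; rewrite sqr_ge0. Qed.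

Lemma fnorm2_col m n (M : 'M[R]_(m, n)) :
  fnorm2 M = \sum_j enorm (col j M) ^+ 2.
Proof.
rewrite /fnorm2 exchange_big; apply: eq_bigr => j _; rewrite enorm_sqr.
by apply: eq_bigr => i _; rewrite mxE expr2.
Qed.

Lemma fnorm2_row m n (M : 'M[R]_(m, n)) :
  fnorm2 M = \sum_i enorm (row i M)^T ^+ 2.
Proof.
apply: eq_bigr => i _; rewrite enorm_sqr.
by apply: eq_bigr => j _; rewrite !mxE expr2.
Qed.

Lemma mulmx_dot m n (M : 'M[R]_(m, n)) (x : 'cV[R]_n) i :
  (M *m x) i 0 = dot (row i M)^T x.
Proof. by rewrite mxE; apply: eq_bigr => j _; rewrite !mxE. Qed.

Lemma enorm_mulmx_fnorm2 m n (M : 'M[R]_(m, n)) (x : 'cV[R]_n) :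
  enorm (M *m x) <= Num.sqrt (fnorm2 M) * enorm x.
Proof.
rewrite enorm_le ?mulr_ge0 ?sqrtr_ge0 ?enorm_ge0//.
rewrite exprMn sqr_sqrtr ?fnorm2_ge0// fnorm2_row mulr_suml.
apply: ler_sum => i _; rewrite mulmx_dot -expr2 !enorm_sqr.
exact: CauchySchwarz_sqr.
Qed.

Lemma stretch_has_sup m n (M : 'M[R]_(m, n)) (x : 'cV[R]_n) : x != 0 ->
  has_sup [set stretch M x | x in [set x : 'cV[R]_n | x != 0]]%classic.
Proof.
move=> x0; split; first by exists (stretch M x), x.
exists (Num.sqrt (fnorm2 M)) => _ [y /= y0 <-].
by rewrite ler_pdivrMr ?enorm_gt0// enorm_mulmx_fnorm2.
Qed.

Lemma stretch_le m n (M : 'M[R]_(m, n)) (x : 'cV[R]_n) :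
  x != 0 -> stretch M x <= specnorm M.
Proof.
move=> x0; apply: (sup_upper_bound (stretch_has_sup M x0)).
by exists x.
Qed.

Lemma enorm_mulmx m n (M : 'M[R]_(m, n)) (x : 'cV[R]_n) :
  enorm (M *m x) <= specnorm M * enorm x.
Proof.
have [->|x0] := eqVneq x 0; first by rewrite mulmx0 !enorm0 mulr0.
by rewrite -ler_pdivrMr ?enorm_gt0// stretch_le.
Qed.

(** When there is no nonzero vector the supremum is that of the empty set, whose default value is 0;
    this is where 0 <= c enters. *)
Lemma specnorm_le m n (M : 'M[R]_(m, n)) c : 0 <= c ->
  (forall x, enorm (M *m x) <= c * enorm x) -> specnorm M <= c.
Proof.
move=> c0 h; rewrite /specnorm.
have [[y [x x0 _]]|] := pselect
    ([set stretch M x | x in [set x : 'cV[R]_n | x != 0]] !=set0)%classic.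
  apply: ge_sup; first by exists (stretch M x), x.
  by move=> _ [z z0 <-]; rewrite ler_pdivrMr ?enorm_gt0.
by move=> hn; rewrite sup_out// => -[].
Qed.

Lemma specnorm_ge0 m n (M : 'M[R]_(m, n)) : 0 <= specnorm M.
Proof.
have [[x x0]|hn] := pselect (exists x : 'cV[R]_n, x != 0).
  apply: le_trans (stretch_le M x0); rewrite divr_ge0 ?enorm_ge0//.
by rewrite /specnorm sup_out// => -[[y [x x0 _]] _]; apply: hn; exists x.
Qed.

Lemma enorm_trmulmx m n (M : 'M[R]_(m, n)) (x : 'cV[R]_m) :
  enorm (M^T *m x) <= specnorm M * enorm x.
Proof.
have [->|x0] := eqVneq (M^T *m x) 0.
  by rewrite enorm0 mulr_ge0 ?specnorm_ge0 ?enorm_ge0.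
rewrite -(ler_pM2l (_ : 0 < enorm (M^T *m x))) ?enorm_gt0//.
rewrite -expr2 enorm_sqr -dot_mulmx mulrA [enorm _ * _]mulrC.
apply: le_trans (ler_norm _) _; apply: le_trans (dot_le _ _) _.
by rewrite ler_wpM2r ?enorm_ge0 ?enorm_mulmx.
Qed.

End Euclidean.

(** * Top singular vector and growth of exact powers *)

Section SingularVectors.
Context {R : realType}.

Lemma gram_sym m n (B : 'M[R]_(m, n)) : (B^T *m B)^T = B^T *m B.
Proof. by rewrite trmx_mul trmxK. Qed.

Lemma dot_gram m n (B : 'M[R]_(m, n)) u v :
  dot u (B^T *m B *m v) = dot (B *m u) (B *m v).
Proof. by rewrite -mulmxA dot_mulmx. Qed.

Lemma psd_CauchySchwarz n (P : 'M[R]_n) : P^T = P ->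
  (forall x, 0 <= dot x (P *m x)) ->
  forall x y, dot x (P *m y) ^+ 2 <= dot x (P *m x) * dot y (P *m y).
Proof.
move=> Psym Ppsd x y; apply: discr_le => t; have := Ppsd (x + t *: y).
rewrite mulmxDr -scalemxAr !dotE (dotC y (P *m x)) dot_mulmx Psym.
by congr (_ <= _); ring.
Qed.

(** Replaces the smallest eigenvalue. With y = P x, invertibility gives |x|^2 <= f |y|^2, and
    Cauchy-Schwarz for the form of P gives |y|^4 <= <y, P y> <x, P x> <= p |y|^2 <x, P x>. *)
Lemma psd_invertible_coercive n (P : 'M[R]_n) : P^T = P -> P \in unitmx ->
  (forall x, 0 <= dot x (P *m x)) ->
  exists2 c, 0 < c & forall x, c * dot x x <= dot x (P *m x).
Proof.
move=> Psym Punit Ppsd.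
set f := fnorm2 (invmx P) + 1; set p := specnorm P + 1.
have f0 : 0 < f by rewrite ltr_wpDl ?fnorm2_ge0.
have p0 : 0 < p by rewrite ltr_wpDl ?specnorm_ge0.
exists (f * p)^-1 => [|x]; first by rewrite invr_gt0 mulr_gt0.
rewrite mulrC ler_pdivrMr ?mulr_gt0//; set y := P *m x.
have h1 : dot x x <= f * dot y y.
  have -> : x = invmx P *m y by rewrite mulKmx.
  rewrite -!enorm_sqr; apply: (@le_trans _ _ (fnorm2 (invmx P) * enorm y ^+ 2)).
    rewrite -[fnorm2 _]sqr_sqrtr ?fnorm2_ge0// -exprMn ler_sqr ?nnegrE ?enorm_ge0//.
      exact: enorm_mulmx_fnorm2.
    by rewrite mulr_ge0 ?sqrtr_ge0 ?enorm_ge0.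
  by rewrite ler_wpM2r ?sqr_ge0// lerDl.
have h2 : dot y y <= p * dot x (P *m x).
  have [y0|y0] := eqVneq (dot y y) 0.
    by rewrite y0 mulr_ge0// ltW.
  have yp : 0 < dot y y by rewrite lt0r y0 dot_ge0.
  rewrite -(ler_pM2l yp) -expr2.
  apply: le_trans (psd_CauchySchwarz Psym Ppsd y x) _.
  rewrite mulrA ler_wpM2r//; apply: le_trans (ler_norm _) _.
  apply: le_trans (dot_le _ _) _; rewrite -!enorm_sqr expr2 -mulrA.
  rewrite ler_wpM2l ?enorm_ge0// mulrC; apply: le_trans (enorm_mulmx _ _) _.
  by rewrite ler_wpM2r ?enorm_ge0// lerDl.
apply: le_trans h1 _; rewrite (_ : _ * (f * p) = f * (p * dot x (P *m x))).
  by rewrite ler_pM2l.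
by ring.
Qed.

Lemma specnorm_gt0 m n (B : 'M[R]_(m, n)) : B != 0 -> 0 < specnorm B.
Proof.
move=> B0; rewrite lt0r specnorm_ge0 andbT; apply: contraNneq B0 => s0.
apply/eqP/matrixP => i j; rewrite mxE.
have := enorm_mulmx B (delta_mx j 0); rewrite s0 mul0r => h.
have /eqP : enorm (B *m delta_mx j 0) == 0 by rewrite eq_le h enorm_ge0.
move=> /eqP; rewrite enorm_eq0 -colE => /eqP/matrixP/(_ i 0).
by rewrite !mxE.
Qed.

(** Attainment without compactness: if s^2 - B^T B were invertible it would be coercive, and every
    stretch would be at most sqrt(s^2 - c) < s, contradicting the supremum. *)
Lemma top_singular_vector m n (B : 'M[R]_(m, n)) : B != 0 ->
  exists2 v : 'cV[R]_n, v != 0 & B^T *m B *m v = specnorm B ^+ 2 *: v.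
Proof.
move=> B0; have s0 := specnorm_gt0 B0; set s := specnorm B in s0 *.
set P := (s ^+ 2)%:M - B^T *m B.
have PE x : P *m x = s ^+ 2 *: x - B^T *m B *m x.
  by rewrite mulmxBl mul_scalar_mx.
have Psym : P^T = P by rewrite /P linearB /= tr_scalar_mx gram_sym.
have PdE x : dot x (P *m x) = s ^+ 2 * dot x x - dot (B *m x) (B *m x).
  by rewrite PE dotBr dotZr dot_gram.
have [/det0P[v v0 vP]|dP] := boolP (\det P == 0).
  exists v^T; first by apply: contraNneq v0 => h; rewrite -[v]trmxK h trmx0.
  apply/esym/eqP; rewrite -subr_eq0 -PE -[P]Psym -trmx_mul vP trmx0; exact: eqxx.
have Ppsd x : 0 <= dot x (P *m x).
  rewrite PdE subr_ge0 -!enorm_sqr -exprMn ler_sqr ?nnegrE ?mulr_ge0 ?enorm_ge0 ?enorm_mulmx//.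
  exact: ltW.
have [|c c0 hc] := psd_invertible_coercive Psym _ Ppsd.
  by rewrite unitmxE unitfE.
(* The minimum with s^2 keeps the radicand nonnegative; it is still positive, so the bound is
   strictly below s. *)
exfalso; have : s <= Num.sqrt (s ^+ 2 - Num.min c (s ^+ 2)).
  apply: specnorm_le; first exact: sqrtr_ge0.
  move=> x; rewrite enorm_le ?mulr_ge0 ?sqrtr_ge0 ?enorm_ge0// exprMn sqr_sqrtr.
    have := hc x; rewrite PdE enorm_sqr; have := dot_ge0 x => dx h.
    have : Num.min c (s ^+ 2) * dot x x <= c * dot x x.
      by rewrite ler_wpM2r// ge_min lexx.
    by rewrite mulrBl; lra.
  by rewrite subr_ge0 ge_min lexx orbT.
rewrite leNgt => /negP; apply; rewrite -[ltRHS](ger0_norm (ltW s0)) -sqrtr_sqr.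
rewrite ltr_sqrt ?exprn_gt0//; rewrite gtrBl lt_min c0 exprn_gt0//.
Qed.

Lemma top_singular_stretch m n (B : 'M[R]_(m, n)) (v : 'cV[R]_n) :
  v != 0 -> B^T *m B *m v = specnorm B ^+ 2 *: v -> stretch B v = specnorm B.
Proof.
move=> v0 hv; rewrite /stretch; apply: (canLR (mulfK _)); first by rewrite enorm_eq0.
rewrite !enormE -dot_gram hv dotZr sqrtrM ?sqr_ge0// sqrtr_sqr ger0_norm//.
exact: specnorm_ge0.
Qed.

Lemma dot_iter_eigen n (A : 'M[R]_n) (v x : 'cV[R]_n) a q : A^T = A ->
  A *m v = a *: v -> dot v (iter q (mulmx A) x) = a ^+ q * dot v x.
Proof.
move=> Asym hv; elim: q => [|q IH] /=; first by rewrite mul1r.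
by rewrite -[A in A *m _]Asym -dot_mulmx hv dotZl IH exprS mulrA.
Qed.

(** Division-free form of: the ratio b_{j+1}/b_j is at least the geometric mean of all earlier
    ratios. In the induction, (b_j b_{j+2})^(j+1) bounds b_{j+1}^(2j+2) and the factor b_{j+1}^j
    cancels. *)
Lemma logconvex_power (b : nat -> R) j : (forall i, 0 <= b i) ->
  (forall i, b i.+1 ^+ 2 <= b i * b i.+2) ->
  b j ^+ j.+1 <= b 0%N * b j.+1 ^+ j.
Proof.
move=> b0 hb; elim: j => [|j IH]; first by rewrite expr1 expr0 mulr1.
have [h|h] := eqVneq (b j.+1) 0.
  by rewrite h expr0n /= mulr_ge0 ?exprn_ge0.
have hp : 0 < b j.+1 by rewrite lt0r h b0.
rewrite -(ler_pM2l (exprn_gt0 j hp)) -exprD (_ : (j + j.+2 = 2 * j.+1)%N);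
  last by rewrite mul2n -addnn addnS addSn.
rewrite exprM; apply: (@le_trans _ _ ((b j * b j.+2) ^+ j.+1)).
  by rewrite lerXn2r ?nnegrE ?exprn_ge0 ?mulr_ge0.
rewrite exprMn mulrA [b j.+1 ^+ j * _]mulrC; rewrite ler_wpM2r ?exprn_ge0//.
Qed.

Lemma gram_power_logconvex m n (B : 'M[R]_(m, n)) (x : 'cV[R]_n) q :
  enorm (iter q (mulmx (B^T *m B)) x) ^+ (2 * q).+1 <=
  enorm x * enorm (B *m iter q (mulmx (B^T *m B)) x) ^+ (2 * q).
Proof.
pose c i : 'cV_n := iter i (mulmx (B^T *m B)) x.
(* With A = B^T B, the sequence b lists the norms of x, Bx, Ax, BAx, A^2x, ...
   and is log-convex by Cauchy-Schwarz. *)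
pose b j := if odd j then enorm (B *m c j./2) else enorm (c j./2).
have bE i : b (2 * i)%N = enorm (c i) by rewrite /b mul2n odd_double doubleK.
have bO i : b (2 * i).+1 = enorm (B *m c i).
  by rewrite /b /= mul2n odd_double /= uphalf_double.
have -> : enorm (iter q (mulmx (B^T *m B)) x) = b (2 * q)%N by rewrite bE.
have -> : enorm (B *m iter q (mulmx (B^T *m B)) x) = b (2 * q).+1 by rewrite bO.
have -> : enorm x = b 0%N by [].
apply: logconvex_power => [i|i]; first by rewrite /b; case: ifP; rewrite enorm_ge0.
have -> : b i.+2 = if odd i then enorm (B *m c i./2.+1) else enorm (c i./2.+1).
  by rewrite /b /= negbK.
have hB u : enorm (B *m u) ^+ 2 <= enorm u * enorm (B^T *m B *m u).
  by rewrite enorm_sqr -dot_gram; apply: le_trans (ler_norm _) (dot_le _ _).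
have hA u : enorm (B^T *m B *m u) ^+ 2 <= enorm (B *m u) * enorm (B *m (B^T *m B *m u)).
  rewrite enorm_sqr dot_gram dotC.
  by apply: le_trans (ler_norm _) (dot_le _ _).
by rewrite /b /= uphalf_half; case: (odd i); [exact: hA|exact: hB].
Qed.

End SingularVectors.

(** * Chebyshev expansions of powers *)

Section Chebyshev.
Context {R : realType}.

(* The pair (T_j(f) v, U_{j-1}(f) v). *)
Fixpoint chebTU (V : lmodType R) (f : V -> V) (v : V) (j : nat) : V * V :=
  if j is j'.+1 then
    let tu := chebTU f v j' in (f tu.1 - (tu.2 - f (f tu.2)), f tu.2 + tu.1)
  else (v, 0).

Definition chebT (V : lmodType R) (f : V -> V) v j := (chebTU f v j).1.
Definition chebU (V : lmodType R) (f : V -> V) v j := (chebTU f v j).2.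

Section Recurrences.
Variables (V : lmodType R) (f : {linear V -> V}) (v : V).

Lemma chebT1 : chebT f v 1 = f v.
Proof. by rewrite /chebT /= !linear0 addr0 subr0. Qed.

Lemma chebU1 : chebU f v 1 = v.
Proof. by rewrite /chebU /= linear0 add0r. Qed.

Lemma chebTSS j : chebT f v j.+2 = 2 *: f (chebT f v j.+1) - chebT f v j.
Proof.
rewrite /chebT /=; case: (chebTU f v j) => t u /=.
rewrite scaler_nat mulr2n -[RHS]addrA; congr (_ + _).
rewrite !opprB !(linearB, linearD) /= !addrA; congr (_ - _).
by rewrite [f (f t) + _]addrC.
Qed.

Lemma chebUSS j : chebU f v j.+2 = 2 *: f (chebU f v j.+1) - chebU f v j.
Proof.
rewrite /chebU /=; case: (chebTU f v j) => t u /=.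
rewrite scaler_nat mulr2n -[RHS]addrA; congr (_ + _).
by rewrite opprB linearD /= addrA [f t + _]addrC.
Qed.

End Recurrences.

(* Coefficients of x^q in the Chebyshev basis. *)
Fixpoint chebc (q j : nat) : R :=
  if q is q'.+1 then
    (match j with 0 => 0 | 1 => chebc q' 0 | j'.+2 => chebc q' j'.+1 / 2 end)
    + chebc q' j.+1 / 2
  else (j == 0%N)%:R.

Lemma chebc_ge0 q j : 0 <= chebc q j.
Proof.
elim: q j => [|q IH] [|[|j]] //=; rewrite ?addr_ge0 ?mulr_ge0 ?invr_ge0//.
Qed.

Lemma chebc_gt q j : (q < j)%N -> chebc q j = 0.
Proof.
elim: q j => [|q IH] [|[|j]] //= h; rewrite !IH ?mul0r ?addr0//; lia.
Qed.

(** Follows from x T_0 = T_1 and x T_{j+1} = (T_j + T_{j+2})/2, which are exactly the rules by which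
    [chebc] passes from q to q + 1. *)
Lemma iter_chebT (V : lmodType R) (f : {linear V -> V}) (v : V) q :
  iter q f v = \sum_(j < q.+1) chebc q j *: chebT f v j.
Proof.
elim: q => [|q IH]; first by rewrite big_ord1 /= scale1r.
have half (w : V) : w = 2^-1 *: w + 2^-1 *: w.
  by rewrite -scalerDl -div1r -splitr scale1r.
have fT j : f (chebT f v j.+1) = 2^-1 *: chebT f v j + 2^-1 *: chebT f v j.+2.
  rewrite chebTSS scalerBr scalerA mulVf ?pnatr_eq0// scale1r.
  by rewrite addrC subrK.
rewrite iterS IH linear_sum /= big_ord_recl linearZ /= -[f (chebT f v 0)](chebT1 f v).
under eq_bigr do rewrite linearZ /= fT scalerDr !scalerA.
rewrite big_split /= [RHS]big_ord_recl [in RHS]big_ord_recl /=.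
under [in RHS]eq_bigr do rewrite scalerDl.
rewrite [in RHS]big_split /= add0r.
(* The sum is lengthened by two terms, zero because the coefficients vanish beyond degree q, so that
   its first two terms can be split off even for small q. *)
have E : \sum_(i < q) (chebc q i.+1 / 2) *: chebT f v i =
   (chebc q 1 / 2) *: chebT f v 0 + ((chebc q 2 / 2) *: chebT f v 1
   + \sum_(i < q) (chebc q i.+3 / 2) *: chebT f v i.+2).
  have <- : \sum_(i < q.+2) (chebc q i.+1 / 2) *: chebT f v i =
    \sum_(i < q) (chebc q i.+1 / 2) *: chebT f v i.
    by rewrite 2!big_ord_recr /= !chebc_gt// !mul0r !scale0r !addr0.
  by rewrite 2!big_ord_recl /=.
rewrite E scalerDl.
have shuffle (x y z t w : V) : x + (y + (z + t) + w) = y + (x + z + (w + t)).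
  by rewrite -!addrA [LHS]addrCA [t + w]addrC.
exact: shuffle.
Qed.

(** Multiplication by c on the one-dimensional module: the vector-valued recurrences then evaluate
    the scalar polynomials at c, and no second definition of them is needed. *)
Definition rmul (c : R) (z : R^o) : R^o := c * z.

Lemma rmul_linear c : linear (rmul c).
Proof. by move=> a x y; rewrite /rmul mulrDr -[_ *: _]/(_ * _) mulrCA. Qed.

HB.instance Definition _ c := GRing.isLinear.Build _ _ _ _ (rmul c) (rmul_linear c).

(** Under x = (y + 1/y)/2 the recurrence is solved by the two geometric sequences y^j and y^-j. *)
Lemma chebT_rmul (y : R) j : y != 0 ->
  chebT (rmul ((y + y^-1) / 2)) 1 j = (y ^+ j + y ^- j) / 2.
Proof.
move=> y0; set f := rmul _.
have [] : chebT f 1 j = (y ^+ j + y ^- j) / 2 /\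
          chebT f 1 j.+1 = (y ^+ j.+1 + y ^- j.+1) / 2; last by [].
elim: j => [|j [IH1 IH2]]; last split => //.
  split; last by rewrite chebT1 !expr1; exact: mulr1.
  by rewrite /chebT /= !expr0 invr1 -mulr2n -[1 *+ 2]/2%:R mulfV// pnatr_eq0.
rewrite chebTSS IH1 IH2.
rewrite -[LHS]/(2 * ((y + y^-1) / 2 * ((y ^+ j.+1 + y ^- j.+1) / 2))
                - (y ^+ j + y ^- j) / 2).
rewrite -!exprVn !exprS.
by set z := y ^+ j; set w := y^-1 ^+ j; field.
Qed.

(** A Chernoff-type bound: evaluate the expansion of x^q at x = (y + 1/y)/2. All terms are
    nonnegative, and each term of degree j >= k is at least its coefficient times y^k/2. *)
Lemma chebc_tail (y : R) q k : 1 <= y ->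
  \sum_(j < q.+1 | (k <= j)%N) chebc q j
    <= 2 * ((y + y^-1) / 2) ^+ q / y ^+ k.
Proof.
move=> y1; have y0 : 0 < y by lra.
have : iter q (rmul ((y + y^-1) / 2)) 1 = ((y + y^-1) / 2) ^+ q.
  by elim: q => [|q IH] //; rewrite iterS IH exprS.
rewrite iter_chebT => <-; rewrite ler_pdivlMr ?exprn_gt0// mulr_suml mulr_sumr.
rewrite [leRHS](bigID (fun j : 'I_q.+1 => (k <= j)%N)) /= -[leLHS]addr0.
have Tj j := chebT_rmul j (lt0r_neq0 y0).
rewrite lerD//.
  apply: ler_sum => j kj; rewrite -[_ *: _]/(_ * _) Tj mulrCA.
  rewrite ler_wpM2l ?chebc_ge0// mulrCA mulfV ?mulr1 ?pnatr_eq0//.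
  apply: (@le_trans _ _ (y ^+ j)); first by rewrite ler_weXn2l.
  by rewrite lerDl invr_ge0 exprn_ge0// ltW.
apply: sumr_ge0 => j _; rewrite -[_ *: _]/(_ * _) Tj.
rewrite mulr_ge0// mulr_ge0 ?chebc_ge0// divr_ge0//.
by rewrite addr_ge0// ?invr_ge0 exprn_ge0// ltW.
Qed.

(** Evaluation at y = 1, where every T_j equals 1; the coefficients thus form a probability
    distribution. *)
Lemma chebc_sum q : \sum_(j < q.+1) chebc q j = 1.
Proof.
have h : (1 + 1^-1) / 2 = 1 :> R by field.
have : iter q (rmul ((1 + 1^-1) / 2)) 1 = 1.
  by elim: q => [|q IH] //; rewrite iterS IH /rmul h mul1r.
rewrite iter_chebT => e; rewrite -[RHS]e; apply: eq_bigr => j _.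
rewrite -[_ *: _]/(_ * _) chebT_rmul ?oner_eq0// expr1n invr1 -mulr2n -[1 *+ 2]/2%:R.
by rewrite mulfV ?pnatr_eq0// mulr1.
Qed.

Section Contraction.
Variables (n : nat) (X : 'M[R]_n).
Hypothesis Xsym : X^T = X.
Hypothesis Xcontr : forall x : 'cV_n, enorm (X *m x) <= enorm x.
Implicit Types x v : 'cV[R]_n.

(** Pell's identity, invariant under one coupled step t' = x t - (1 - x^2) u, u' = x u + t; this is
    why T and U are computed together. For a contraction X the bracket is nonnegative, which bounds
    T_j(X) v by v. *)
Lemma chebTU_Pell v j :
  dot (chebT (mulmx X) v j) (chebT (mulmx X) v j)
  + (dot (chebU (mulmx X) v j) (chebU (mulmx X) v j)
     - dot (X *m chebU (mulmx X) v j) (X *m chebU (mulmx X) v j)) = dot v v.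
Proof.
elim: j => [|j <-]; first by rewrite /chebT /chebU /= mulmx0 !dot0l subr0 addr0.
rewrite /chebT /chebU /=; case: (chebTU _ v j) => t u /=.
have sym x y : dot x (X *m y) = dot (X *m x) y by rewrite dot_mulmx Xsym.
rewrite !mulmxDr; set u1 := X *m u; set u2 := X *m u1; set t1 := X *m t.
rewrite !dotE (dotC u1 t) (dotC u2 t1) (dotC u2 u) (dotC u t1).
have -> : dot t1 u = dot t u1 by rewrite -sym.
have -> : dot u u2 = dot u1 u1 by rewrite -sym.
by ring.
Qed.

Lemma chebT_le v j : enorm (chebT (mulmx X) v j) <= enorm v.
Proof.
rewrite enorm_le ?enorm_ge0// enorm_sqr -(chebTU_Pell v j) lerDl subr_ge0.
by rewrite -!enorm_sqr ler_sqr ?nnegrE ?enorm_ge0.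
Qed.

Lemma chebU_le v j : enorm (chebU (mulmx X) v j) <= j%:R * enorm v.
Proof.
elim: j => [|j IH]; first by rewrite /chebU /= enorm0 mul0r.
have -> : chebU (mulmx X) v j.+1 = X *m chebU (mulmx X) v j + chebT (mulmx X) v j by [].
apply: le_trans (enormD _ _) _; rewrite -natr1 mulrDl mul1r lerD ?chebT_le//.
exact: le_trans (Xcontr _) IH.
Qed.

(** Discrete variation of constants: an inhomogeneity entering at step l + 1 is propagated to step j
    by U_{j-l-1}(X), whose norm grows only linearly. *)
Lemma cheb_perturbation (d r : nat -> 'cV[R]_n) :
  d 0%N = 0 -> d 1%N = r 0%N ->
  (forall j, d j.+2 = 2 *: (X *m d j.+1) - d j + r j.+1) ->
  forall j, d j = \sum_(l < j) chebU (mulmx X) (r l) (j - l).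
Proof.
move=> d0 d1 dSS j.
have [] : d j = \sum_(l < j) chebU (mulmx X) (r l) (j - l) /\
  d j.+1 = \sum_(l < j.+1) chebU (mulmx X) (r l) (j.+1 - l); last by [].
elim: j => [|j [IH1 IH2]]; last split=> //.
  by rewrite big_ord0 big_ord1 chebU1.
have IH1' : d j = \sum_(l < j.+1) chebU (mulmx X) (r l) (j - l).
  by rewrite big_ord_recr /= subnn /chebU /= addr0.
rewrite dSS IH1' IH2 [RHS]big_ord_recr /= subSn// subnn chebU1; congr (_ + _).
rewrite mulmx_sumr scaler_sumr -sumrB; apply: eq_bigr => l _.
have lj : (l <= j)%N by rewrite -ltnS.
by rewrite !subSn ?(leqW lj)// -[X *m _]/(mulmx X _) -chebUSS.
Qed.

End Contraction.

(** The deviations d_j = T_j(A) Q e - Q T_j(T) e satisfy the Chebyshev recurrence with inhomogeneity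
    (A Q - Q T) T_j(T) e. For j < k only the controlled residuals occur, and d_j <= 2 k^2 tau; for j
    >= k the trivial bound is weighted by the small Chebyshev tail. *)
Lemma krylov_power n m (A : 'M[R]_n) (T : 'M[R]_m) (Q : 'M[R]_(n, m))
    (e : 'cV[R]_m) (F tau : R) (q k : nat) :
  A^T = A -> (forall x, enorm (A *m x) <= enorm x) ->
  T^T = T -> (forall x, enorm (T *m x) <= enorm x) ->
  0 <= F -> (forall x, enorm (Q *m x) <= F * enorm x) -> 0 <= tau ->
  (forall j, (j.+1 < k)%N ->
     enorm ((A *m Q - Q *m T) *m chebT (mulmx T) e j) <= tau) ->
  enorm (iter q (mulmx A) (Q *m e) - Q *m iter q (mulmx T) e) <=
  (enorm (Q *m e) + F * enorm e) * (\sum_(j < q.+1 | (k <= j)%N) chebc q j)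
  + 2 * k%:R ^+ 2 * tau.
Proof.
move=> Asym Acon Tsym Tcon F0 Qle tau0 res.
pose N := A *m Q - Q *m T.
pose d j := chebT (mulmx A) (Q *m e) j - Q *m chebT (mulmx T) e j.
(* The factor 2 is absent at j = 0 because T_1 = x T_0, whereas T_{j+2} = 2 x T_{j+1} - T_j. *)
pose r j := if j is 0 then N *m e else 2 *: (N *m chebT (mulmx T) e j).
have rle j : (j.+1 < k)%N -> enorm (r j) <= 2 * tau.
  case: j => [|j] /res h; rewrite /r; first by apply: (le_trans h); lra.
  by rewrite enormZ ger0_norm// ler_pM2l.
have step a b (c f : 'cV_m) : 2 *: (A *m a) - b - Q *m (2 *: (T *m c) - f)
    = 2 *: (A *m (a - Q *m c)) - (b - Q *m f) + 2 *: (N *m c).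
  rewrite /N mulmxBl !mulmxBr -scalemxAr !scalerBr !mulmxA !opprB !addrA.
  move: (A *m a) (A *m Q *m c) (Q *m T *m c) (Q *m f) => x y z w.
  by apply/matrixP => i j; rewrite !mxE; ring.
have dE := @cheb_perturbation n A d r _ _ _.
have {}dE j : d j = \sum_(l < j) chebU (mulmx A) (r l) (j - l).
  apply: dE => [||i]; rewrite /d.
  - by rewrite subrr.
  - by rewrite !chebT1 /r /N mulmxBl -!mulmxA.
  - by rewrite !chebTSS; apply: step.
have dle j : (j < k)%N -> enorm (d j) <= 2 * k%:R ^+ 2 * tau.
  move=> jk; rewrite dE; apply: le_trans; first exact: enorm_sum.
  apply: (@le_trans _ _ (\sum_(l < j) k%:R * (2 * tau))).
    apply: ler_sum => l _; apply: le_trans (chebU_le Asym Acon _ _) _.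
    rewrite ler_pM ?enorm_ge0 ?ler_nat//; first by have := ltn_ord l; lia.
    by rewrite rle//; have := ltn_ord l; lia.
  rewrite sumr_const card_ord -[_ *+ j]mulr_natl.
  rewrite [leRHS](_ : _ = k%:R * (k%:R * (2 * tau))); last by ring.
  by rewrite ler_wpM2r ?mulr_ge0// ler_nat ltnW.
have dge j : enorm (d j) <= enorm (Q *m e) + F * enorm e.
  apply: le_trans (enormB _ _) _; rewrite lerD ?chebT_le//.
  by apply: le_trans (Qle _) _; rewrite ler_wpM2l ?chebT_le.
have -> : iter q (mulmx A) (Q *m e) - Q *m iter q (mulmx T) e
        = \sum_(j < q.+1) chebc q j *: d j.
  rewrite !iter_chebT mulmx_sumr -sumrB; apply: eq_bigr => j _.
  by rewrite -scalemxAr scalerBr.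
apply: le_trans; first exact: enorm_sum.
rewrite (bigID (fun j : 'I_q.+1 => (k <= j)%N)) /= mulr_sumr lerD//.
  apply: ler_sum => j _; rewrite enormZ ger0_norm ?chebc_ge0// mulrC.
  by rewrite ler_wpM2r ?chebc_ge0.
set E := 2 * _ * tau in dle *.
have E0 : 0 <= E by rewrite !mulr_ge0// exprn_ge0.
have -> : E = \sum_(j < q.+1) chebc q j * E by rewrite -mulr_suml chebc_sum mul1r.
rewrite [leRHS](bigID (fun j : 'I_q.+1 => (k <= j)%N)) /= -[leLHS]add0r; apply: lerD.
  by apply: sumr_ge0 => j _; rewrite mulr_ge0 ?chebc_ge0.
apply: ler_sum => j jk; rewrite enormZ ger0_norm ?chebc_ge0// ler_wpM2l ?chebc_ge0// dle//.
by rewrite ltnNge.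
Qed.

End Chebyshev.

(** * Norm of the tridiagonal matrix *)

Section Jacobi.
Context {R : realType}.

Section Sequences.
Variables al be : nat -> R.
(* be i couples the coordinates i.-1 and i, and be 0 = 0 makes the junk
   coordinate 0.-1 = 0 harmless. *)
Hypothesis be0 : be 0%N = 0.
Implicit Types (s x y : nat -> R) (J i : nat) (theta h : R).

Definition jac s i := be i * s i.-1 + al i * s i + be i.+1 * s i.+1.

Definition seqdot J x y := \sum_(i < J) x i * y i.

(** Sequences vanishing from J on stand for the leading J-by-J block, so that blocks of all sizes
    live in one type and can be handled by induction on J. *)
Definition jac_le J theta := forall y, (forall i, (J <= i)%N -> y i = 0) ->
  seqdot J y (jac y) <= theta * seqdot J y y.

Lemma seqdotS J x y : seqdot J.+1 x y = seqdot J x y + x J * y J.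
Proof. by rewrite /seqdot big_ord_recr. Qed.

Lemma seqdot_ge0 J x : 0 <= seqdot J x x.
Proof. by apply: sumr_ge0 => i _; rewrite -expr2 sqr_ge0. Qed.

(** Discrete Green identity: symmetry up to the boundary term caused by cutting the coupling between
    coordinates J - 1 and J. *)
Lemma jac_symmetry J x y :
  seqdot J y (jac x) - seqdot J x (jac y) = be J * (y J.-1 * x J - x J.-1 * y J).
Proof.
elim: J => [|J IH]; first by rewrite /seqdot !big_ord0 be0; ring.
rewrite !seqdotS /= [LHS](_ : _ = seqdot J y (jac x) - seqdot J x (jac y)
  + (y J * jac x J - x J * jac y J)); last by ring.
by rewrite IH /jac; ring.
Qed.

Lemma jac_le_pred J theta : jac_le J.+1 theta -> jac_le J theta.
Proof.
move=> H y hy; have := H y (fun i Ji => hy i (ltnW Ji)).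
by rewrite !seqdotS hy// !mul0r !addr0.
Qed.

(** The margin h makes the leading block of theta + h - T positive definite, so the first J
    equations are solvable with s_J = 1. The last clause controls the size of s: pairing s with its
    own defect gives h |s|^2 <= phi, where phi is the Schur complement at the new coordinate, and
    |s|^2 >= 1 gives phi >= h. *)
Lemma jac_solve J theta h : 0 < h -> jac_le J theta ->
  exists s, [/\ s J = 1, forall i, (J < i)%N -> s i = 0,
    forall i, (i < J)%N -> (theta + h) * s i = jac s i
    & h ^+ 2 * seqdot J s s <= be J ^+ 2].
Proof.
move=> h0; elim: J => [|J IH] HT.
  exists (fun i => (i == 0%N)%:R); split=> // [i|]; first by case: i.
  by rewrite /seqdot big_ord0 mulr0 sqr_ge0.
have [s [sJ s0 hs _]] := IH (jac_le_pred HT).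
set th := theta + h in hs *.
pose phi := th * s J - jac s J.
have phiE : seqdot J.+1 s (fun i => th * s i - jac s i) = phi.
  rewrite seqdotS sJ mul1r /seqdot big1 ?add0r /phi ?sJ// => i _.
  by rewrite hs ?ltn_ord// subrr mulr0.
have phiE2 : seqdot J.+1 s (fun i => th * s i - jac s i)
    = th * seqdot J.+1 s s - seqdot J.+1 s (jac s).
  by rewrite mulr_sumr -sumrB; apply: eq_bigr => i _; ring.
have hphi : h * seqdot J.+1 s s <= phi.
  rewrite -phiE phiE2; have := HT s s0; rewrite /th; lra.
have s1 : 1 <= seqdot J.+1 s s by rewrite seqdotS sJ mulr1 lerDr seqdot_ge0.
have phih : h <= phi by apply: le_trans hphi; rewrite ler_peMr// ltW.
have phi0 : 0 < phi by lra.
(* Rescaling the old solution by c leaves its J equations intact and makes equation J balance the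
   coupling to a new last coordinate equal to 1. *)
set c := be J.+1 / phi.
exists (fun i => if (i <= J)%N then c * s i else (i == J.+1)%:R); split.
- by rewrite ltnn eqxx.
- by move=> i hi; rewrite leqNgt (ltnW hi)/= gtn_eqF.
- move=> i; rewrite ltnS => iJ; rewrite /jac iJ (leq_trans (leq_pred i) iJ).
  have [e|ij] := eqVneq i J.
    subst i; rewrite ltnn eqxx mulr1.
    have E : phi = th * s J - (be J * s J.-1 + al J * s J).
      by rewrite /phi /jac (s0 J.+1)// mulr0 addr0.
    have : c * phi = be J.+1 by rewrite /c divfK// gt_eqF.
    by rewrite E => <-; ring.
  have iJ' : (i < J)%N by rewrite ltn_neqAle ij.
  by rewrite iJ' mulrCA hs// /jac; ring.
- have -> : seqdot J.+1 (fun i => if (i <= J)%N then c * s i else (i == J.+1)%:R)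
     (fun i => if (i <= J)%N then c * s i else (i == J.+1)%:R) = c ^+ 2 * seqdot J.+1 s s.
    rewrite mulr_sumr; apply: eq_bigr => i _; rewrite -ltnS ltn_ord; ring.
  rewrite /c exprMn exprVn; set S := seqdot _ _ _ in hphi s1 *.
  have -> : h ^+ 2 * (be J.+1 ^+ 2 / phi ^+ 2 * S) = be J.+1 ^+ 2 * ((h * (h * S)) / phi ^+ 2).
    by field; rewrite gt_eqF.
  rewrite ler_piMr ?sqr_ge0// ler_pdivrMr ?exprn_gt0// mul1r expr2.
  by rewrite ler_pM// ?mulr_ge0// ltW//; lra.
Qed.

(* Completing the square at the new coordinate: phi is the Schur complement. *)
Lemma jac_le_succ J theta h s w :
  0 <= h -> jac_le J theta ->
  s J = 1 -> (forall i, (J < i)%N -> s i = 0) ->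
  (forall i, (i < J)%N -> (theta + h) * s i = jac s i) ->
  0 <= w -> - w <= (theta + h) * s J - jac s J ->
  jac_le J.+1 (theta + h + w).
Proof.
move=> h0 HT sJ s0 hs w0 hw y hy; set th := theta + h in hs hw *.
pose x i := y i - y J * s i.
have x0 i : (J <= i)%N -> x i = 0.
  rewrite leq_eqVlt /x => /orP[/eqP<-|Ji]; first by rewrite sJ mulr1 subrr.
  by rewrite hy// s0// mulr0 subr0.
have yE i : y i = x i + y J * s i by rewrite /x subrK.
pose d u i := th * u i - jac u i.
have dE u v : seqdot J.+1 u (d v) = th * seqdot J.+1 u v - seqdot J.+1 u (jac v).
  by rewrite mulr_sumr -sumrB; apply: eq_bigr => i _; rewrite /d; ring.
have sds : seqdot J.+1 s (d s) = d s J.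
  rewrite seqdotS sJ mul1r /seqdot big1 ?add0r// => i _.
  by rewrite /d hs ?ltn_ord// subrr mulr0.
have xds : seqdot J.+1 x (d s) = 0.
  rewrite seqdotS x0// mul0r addr0 /seqdot big1// => i _.
  by rewrite /d hs ?ltn_ord// subrr mulr0.
have sdx : seqdot J.+1 s (d x) = 0.
  have := jac_symmetry J.+1 x s; rewrite (x0 J.+1)// (s0 J.+1)// !mulr0 subrr mulr0.
  move/eqP; rewrite subr_eq0 => /eqP E; rewrite -xds !dE E; congr (_ * _ - _).
  by apply: eq_bigr => i _; rewrite mulrC.
have xdx : 0 <= seqdot J.+1 x (d x).
  rewrite dE !seqdotS x0// !mul0r !addr0; have := HT x x0; have := seqdot_ge0 J x.
  by rewrite /th => X1 X2; have : 0 <= h * seqdot J x x by [rewrite mulr_ge0]; lra.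
have key : seqdot J.+1 y (d y) = seqdot J.+1 x (d x) + y J ^+ 2 * d s J.
  have -> : seqdot J.+1 y (d y) = seqdot J.+1 x (d x) + y J * seqdot J.+1 x (d s)
     + y J * seqdot J.+1 s (d x) + y J ^+ 2 * seqdot J.+1 s (d s).
    rewrite !mulr_sumr -!big_split; apply: eq_bigr => i _ /=.
    rewrite /d /jac (yE i) (yE i.-1) (yE i.+1); ring.
  by rewrite xds sdx sds !mulr0 !addr0.
have yJ : y J ^+ 2 <= seqdot J.+1 y y by rewrite seqdotS expr2 lerDr seqdot_ge0.
rewrite -subr_ge0 mulrDl addrAC -dE key.
have h1 : - (w * y J ^+ 2) <= y J ^+ 2 * d s J.
  by rewrite mulrC -mulrN ler_wpM2l ?sqr_ge0.
have h2 : w * y J ^+ 2 <= w * seqdot J.+1 y y by rewrite ler_wpM2l.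
lra.
Qed.

End Sequences.

Section LocalLanczos.
Variables (n : nat) (A : 'M[R]_n) (q : nat -> 'cV[R]_n) (al be : nat -> R).
Variables (K : nat) (b eps : R).
Hypothesis Asym : A^T = A.
Hypothesis Ale : forall x, dot x (A *m x) <= dot x x.
Hypothesis be0 : be 0%N = 0.
Hypothesis be_le : forall i, (i < K)%N -> `|be i| <= b.
Hypothesis eps0 : 0 <= eps.
Hypothesis eps1 : eps <= 1.

Definition lres i := A *m q i - (be i *: q i.-1 + al i *: q i + be i.+1 *: q i.+1).

Hypothesis q_norm : forall i, (i < K)%N -> `|dot (q i) (q i) - 1| <= eps.
Hypothesis q_orth : forall i, (i < K)%N -> `|be i * dot (q i) (q i.-1)| <= eps.
Hypothesis q_al : forall i, (i < K)%N -> `|dot (q i) (A *m q i) - al i| <= eps.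
Hypothesis q_res : forall i, (i.+1 < K)%N -> enorm (lres i) <= eps.

Section Shifted.
Variables (theta : R) (s : nat -> R) (J : nat).
Hypothesis JK : (J < K)%N.
(** Defect of equation i with the coupling to coordinate i + 1 left out. For the solutions from
    [jac_solve], its value at J is the Schur complement. *)
Let phi i := (theta - al i) * s i - be i * s i.-1.
Hypothesis phiE : forall i, (i < J)%N -> phi i = be i.+1 * s i.+1.
Let g i := \sum_(l < i.+1) s l *: q l.
Let err i := \sum_(l < i.+1) s l *: lres l.

(** Telescoping: the equations for s cancel all interior q_l, so that theta - A applied to the
    partial sum leaves only its two end vectors and the accumulated residuals. This is what makes
    global orthogonality dispensable. *)
Lemma shifted_lanczos i : (i <= J)%N ->
  theta *: g i - A *m g i = phi i *: q i - (be i.+1 * s i) *: q i.+1 - err i.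
Proof.
elim: i => [|i IH] iJ.
  rewrite /g /err !big_ord1 -scalemxAr /lres /phi /= be0.
  move: (A *m q 0%N) (q 0%N) (q 1%N) => x y z.
  by apply/matrixP => a c; rewrite !mxE; ring.
have -> : g i.+1 = g i + s i.+1 *: q i.+1 by rewrite /g big_ord_recr.
have -> : err i.+1 = err i + s i.+1 *: lres i.+1 by rewrite /err big_ord_recr.
rewrite mulmxDr scalerDr opprD addrACA IH 1?ltnW// phiE// -scalemxAr /lres /phi /=.
move: (A *m q i.+1) (q i) (q i.+1) (q i.+2) (err i) => x y z t u.
by apply/matrixP => a c; rewrite !mxE; ring.
Qed.

Let S := \sum_(l < J.+1) s l ^+ 2.

Lemma coef_prod_le l m x : (l <= J)%N -> (m <= J)%N -> `|x| <= eps ->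
  `|s l * s m * x| <= eps * S.
Proof.
move=> lJ mJ xe.
have S0 : 0 <= S by apply: sumr_ge0 => i _; rewrite sqr_ge0.
have sl i : (i <= J)%N -> `|s i| <= Num.sqrt S.
  move=> iJ; rewrite -ler_sqr ?nnegrE ?sqrtr_ge0// sqr_sqrtr// real_normK ?num_real//.
  rewrite /S (bigD1 (Ordinal (iJ : i < J.+1)%N))//= lerDl.
  by apply: sumr_ge0 => j _; rewrite sqr_ge0.
rewrite mulrC 2!normrM ler_pM ?mulr_ge0//.
by rewrite -[S]sqr_sqrtr// expr2 ler_pM ?sl.
Qed.

Lemma dot_err_le l i : (l <= J)%N -> (i < J)%N -> enorm (q l) <= 2 ->
  `|s l * dot (q l) (err i)| <= 2 * K%:R * (eps * S).
Proof.
move=> lJ iJ ql; rewrite /err dotC dot_suml mulr_sumr.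
apply: le_trans (ler_norm_sum _ _ _) _.
apply: (@le_trans _ _ (\sum_(j < i.+1) 2 * (eps * S))).
  apply: ler_sum => j _; rewrite dotZl.
  have jK : (j.+1 < K)%N by have := ltn_ord j; lia.
  have jJ : (j <= J)%N by have := ltn_ord j; lia.
  have -> : s l * (s j * dot (lres j) (q l)) = 2 * (s l * s j * (dot (lres j) (q l) / 2)).
    by field.
  rewrite normrM ger0_norm// ler_pM2l// coef_prod_le// normrM [`|2^-1|]ger0_norm ?invr_ge0//.
  rewrite ler_pdivrMr//; apply: le_trans (dot_le _ _) _.
  by rewrite ler_pM ?enorm_ge0// q_res.
rewrite sumr_const card_ord -[_ *+ i.+1]mulr_natl.
have S0 : 0 <= S by apply: sumr_ge0 => j _; rewrite sqr_ge0.
rewrite [leRHS](_ : _ = K%:R * (2 * (eps * S))); last by ring.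
by rewrite ler_wpM2r ?mulr_ge0// ler_nat; lia.
Qed.

(** Induction on i. Adding t q_{i+1} to g_i changes the quadratic form by 2t <q_{i+1}, (theta - A)
    g_i> plus a diagonal term, and [shifted_lanczos] reduces the cross term to products of
    neighbours. In units of eps S one step costs 2 (neighbour product), 2b (norm of q_{i+1}), 4K
    (residuals) and |theta| + 1 (diagonal). *)
Lemma shifted_defect i : (i <= J)%N ->
  `|dot (g i) (theta *: g i - A *m g i) - phi i * s i| <=
  i.+1%:R * (eps * S * (4 * K%:R + 2 * b + `|theta| + 3)).
Proof.
have S0 : 0 <= S by apply: sumr_ge0 => j _; rewrite sqr_ge0.
have b0 : 0 <= b by apply: le_trans (be_le JK).
have last_le l : (l <= J)%N ->
  `|s l ^+ 2 * (theta * (dot (q l) (q l) - 1) - (dot (q l) (A *m q l) - al l))|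
    <= eps * S * (`|theta| + 1).
  move=> lJ; have lK : (l < K)%N by lia.
  have := coef_prod_le lJ lJ (q_norm lK); have := coef_prod_le lJ lJ (q_al lK).
  set X := dot _ _ - 1; set Y := dot _ _ - al l => hY hX.
  have -> : s l ^+ 2 * (theta * X - Y) = theta * (s l * s l * X) - s l * s l * Y by ring.
  have -> : eps * S * (`|theta| + 1) = `|theta| * (eps * S) + eps * S by ring.
  by rewrite (le_trans (ler_normB _ _))// lerD// normrM ler_wpM2l.
have KS : 0 <= K%:R :> R by [].
have KeS : 0 <= K%:R * (eps * S) by rewrite !mulr_ge0.
have beS : 0 <= b * (eps * S) by rewrite !mulr_ge0.
have eS : 0 <= eps * S by rewrite mulr_ge0.
have tS : 0 <= `|theta| * (eps * S) by rewrite mulr_ge0.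
elim: i => [_|i IH iJ].
  apply: (@le_trans _ _ (eps * S * (`|theta| + 1))); last by lra.
  apply: le_trans (last_le 0%N isT); rewrite le_eqVlt; apply/orP; left; apply/eqP.
  congr `|_|; rewrite /g big_ord1 /phi /= be0 -scalemxAr !dotE; ring.
have -> : g i.+1 = g i + s i.+1 *: q i.+1 by rewrite /g big_ord_recr.
have iK : (i.+1 < K)%N := leq_ltn_trans iJ JK.
have key : dot (q i.+1) (theta *: g i - A *m g i) =
    be i.+1 * s i.+1 * dot (q i.+1) (q i) - be i.+1 * s i * dot (q i.+1) (q i.+1)
    - dot (q i.+1) (err i).
  by rewrite shifted_lanczos 1?ltnW// phiE// !dotE.
set qq := q i.+1 in key *; set t := s i.+1 in key *.
have -> : dot (g i + t *: qq) (theta *: (g i + t *: qq) - A *m (g i + t *: qq))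
    - phi i.+1 * t =
  (dot (g i) (theta *: g i - A *m g i) - phi i * s i)
  + (2 * (t * t * (be i.+1 * dot qq (q i)))
  - 2 * (be i.+1 * (t * s i * (dot qq qq - 1)))
  - 2 * (t * dot qq (err i))
  + t ^+ 2 * (theta * (dot qq qq - 1) - (dot qq (A *m qq) - al i.+1))).
  have sym : dot (g i) (A *m qq) = dot qq (A *m g i) by rewrite dotC dot_mulmx Asym.
  have ph : phi i.+1 = (theta - al i.+1) * t - be i.+1 * s i by [].
  move: key; rewrite !mulmxDr -!scalemxAr !dotE sym (dotC (g i) qq) ph phiE// -/t.
  move: (dot qq (g i)) (dot qq (A *m g i)) (dot qq (err i)) => x y z.
  move/(canRL (subKr _)) => ->.
  by ring.
have t1 : `|t * t * (be i.+1 * dot qq (q i))| <= eps * S.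
  by apply: coef_prod_le => //; exact: q_orth iK.
have t2 : `|be i.+1 * (t * s i * (dot qq qq - 1))| <= b * (eps * S).
  rewrite normrM ler_pM// ?be_le//; apply: coef_prod_le => //; [exact: ltnW|exact: q_norm].
have t3 : `|t * dot qq (err i)| <= 2 * K%:R * (eps * S).
  apply: dot_err_le => //; rewrite enorm_le//; have := ler_norm (dot qq qq - 1).
  by have := q_norm iK; rewrite -/qq expr2; move: eps1; lra.
have t4 := last_le i.+1 iJ.
have := IH (ltnW iJ).
set E := eps * S * _ => t0.
have -> : i.+2%:R * E = i.+1%:R * E + E by rewrite -[i.+2%:R]natr1; ring.
rewrite (le_trans (ler_normD _ _))// lerD//.
move: t1 t2 t3 t4; rewrite -/t -/qq !ler_norml => /andP[? ?] /andP[? ?] /andP[? ?] /andP[? ?].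
by apply/andP; split; rewrite /E; lra.
Qed.

End Shifted.

(** Each coordinate raises the bound by h + w: h buys solvability and |s|^2 <= 1 + b^2/h^2, and w
    absorbs the defect of [shifted_defect]. The condition K(h + w) <= 1 keeps theta <= 2, whence the
    5 in place of |theta| + 3. *)
Lemma jac_le_lanczos h w J :
  0 < h -> 0 <= w -> (J <= K)%N -> K%:R * (h + w) <= 1 ->
  K%:R * (eps * (4 * K%:R + 2 * b + 5)) * (1 + b ^+ 2 / h ^+ 2) <= w ->
  jac_le al be J (1 + J%:R * (h + w)).
Proof.
move=> h0 w0 + hw1 hw; elim: J => [_|J IH JK].
  move=> y hy; rewrite /seqdot !big_ord0 mulr0; exact: lexx.
have b0 : 0 <= b by apply: le_trans (be_le JK).
set th0 := 1 + J%:R * (h + w) in IH.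
have th01 : 1 <= th0 by rewrite lerDl mulr_ge0// addr_ge0// ltW.
have thle : th0 + (h + w) <= 2.
  have -> : th0 + (h + w) = 1 + J.+1%:R * (h + w) by rewrite -natr1 /th0; ring.
  have : J.+1%:R * (h + w) <= K%:R * (h + w).
    by rewrite ler_wpM2r ?ler_nat// addr_ge0// ltW.
  by lra.
have [s [sJ s0 hs sn]] := jac_solve h0 (IH (ltnW JK)).
set th := th0 + h in hs.
have phiE i : (i < J)%N -> (th - al i) * s i - be i * s i.-1 = be i.+1 * s i.+1.
  by move=> iJ; rewrite mulrBl hs// /jac; ring.
have := shifted_defect JK phiE (leqnn J).
set g := \sum_(l < J.+1) _.
have gge : 0 <= dot g (th *: g - A *m g).
  rewrite dotBr dotZr subr_ge0; apply: le_trans (Ale g) _.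
  by rewrite ler_peMl ?dot_ge0// /th; lra.
have sS : \sum_(l < J.+1) s l ^+ 2 <= 1 + b ^+ 2 / h ^+ 2.
  rewrite big_ord_recr /= sJ expr1n addrC lerD2l ler_pdivlMr ?exprn_gt0// mulrC.
  have -> : \sum_(i < J) s i ^+ 2 = seqdot J s s.
    by apply: eq_bigr => i _; rewrite expr2.
  apply: le_trans sn _; rewrite -[leLHS]real_normK ?num_real// ler_sqr ?nnegrE//.
  exact: be_le.
have S0 : 0 <= \sum_(l < J.+1) s l ^+ 2 by apply: sumr_ge0 => l _; rewrite sqr_ge0.
have thn : `|th| <= 2 by rewrite ger0_norm /th; lra.
have cw : J.+1%:R * (eps * (\sum_(l < J.+1) s l ^+ 2) * (4 * K%:R + 2 * b + `|th| + 3)) <= w.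
  apply: le_trans hw; set U := 1 + _ / _ in sS *.
  have -> : K%:R * (eps * (4 * K%:R + 2 * b + 5)) * U
    = K%:R * (eps * U * (4 * K%:R + 2 * b + 5)) by ring.
  have F0 : 0 <= 4 * K%:R + 2 * b :> R by rewrite addr_ge0 ?mulr_ge0.
  have F1 : 0 <= 4 * K%:R + 2 * b + `|th| + 3 by have := normr_ge0 th; lra.
  by rewrite ler_pM ?mulr_ge0 ?ler_nat// ler_pM ?mulr_ge0// ?ler_wpM2l//; lra.
move=> /(le_trans (ler_norm _)) => h1.
have -> : 1 + J.+1%:R * (h + w) = th0 + h + w by rewrite -natr1 /th0; ring.
apply: (jac_le_succ be0 (ltW h0) (IH (ltnW JK)) sJ s0 hs w0).
rewrite -/th; have -> : th * s J - jac al be s J = ((th - al J) * s J - be J * s J.-1) * s J.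
  by rewrite /jac (s0 J.+1)// sJ; ring.
by have := le_trans h1 cw; move: gge; lra.
Qed.

End LocalLanczos.
End Jacobi.

(** * From approximate Lanczos relations to powers of the matrix *)

Section LanczosPower.
Context {R : realType}.

(* With u = (N - T) x and w = (N + T) x one has
   <u, (N + T) u> + <w, (N - T) w> = 2 N <x, (N^2 - T^2) x>. *)
Lemma numerical_radius n (T : 'M[R]_n) (N : R) : T^T = T -> 0 < N ->
  (forall x, dot x (T *m x) <= N * dot x x) ->
  (forall x, - (N * dot x x) <= dot x (T *m x)) ->
  forall x, enorm (T *m x) <= N * enorm x.
Proof.
move=> Tsym N0 Tu Tl x.
rewrite enorm_le ?mulr_ge0 ?enorm_ge0 ?(ltW N0)// exprMn enorm_sqr.
have sym y z : dot y (T *m z) = dot (T *m y) z by rewrite dot_mulmx Tsym.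
have := Tl (N *: x - T *m x); have := Tu (N *: x + T *m x).
rewrite !mulmxBr !mulmxDr -!scalemxAr; set y := T *m x; set z := T *m y.
rewrite !dotE !(dotC y x) (sym x y : dot x z = _) -/y => h1 h2.
rewrite -subr_ge0 -(pmulr_rge0 _ (_ : 0 < 2 * N)); last by rewrite mulr_gt0.
by move: h1 h2; move: (dot y z) (dot x x) (dot y y) (dot x y) => p a b c; nra.
Qed.

Definition jacmx K (al be : nat -> R) : 'M[R]_K :=
  \matrix_(i, j) if i == j then al i else if j == i.+1 :> nat then be j
    else if i == j.+1 :> nat then be i else 0.

Lemma jacmx_sym K al be : (jacmx K al be)^T = jacmx K al be.
Proof.
apply/matrixP => i j; rewrite !mxE eq_sym; case: eqP => [->//|_].
by case: eqP => [e|_]; case: eqP => // e'; exfalso; lia.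
Qed.

Definition colmx n K (q : nat -> 'cV[R]_n) : 'M[R]_(n, K) := \matrix_(i, j) q j i 0.

Lemma colmxE n K (q : nat -> 'cV[R]_n) (x : 'cV[R]_K) :
  colmx K q *m x = \sum_j x j 0 *: q j.
Proof.
rewrite mulmx_col; apply: eq_bigr => j _; congr (_ *: _).
by apply/matrixP => i k; rewrite !mxE ord1.
Qed.

Definition ext K (x : 'cV[R]_K) (i : nat) : R := if insub i is Some j then x j 0 else 0.

Lemma ext_ord K (x : 'cV[R]_K) (i : 'I_K) : ext x i = x i 0.
Proof. by rewrite /ext valK. Qed.

Lemma ext_ge K (x : 'cV[R]_K) i : (K <= i)%N -> ext x i = 0.
Proof. by rewrite /ext leqNgt => h; rewrite insubN. Qed.

(** Evaluates a tridiagonal row uniformly in i: at i = 0 the predecessor is 0 itself but its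
    coefficient a is 0, and in the last row the successor falls where f vanishes. *)
Lemma sum_band K (f : nat -> R) (i : nat) (a b c : R) : (i < K)%N ->
  (i = 0%N -> a = 0) -> (forall l, (K <= l)%N -> f l = 0) ->
  \sum_(j < K) (if i == j :> nat then b else if j == i.+1 :> nat then c
     else if i == j.+1 :> nat then a else 0) * f j
  = a * f i.-1 + b * f i + c * f i.+1.
Proof.
move=> iK a0 f0.
transitivity (\sum_(j < K) ((if j == i :> nat then b * f j else 0)
   + (if j == i.+1 :> nat then c * f j else 0)
   + (if j.+1 == i :> nat then a * f j else 0))).
  apply: eq_bigr => j _; rewrite [i == j.+1]eq_sym [i == j]eq_sym.
  case: eqP => [e|ne].
    by rewrite !ifF ?addr0//; apply/eqP; lia.
  case: eqP => [e|ne']; first by rewrite ifF ?add0r ?addr0//; apply/eqP; lia.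
  by case: eqP; rewrite ?mul0r ?add0r.
have pick (l : nat) (d : R) :
  \sum_(j < K) (if j == l :> nat then d * f j else 0) = d * f l.
  have [lK|Kl] := ltnP l K.
    rewrite (bigD1 (Ordinal lK))//= eqxx big1 ?addr0// => j /eqP jl.
    by case: eqP => // e; case: jl; apply: val_inj.
  rewrite f0// mulr0 big1// => j _; case: eqP => // e; have := ltn_ord j; lia.
rewrite !big_split /= !pick -[RHS]addrA [RHS]addrC; congr (_ + _).
case: i iK a0 => [|i] iK a0 /=; last by under eq_bigr do rewrite eqSS; exact: pick.
by rewrite a0// mul0r big1.
Qed.

Lemma jacmx_mul K al be (x : 'cV[R]_K) (i : 'I_K) : be 0%N = 0 ->
  (jacmx K al be *m x) i 0 = jac al be (ext x) i.
Proof.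
move=> be0; rewrite mxE /jac -(@sum_band K (ext x) i (be i) (al i) (be i.+1))//; last 2 first.
- by move=> ->.
- by move=> l; apply: ext_ge.
apply: eq_bigr => j _; rewrite mxE ext_ord -val_eqE /=.
by case: eqP => // _; case: eqP => // ->.
Qed.

Lemma dot_jacmx K al be (x : 'cV[R]_K) : be 0%N = 0 ->
  dot x (jacmx K al be *m x) = seqdot K (ext x) (jac al be (ext x)).
Proof. by move=> be0; apply: eq_bigr => i _; rewrite jacmx_mul// ext_ord. Qed.

Lemma dot_ext K (x : 'cV[R]_K) : dot x x = seqdot K (ext x) (ext x).
Proof. by apply: eq_bigr => i _; rewrite ext_ord. Qed.

(** The lower bound on the quadratic form is the upper bound for the negated coefficients, which are
    Lanczos coefficients of - A with the same vectors. *)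
Lemma jacmx_norm K al be (N : R) : be 0%N = 0 -> 0 < N ->
  jac_le al be K N -> jac_le (fun i => - al i) (fun i => - be i) K N ->
  forall x, enorm (jacmx K al be *m x) <= N * enorm x.
Proof.
move=> be0 N0 H1 H2; apply: numerical_radius => //; first exact: jacmx_sym.
  by move=> x; rewrite dot_jacmx// dot_ext H1// => i; apply: ext_ge.
move=> x; rewrite dot_jacmx// dot_ext lerNl.
have := H2 (ext x) (fun i => @ext_ge _ x i); apply: le_trans.
rewrite -sumrN le_eqVlt; apply/orP; left; apply/eqP; apply: eq_bigr => i _.
by rewrite /jac; ring.
Qed.

Lemma colmx_jacmx K n (q : nat -> 'cV[R]_n) al be (c : 'I_K) : be 0%N = 0 ->
  col c (colmx K q *m jacmx K al be) =
  be c *: q c.-1 + al c *: q c + (if (c.+1 < K)%N then be c.+1 *: q c.+1 else 0).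
Proof.
move=> be0; apply/matrixP => a z; rewrite [z]ord1 !mxE.
transitivity (be c * q c.-1 a 0 + al c * q c a 0 + be c.+1 *
   (if (c.+1 < K)%N then q c.+1 a 0 else 0)); last by case: ifP; rewrite !mxE ?mulr0.
pose f j := if (j < K)%N then q j a 0 else 0.
have fE j : (j < K)%N -> f j = q j a 0 by rewrite /f => ->.
have cK := ltn_ord c.
rewrite -/(f c.+1) -fE -?(fE c)//; last by lia.
rewrite -(@sum_band K f c)//; last 2 first.
- by move=> ->.
- by move=> l h; rewrite /f ltnNge h.
apply: eq_bigr => j _; rewrite !mxE -fE// mulrC -val_eqE [val j == _]eq_sym /=.
congr (_ * _); case: (val c =P j) => [->//|_].
case: (val c =P j.+1) => [e|_]; case: (val j =P c.+1) => [e'|_] //.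
- by move: e e' => /=; lia.
- by rewrite e'.
Qed.

Lemma enorm_colmx K n (q : nat -> 'cV[R]_n) (F : R) : 0 <= F ->
  (forall i, (i < K)%N -> enorm (q i) <= F) ->
  forall x : 'cV_K, enorm (colmx K q *m x) <= K%:R * F * enorm x.
Proof.
move=> F0 qF x; rewrite colmxE; apply: le_trans; first exact: enorm_sum.
apply: (@le_trans _ _ (\sum_(j < K) F * enorm x)).
  by apply: ler_sum => j _; rewrite enormZ mulrC ler_pM ?enorm_ge0 ?coord_le ?qF.
by rewrite sumr_const card_ord -[_ *+ K]mulr_natl mulrA.
Qed.

Lemma jacmx_support K al be (x : 'cV[R]_K) m : be 0%N = 0 ->
  (forall i : 'I_K, (m < i)%N -> x i 0 = 0) ->
  forall i : 'I_K, (m.+1 < i)%N -> (jacmx K al be *m x) i 0 = 0.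
Proof.
move=> be0 x0 i mi; rewrite jacmx_mul//.
have e0 j : (m < j)%N -> ext x j = 0.
  by rewrite /ext; case: insubP => // k _ <- /x0.
by rewrite /jac !e0 ?mulr0 ?addr0//; lia.
Qed.

Lemma chebT_jacmx_support K al be c (x : 'cV[R]_K) : be 0%N = 0 ->
  (forall i : 'I_K, (0 < i)%N -> x i 0 = 0) ->
  forall j (i : 'I_K), (j < i)%N -> chebT (mulmx (c *: jacmx K al be)) x j i 0 = 0.
Proof.
move=> be0 x0 j; set M := c *: jacmx K al be.
have [] : (forall i : 'I_K, (j < i)%N -> chebT (mulmx M) x j i 0 = 0) /\
   (forall i : 'I_K, (j.+1 < i)%N -> chebT (mulmx M) x j.+1 i 0 = 0); last by [].
have fsupp m (y : 'cV_K) : (forall i : 'I_K, (m < i)%N -> y i 0 = 0) ->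
    forall i : 'I_K, (m.+1 < i)%N -> (M *m y) i 0 = 0.
  by move=> y0 i mi; rewrite -scalemxAl mxE (jacmx_support _ be0 y0)// mulr0.
elim: j => [|j [IH1 IH2]]; split=> //.
  by rewrite chebT1; apply: fsupp.
move=> i ji; rewrite chebTSS mxE [X in _ + X]mxE IH1; last by lia.
rewrite mxE -[X in 2 * X]/((M *m chebT (mulmx M) x j.+1) i 0).
by rewrite (fsupp j.+1 _ IH2)// mulr0 subr0.
Qed.

(** Here k is the iteration budget and K the number of vectors produced. The residual hypothesis
    says nothing about the last column when K = k; when K < k (early exit) it covers every column,
    so the same degree range j + 1 < k works in both cases. *)
Lemma lanczos_power n (A : 'M[R]_n) (q : nat -> 'cV[R]_n) (al be : nat -> R)
    (K k p : nat) (b eps h w : R) (x0 : 'cV[R]_K) :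
  A^T = A -> (forall x, enorm (A *m x) <= enorm x) ->
  be 0%N = 0 -> (forall i, (i < K)%N -> `|be i| <= b) ->
  0 <= eps -> eps <= 1 -> (K <= k)%N ->
  (forall i, (i < K)%N -> `|dot (q i) (q i) - 1| <= eps) ->
  (forall i, (i < K)%N -> `|be i * dot (q i) (q i.-1)| <= eps) ->
  (forall i, (i < K)%N -> `|dot (q i) (A *m q i) - al i| <= eps) ->
  (forall i, (i < K)%N -> (i.+1 < k)%N ->
    enorm (A *m q i - (be i *: q i.-1 + al i *: q i
      + (if (i.+1 < K)%N then be i.+1 *: q i.+1 else 0))) <= eps) ->
  0 < h -> 0 <= w -> K%:R * (h + w) <= 1 ->
  K%:R * (eps * (4 * K%:R + 2 * b + 5)) * (1 + b ^+ 2 / h ^+ 2) <= w ->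
  (forall i : 'I_K, x0 i 0 = (i == 0%N :> nat)%:R) ->
  (forall x, enorm (jacmx K al be *m x) <= (1 + K%:R * (h + w)) * enorm x) /\
  enorm (iter p (mulmx A) (colmx K q *m x0)
         - colmx K q *m iter p (mulmx (jacmx K al be)) x0) <=
  (1 + K%:R * (h + w)) ^+ p *
   (4 * K%:R * (\sum_(j < p.+1 | (k <= j)%N) chebc p j)
     + 2 * k%:R ^+ 2 * (K%:R * eps)).
Proof.
move=> Asym Ale be0 be_le eps0 eps1 Kk q_norm q_orth q_al q_res h0 w0 hw1 hw x0E.
set N := 1 + _; set T := jacmx K al be; set Q := colmx K q.
have N1 : 1 <= N by rewrite lerDl mulr_ge0// addr_ge0// ltW.
have N0 : 0 < N by lra.
have res' i : (i.+1 < K)%N -> enorm (lres A q al be i) <= eps.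
  by move=> iK; have := q_res i (ltnW iK) (leq_trans iK Kk); rewrite iK.
have Adot x : dot x (A *m x) <= dot x x.
  apply: le_trans (ler_norm _) _; apply: le_trans (dot_le _ _) _.
  by rewrite -enorm_sqr expr2 ler_wpM2l ?enorm_ge0.
have Adot' x : dot x (- A *m x) <= dot x x.
  rewrite mulNmx; apply: le_trans (ler_norm _) _; apply: le_trans (dot_le _ _) _.
  by rewrite enormN -enorm_sqr expr2 ler_wpM2l ?enorm_ge0.
have TN : forall x, enorm (T *m x) <= N * enorm x.
  apply: jacmx_norm => //.
    exact: (jac_le_lanczos Asym Adot be0 be_le eps0 eps1 q_norm q_orth q_al res' h0 w0).
  apply: (@jac_le_lanczos _ n (- A) q _ _ K b eps _ Adot' _ _ eps0 eps1 q_norm) => //.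
  - by rewrite linearN /= Asym.
  - by rewrite be0 oppr0.
  - by move=> i /be_le; rewrite normrN.
  - by move=> i /q_orth; rewrite mulNr normrN.
  - by move=> i /q_al; rewrite mulNmx dotNr -opprD normrN.
  - move=> i /res'; rewrite -enormN; congr (enorm _ <= _); rewrite /lres mulNmx.
    by rewrite !scaleNr -!opprD.
split=> //.
have q2 i : (i < K)%N -> enorm (q i) <= 2.
  move=> iK; rewrite enorm_le//; have := ler_norm (dot (q i) (q i) - 1).
  by have := q_norm i iK; rewrite expr2; lra.
have QF x : enorm (Q *m x) <= 2 * K%:R * enorm x.
  by rewrite [2 * _]mulrC; apply: enorm_colmx.
have x01 : enorm x0 <= 1.
  rewrite enorm_le// expr1n /dot; case: (K) x0 x0E => [|K'] y yE; first by rewrite big_ord0.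
  by rewrite big_ord_recl big1 ?addr0 => [|i _]; rewrite !yE ?mulr0// mulr1.
(* Both matrices are divided by the bound N on |T|, so that [krylov_power] applies to two
   contractions; the factor N^p is restored outside. *)
pose A' := N^-1 *: A; pose T' := N^-1 *: T.
have iterZ m (M : 'M_m) (x : 'cV_m) : iter p (mulmx M) x
    = N ^+ p *: iter p (mulmx (N^-1 *: M)) x.
  elim: p => [|i IH]; first by rewrite scale1r.
  rewrite iterS IH iterS -scalemxAr -scalemxAl scalerA; congr (_ *: _).
  by rewrite exprSr mulfK// gt_eqF.
rewrite iterZ [in X in _ - X]iterZ -scalemxAr -scalerBr enormZ ger0_norm ?exprn_ge0 ?(ltW N0)//.
rewrite ler_pM2l ?exprn_gt0//.
apply: le_trans (@krylov_power _ n K A' T' Q x0 (2 * K%:R) (K%:R * eps) p k _ _ _ _ _ QF _ _) _.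
- by rewrite /A' linearZ /= Asym.
- move=> x; rewrite /A' -scalemxAl enormZ ger0_norm ?invr_ge0 ?(ltW N0)//.
  by rewrite ler_pdivrMl//; apply: le_trans (Ale x) _; rewrite ler_peMl ?enorm_ge0.
- by rewrite /T' linearZ /= jacmx_sym.
- move=> x; rewrite /T' -scalemxAl enormZ ger0_norm ?invr_ge0 ?(ltW N0)//.
  by rewrite ler_pdivrMl.
- by rewrite mulr_ge0.
- by rewrite mulr_ge0.
- move=> j jk; set t := chebT _ _ j.
  have t1 i : `|t i 0| <= 1.
    apply: le_trans (coord_le _ _) _; apply: le_trans x01; apply: chebT_le.
      by rewrite /T' linearZ /= jacmx_sym.
    move=> x; rewrite /T' -scalemxAl enormZ ger0_norm ?invr_ge0 ?(ltW N0)//.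
    by rewrite ler_pdivrMl.
  rewrite mulmx_col; apply: le_trans; first exact: enorm_sum.
  apply: (@le_trans _ _ (\sum_(c < K) eps)); last first.
    by rewrite sumr_const card_ord -[_ *+ K]mulr_natl.
  apply: ler_sum => c _; rewrite enormZ.
  have [cj|jc] := leqP c j; last first.
    rewrite (_ : t c 0 = 0) ?normr0 ?mul0r//; apply: chebT_jacmx_support => // i.
    by rewrite x0E; case: (i : nat).
  rewrite -[leRHS]mul1r ler_pM ?enorm_ge0//.
  have -> : A' *m Q - Q *m T' = N^-1 *: (A *m Q - Q *m T).
    by rewrite /A' /T' -scalemxAl -scalemxAr scalerBr.
  rewrite linearZ linearB /= enormZ.
  rewrite ger0_norm ?invr_ge0 ?(ltW N0)// ler_pdivrMl//.
  rewrite colmx_jacmx// (_ : col c (A *m Q) = A *m q c).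
    apply: le_trans (q_res c (ltn_ord c) (leq_ltn_trans (cj : (c < j.+1)%N) jk)) _.
    by rewrite ler_peMl.
  by rewrite !colE -mulmxA colmxE (bigD1 c)//= !mxE !eqxx scale1r big1 ?addr0// => i ic;
    rewrite mxE (negbTE ic) scale0r.
rewrite lerD2r ler_wpM2r//; first by apply: sumr_ge0 => j _; rewrite chebc_ge0.
have := QF x0; have K0 : 0 <= K%:R :> R by [].
have : 2 * K%:R * enorm x0 <= 2 * K%:R * 1 by rewrite ler_wpM2l// mulr_ge0.
lra.
Qed.

End LanczosPower.

(** * Rounding errors *)

Section RoundingErrors.
Context {R : realType}.
Variables (F : fpu R) (e : R).
Hypothesis req1 : requirement1 e F.
Hypothesis e0 : 0 <= e.
Implicit Types m n : nat.

Lemma fl_opP o x y : (o = Div -> y != 0) ->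
  exists2 d, `|d| <= e & fl_op F o x y = (1 + d) * exact_op o x y.
Proof. by case: req1 => + _ oy => /(_ o x y oy). Qed.

(** With y = 2Ne <= 1 one more factor adds at most e(1 + y) <= 2e. It serves for accumulated
    roundings and later for the q-th power of the norm bound. *)
Lemma growth_le (N : nat) : 2 * N%:R * e <= 1 -> (1 + e) ^+ N - 1 <= 2 * N%:R * e.
Proof.
have epos := e0.
elim: N => [|N IH]; first by rewrite expr0 subrr mulr0 mul0r.
rewrite exprS -[N.+1%:R]natr1 => h.
have Ne : 2 * N%:R * e <= 1 by lra.
have Ne0 : 0 <= 2 * N%:R * e by rewrite !mulr_ge0.
have := IH Ne; set z := (1 + e) ^+ N; set y := 2 * N%:R * e in Ne Ne0 *.
have -> : 2 * (N%:R + 1) * e = y + 2 * e by rewrite /y; ring.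
by move=> hz; nra.
Qed.

(** The exponent counts roundings per term: one product and at most one addition per entry, the
    addition to the initial 0 included. *)
Lemma fdot_foldl_err n (u v : 'cV[R]_n) (s : seq 'I_n) :
  `|value (foldl (fun acc i =>
       let* s := acc in let* p := fmul F (u i 0) (v i 0) in fadd F s p)
        (tick 0) s) - \sum_(i <- s) u i 0 * v i 0| <=
  ((1 + e) ^+ (size s).+1 - 1) * \sum_(i <- s) `|u i 0 * v i 0|.
Proof.
have epos := e0.
elim/last_ind: s => [|s i].
  by rewrite /= !big_nil subrr normr0 mulr0.
rewrite foldl_rcons -cats1 !big_cat !big_seq1 /= size_cat addn1.
set acc := foldl _ _ s; set S := \sum_(j <- s) _; set P := \sum_(j <- s) _ => IH.
set p := u i 0 * v i 0.
have [d1 d1e E1] := @fl_opP Mul (u i 0) (v i 0) ltac:(by []).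
have [d2 d2e E2] := @fl_opP Add (value acc) (fl_op F Mul (u i 0) (v i 0)) ltac:(by []).
rewrite -[X in X - _]/(fl_op F Add (value acc) (fl_op F Mul (u i 0) (v i 0))).
rewrite E2 E1 /= -/p.
have P0 : 0 <= P by apply: sumr_ge0.
have SP : `|S| <= P by apply: ler_norm_sum.
set a := value acc in IH *.
set G := (1 + e) ^+ (size s).+1 in IH *.
have G1 : 1 + e <= G by rewrite /G exprS ler_peMr ?exprn_ege1; lra.
have -> : (1 + e) ^+ (size s).+2 = (1 + e) * G by rewrite exprS.
have -> : (1 + d2) * (a + (1 + d1) * p) - (S + p)
   = (1 + d2) * (a - S) + (d2 * S + (d1 + d2 + d1 * d2) * p) by ring.
have h1 : `|1 + d2| <= 1 + e by rewrite (le_trans (ler_normD _ _))// normr1 lerD2l.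
have h2 : `|d1 + d2 + d1 * d2| <= e + e + e * e.
  by rewrite (le_trans (ler_normD _ _))// lerD// ?(le_trans (ler_normD _ _)) ?lerD// normrM ler_pM.
apply: le_trans (ler_normD _ _) _; rewrite normrM.
apply: (@le_trans _ _ ((1 + e) * ((G - 1) * P) + (e * P + (e + e + e * e) * `|p|))).
  rewrite lerD//; first by rewrite ler_pM.
  rewrite (le_trans (ler_normD _ _))// lerD//; first by rewrite normrM ler_pM.
  by rewrite [leLHS]normrM ler_wpM2r.
have hp : (e + e + e * e) * `|p| <= ((1 + e) * G - 1) * `|p|.
  by rewrite ler_wpM2r//; nra.
have -> : ((1 + e) * G - 1) * (P + `|p|)
  = (1 + e) * ((G - 1) * P) + (e * P + ((1 + e) * G - 1) * `|p|) by ring.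
by rewrite !lerD2l.
Qed.

Lemma sum_normM_le n (u v : 'cV[R]_n) :
  \sum_i `|u i 0 * v i 0| <= enorm u * enorm v.
Proof.
pose abs (w : 'cV[R]_n) : 'cV_n := \col_i `|w i 0|.
have absE w : enorm (abs w) = enorm w.
  rewrite !enormE; congr Num.sqrt; apply: eq_bigr => i _.
  by rewrite mxE -normrM ger0_norm// -expr2 sqr_ge0.
rewrite -(absE u) -(absE v); apply: le_trans (dot_le _ _); apply: le_trans (ler_norm _).
by rewrite le_eqVlt; apply/orP; left; apply/eqP; apply: eq_bigr => i _; rewrite !mxE normrM.
Qed.

Lemma fdot_err n (u v : 'cV[R]_n) g : 2 * n.+1%:R * e <= g -> g <= 1 ->
  `|value (fdot F u v) - dot u v| <= g * (enorm u * enorm v).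
Proof.
have epos := e0.
move=> ng g1; have := fdot_foldl_err u v (enum 'I_n).
rewrite size_enum_ord -/(fdot F u v) !big_enum /= => h; apply: le_trans h _.
rewrite ler_pM ?sum_normM_le//; first by rewrite subr_ge0 exprn_ege1//; lra.
  exact: sumr_ge0.
by apply: (le_trans _ ng); apply: growth_le; exact: le_trans ng g1.
Qed.

(** The scalar product accounts for n + 1 units of 2e; the rounding of the square root costs at most
    2e |v|, paid by the two further units. *)
Lemma fnorm_err n (v : 'cV[R]_n) g : 2 * n.+3%:R * e <= g -> g <= 1 / 2 ->
  `|value (fnorm F v) - enorm v| <= g * enorm v.
Proof.
have epos := e0.
move=> ng g1; pose g' := 2 * n.+1%:R * e.
have g'g : g' + 4 * e <= g.
  by apply: le_trans ng; rewrite -[n.+3%:R]natr1 -[n.+2%:R]natr1 /g'; lra.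
have g'0 : 0 <= g' by rewrite !mulr_ge0.
have := @fdot_err n v v g' (lexx _) ltac:(lra).
set x := value (fdot F v v); rewrite -expr2 enorm_sqr ler_distl => /andP[xl xu].
have D0 := dot_ge0 v; set D := dot v v in xl xu D0 *.
have x0 : 0 <= x by nra.
have [d de E] : rel_approx e (fl_sqrt F x) (Num.sqrt x) by case: req1 => _; apply.
rewrite [value _]E enormE -/D.
have sD0 := sqrtr_ge0 D; have sx0 := sqrtr_ge0 x.
have sD2 : Num.sqrt D ^+ 2 = D by rewrite sqr_sqrtr.
have sx2 : Num.sqrt x ^+ 2 = x by rewrite sqr_sqrtr.
set sD := Num.sqrt D in sD0 sD2 *; set sx := Num.sqrt x in sx0 sx2 *.
have su : sx <= (1 + g') * sD.
  rewrite -ler_sqr ?nnegrE ?mulr_ge0 ?addr_ge0// exprMn sx2 sD2; nra.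
have sl : (1 - g') * sD <= sx.
  have h0 : 0 <= 1 - g' by lra.
  rewrite -ler_sqr ?nnegrE ?mulr_ge0// exprMn sx2 sD2; nra.
have ds : `|d * sx| <= e * (2 * sD).
  by rewrite normrM (ger0_norm sx0) ler_pM//; nra.
move: ds; rewrite ler_norml ler_distl => /andP[? ?]; apply/andP.
have : (g' + 2 * e) * sD <= g * sD by rewrite ler_wpM2r//; lra.
by split; lra.
Qed.

Lemma fscale_err n (v : 'cV[R]_n) b : b != 0 ->
  enorm (value (fscale F v b) - b^-1 *: v) <= e * (`|b|^-1 * enorm v).
Proof.
move=> b0; rewrite -normfV -enormZ; apply: enorm_pointwise => // i.
have [d de E] := @fl_opP Div (v i 0) b (fun _ => b0).
rewrite !mxE [value _]E /= [v i 0 / b]mulrC mulrDl mul1r addrAC subrr add0r normrM.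
by rewrite ler_wpM2r.
Qed.

Lemma faxpy_err n (w v : 'cV[R]_n) a : e <= 1 ->
  enorm (value (faxpy F w a v) - (w - a *: v)) <= 3 * e * (enorm w + `|a| * enorm v).
Proof.
have epos := e0.
move=> e1; set r := value _.
pose abs (y : 'cV[R]_n) : 'cV_n := \col_i `|y i 0|.
have absE y : enorm (abs y) = enorm y.
  rewrite !enormE; congr Num.sqrt; apply: eq_bigr => i _.
  by rewrite mxE -normrM ger0_norm// -expr2 sqr_ge0.
apply: (@le_trans _ _ (3 * e * enorm (abs w + `|a| *: abs v))); last first.
  rewrite ler_wpM2l ?mulr_ge0// (le_trans (enormD _ _))// enormZ normr_id.
  by rewrite !absE.
apply: enorm_pointwise => [|i]; first by rewrite mulr_ge0.
have [d1 d1e E1] := @fl_opP Mul a (v i 0) ltac:(by []).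
have [d2 d2e E2] := @fl_opP Defs.Sub (w i 0) (fl_op F Mul a (v i 0)) ltac:(by []).
rewrite /r !mxE [value _]E2 /= E1 /=.
rewrite [in leRHS]ger0_norm; last by rewrite addr_ge0// mulr_ge0.
have -> : (1 + d2) * (w i 0 - (1 + d1) * (a * v i 0)) - (w i 0 - a * v i 0)
   = d2 * w i 0 - (d1 + d2 + d1 * d2) * (a * v i 0) by ring.
rewrite (le_trans (ler_normB _ _))// !normrM mulrDr.
have h2 : `|d1 + d2 + d1 * d2| <= 3 * e.
  have : `|d1 + d2 + d1 * d2| <= e + e + e * e.
    by rewrite (le_trans (ler_normD _ _))// lerD// ?(le_trans (ler_normD _ _)) ?lerD// normrM ler_pM.
  by nra.
rewrite lerD//; first by rewrite ler_wpM2r//; move: d2e; lra.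
by rewrite ler_wpM2r// mulr_ge0.
Qed.

Lemma fmulmx_err m n (M : 'M[R]_(m, n)) (v : 'cV[R]_n) g :
  2 * n.+1%:R * e <= g -> g <= 1 ->
  enorm (value (fmulmx F M v) - M *m v) <= g * (Num.sqrt (fnorm2 M) * enorm v).
Proof.
move=> ng g1; have g0 : 0 <= g by apply: le_trans ng; rewrite !mulr_ge0.
rewrite enorm_le ?mulr_ge0 ?sqrtr_ge0 ?enorm_ge0// !exprMn sqr_sqrtr ?fnorm2_ge0//.
rewrite fnorm2_row mulr_suml mulr_sumr; apply: ler_sum => i _.
have -> : (value (fmulmx F M v) - M *m v) i 0
    = value (fdot F (row i M)^T v) - dot (row i M)^T v.
  by rewrite -mulmx_dot [LHS]mxE; congr (_ + _); rewrite [LHS]mxE.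
rewrite -expr2.
rewrite -[leLHS]real_normK ?num_real// -!exprMn ler_sqr ?nnegrE ?mulr_ge0 ?enorm_ge0//.
exact: fdot_err.
Qed.

End RoundingErrors.

(** * Error analysis of one Lanczos iteration *)

Section Iteration.
Context {R : realType}.

(** All errors are measured in units U = g bm lam. The bound on beta may grow from b lam to (b + 7)
    lam, 6 here and 1 in the computed norm. The bound on <w2, q> is a fixed multiple of U: the
    coefficient al is computed from w1 itself, so the previous loss of orthogonality enters only
    through the size of al and does not accumulate. *)
Lemma lanczos_step_err n (A : 'M[R]_n) (q qp w0 w1 w2 : 'cV[R]_n)
    (al be lam g b bm : R) :
  0 < lam -> 0 <= g -> 1 <= b -> b + 7 <= bm -> 1000 * (g * bm) <= 1 ->
  (forall x, enorm (A *m x) <= lam * enorm x) ->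
  `|dot q q - 1| <= 10 * g -> enorm qp <= 1 + 4 * g -> `|be| <= b * lam ->
  `|be * dot q qp| <= 50 * (g * bm * lam) ->
  enorm (w0 - A *m q) <= g * lam * enorm q ->
  enorm (w1 - (w0 - be *: qp)) <= g * (enorm w0 + `|be| * enorm qp) ->
  `|al - dot w1 q| <= g * (enorm w1 * enorm q) ->
  enorm (w2 - (w1 - al *: q)) <= g * (enorm w1 + `|al| * enorm q) ->
  [/\ `|dot q (A *m q) - al| <= 60 * (g * bm * lam),
      enorm w2 <= (b + 6) * lam,
      `|dot w2 q| <= 40 * (g * bm * lam) &
      enorm (A *m q - (be *: qp + al *: q) - w2) <= 12 * (g * bm * lam)].
Proof.
move=> lam0 g0 b1 bbm gbm Ale qn qpn bel orth E0 E1 E2 E3.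
set G := g * lam; set B := b * lam in bel *; set M := bm * lam.
have -> : g * bm * lam = g * M by rewrite /M mulrA.
rewrite -mulrA -/M in orth.
set U := g * M in orth *.
have bm1 : 1 <= bm by clear -b1 bbm; lra.
have GM : G <= g * M by rewrite /G /M ler_wpM2l// ler_peMl// ltW.
have G0 : 0 <= G by rewrite mulr_ge0// ltW.
have U0 : G <= U by [].
have Ul : 1000 * U <= lam.
  rewrite /U /M; have : 1000 * (g * bm) * lam <= 1 * lam by rewrite ler_wpM2r// ltW.
  lra.
have BM : B + 7 * lam <= M.
  by rewrite /B /M -mulrDl ler_wpM2r// ltW.
have Bl : lam <= B by rewrite /B ler_peMl// ltW.
have gs x : x <= M -> g * x <= U by move=> xM; rewrite /U ler_wpM2l.
have g1 : 1000 * g <= 1.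
  have : g * 1 <= g * bm by rewrite ler_wpM2l//; lra.
  by lra.
have hG : g * lam = G by [].
have hB : b * lam = B by [].
have bE : (b + 6) * lam = B + 6 * lam by rewrite mulrDl.
clearbody G B U M; clear bbm gbm b1 bm1.
have gB1 : g * B <= U by apply: gs; clear -BM lam0; lra.
have nq0 := enorm_ge0 q; set nq := enorm q in E0 E2 E3 nq0.
have nq2 : nq ^+ 2 <= 101 / 100.
  rewrite enorm_sqr; have := le_trans (ler_norm _) qn.
  by move: (dot q q) => x; clear -g1; lra.
have nq1 : nq <= 101 / 100 by clear -nq2 nq0; nra.
have dotq (x : 'cV_n) c : enorm x <= c -> `|dot x q| <= 101 / 100 * c.
  move=> xc; apply: le_trans (dot_le _ _) _; rewrite mulrC ler_pM ?enorm_ge0//.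
have Aq : enorm (A *m q) <= 101 / 100 * lam.
  by apply: le_trans (Ale q) _; rewrite mulrC ler_wpM2r// ltW.
have E0' : enorm (w0 - A *m q) <= 101 / 100 * G.
  by apply: le_trans E0 _; rewrite hG mulrC ler_wpM2r.
have w0n : enorm w0 <= 101 / 100 * lam + 101 / 100 * G.
  apply: le_trans (le_enorm_diff _ (A *m q)) _; exact: lerD.
have qpb : `|be| * enorm qp <= B + 4 * U.
  apply: (@le_trans _ _ (B * (1 + 4 * g))).
    by rewrite ler_pM ?enorm_ge0.
  by clear -gB1; lra.
have s1 : enorm w0 + `|be| * enorm qp <= B + 2 * lam.
  by move: w0n qpb; move: (enorm w0) (`|be| * _) => x y; clear -Ul lam0 G0 U0; lra.
have E1' : enorm (w1 - (w0 - be *: qp)) <= U.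
  by apply: le_trans E1 _; apply: gs; move: s1; clear -BM lam0; lra.
have w1n : enorm w1 <= B + 2 * lam + U.
  apply: le_trans (le_enorm_diff _ (w0 - be *: qp)) _; rewrite lerD//.
  by apply: le_trans (enormB _ _) _; rewrite enormZ.
have w1q : g * (enorm w1 * nq) <= 101 / 100 * U.
  rewrite mulrA mulrC ler_pM ?mulr_ge0 ?enorm_ge0//; apply: gs.
  by move: w1n; clear -BM Ul lam0 G0 U0; lra.
have alw1 : `|al - dot w1 q| <= 101 / 100 * U by apply: le_trans E2 w1q.
have d1 := dotq _ _ E1'; have d0 := dotq _ _ E0'.
(* Since w1 contains - be qp, the coefficient al deviates from <q, A q> by be <q, qp>; this is the
   50 of the 54. *)
have alA : `|dot q (A *m q) - al| <= 54 * U.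
  have -> : dot q (A *m q) - al = be * dot q qp - (al - dot w1 q)
      - dot (w1 - (w0 - be *: qp)) q - dot (w0 - A *m q) q.
    by rewrite !dotE (dotC q (A *m q)) (dotC q qp); ring.
  move: alw1 d1 d0 orth; move: (be * _) (al - _) (dot (w1 - _) q) (dot (w0 - _) q).
  move=> x y z t; rewrite !ler_norml; clear -U0 G0.
  by move=> /andP[? ?] /andP[? ?] /andP[? ?] /andP[? ?]; apply/andP; split; lra.
have dAq : `|dot q (A *m q)| <= 103 / 100 * lam.
  rewrite dotC; apply: le_trans (dotq _ _ Aq) _.
  by clear -lam0; lra.
have aln : `|al| <= 11 / 10 * lam.
  move: alA dAq; move: (dot _ _) => x; rewrite !ler_norml; clear -Ul lam0.
  by move=> /andP[? ?] /andP[? ?]; apply/andP; split; lra.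
have alq : `|al| * nq <= 12 / 10 * lam.
  apply: (@le_trans _ _ (11 / 10 * lam * (101 / 100))); last by clear -lam0; lra.
  by rewrite ler_pM.
have s2 : enorm w1 + `|al| * nq <= B + 4 * lam.
  by move: w1n alq; move: (enorm w1) (`|al| * nq) => x y; clear -Ul lam0; lra.
have E3' : enorm (w2 - (w1 - al *: q)) <= U.
  by apply: le_trans E3 _; apply: gs; move: s2; clear -BM lam0; lra.
have w2n : enorm w2 <= B + 6 * lam.
  apply: le_trans (le_enorm_diff _ (w1 - al *: q)) _.
  have := enormB w1 (al *: q); rewrite enormZ -/nq.
  move: s2 E3'; move: (enorm w1 + _) (enorm (w1 - _)) (enorm (w2 - _)) => x y z.
  by clear -Ul lam0; lra.
split.
- by apply: le_trans alA _; clear -U0 G0; lra.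
- by rewrite bE.
- have d3 := dotq _ _ E3'.
  have -> : dot w2 q = dot (w2 - (w1 - al *: q)) q - (al - dot w1 q) - al * (dot q q - 1).
    by rewrite !dotE; ring.
  have h : `|al * (dot q q - 1)| <= 11 * U.
    rewrite normrM; apply: (@le_trans _ _ (11 / 10 * lam * (10 * g))).
      by rewrite ler_pM.
    by clear -hG U0; lra.
  move: h d3 alw1; move: (al * _) (dot (w2 - _) q) (al - _) => x y z.
  rewrite !ler_norml; clear -U0 G0.
  by move=> /andP[? ?] /andP[? ?] /andP[? ?]; apply/andP; split; lra.
- have -> : A *m q - (be *: qp + al *: q) - w2
    = - (w0 - A *m q) - (w1 - (w0 - be *: qp)) - (w2 - (w1 - al *: q)).
    by move: (A *m q) => y; apply/matrixP => i j; rewrite !mxE; ring.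
  apply: le_trans (enormB _ _) _; have := enormB (- (w0 - A *m q)) (w1 - (w0 - be *: qp)).
  rewrite enormN; move: E0' E1' E3'.
  move: (enorm (w0 - _)) (enorm (w1 - _)) (enorm (w2 - _)) (enorm (_ - (w1 - _))) => x y z t.
  by clear -U0 G0; lra.
Qed.

(** Orthogonality is recorded as a bound on b' <q', q>, not on <q', q>: when b' is tiny the
    normalised vector may be far from orthogonal to q, but the product is what the recurrence uses.
    The bound 50 U is the one assumed for the preceding pair, so the invariant closes. *)
Lemma lanczos_normalize_err n (q w2 q' : 'cV[R]_n) (lam g b bm b' : R) :
  0 < lam -> 0 <= g -> 1 <= b -> b + 7 <= bm -> 1000 * (g * bm) <= 1 ->
  `|dot q q - 1| <= 10 * g -> enorm w2 <= (b + 6) * lam ->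
  `|dot w2 q| <= 40 * (g * bm * lam) ->
  `|b' - enorm w2| <= g * enorm w2 -> b' != 0 ->
  enorm (q' - b'^-1 *: w2) <= g * (`|b'|^-1 * enorm w2) ->
  [/\ `|dot q' q' - 1| <= 10 * g, enorm q' <= 1 + 4 * g, `|b'| <= (b + 7) * lam,
      `|b' * dot q' q| <= 50 * (g * bm * lam) &
      enorm (w2 - b' *: q') <= 2 * (g * bm * lam)].
Proof.
move=> lam0 g0 b1 bbm gbm qn w2n w2q; rewrite ler_distl => /andP[bl bu] b'0 Eq'.
set M := bm * lam.
have E : g * bm * lam = g * M by rewrite /M mulrA.
rewrite E in w2q *; set U := g * M in w2q *.
have g1 : 1000 * g <= 1.
  have : g * 1 <= g * bm by rewrite ler_wpM2l//; lra.
  by lra.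
have nw0 := enorm_ge0 w2; set nw := enorm w2 in w2n bl bu Eq' nw0 *.
have nwM : nw <= M.
  by apply: le_trans w2n _; rewrite ler_wpM2r ?(ltW lam0)//; lra.
have U0 : g * nw <= U by rewrite ler_wpM2l.
have Ul : 1000 * U <= lam.
  rewrite /U /M; have : 1000 * (g * bm) * lam <= 1 * lam by rewrite ler_wpM2r// ltW.
  lra.
have b'p : 0 < b'.
  rewrite lt0r b'0 /=; apply: le_trans bl; rewrite subr_ge0 ler_piMl//; lra.
rewrite (gtr0_norm b'p) in Eq' *.
set r := b'^-1 * nw in Eq'.
have rb : r * b' = nw by rewrite /r mulrAC mulVf ?mul1r.
have r0 : 0 <= r by rewrite mulr_ge0// invr_ge0 ltW.
have ru : r <= 1 + 2 * g.
  rewrite -(ler_pM2r b'p) rb; nra.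
have rl : 1 - g <= r.
  rewrite -(ler_pM2r b'p) rb; nra.
have rE : enorm (b'^-1 *: w2) = r by rewrite enormZ gtr0_norm ?invr_gt0.
clearbody r U.
have qu : enorm q' <= 1 + 4 * g.
  apply: le_trans (le_enorm_diff _ (b'^-1 *: w2)) _; rewrite rE; nra.
have ql : 1 - 2 * g <= enorm q'.
  have := le_enorm_diff (b'^-1 *: w2) q'; rewrite rE -(enormN (_ - _)) opprB => h1.
  have h2 : enorm (q' - b'^-1 *: w2) <= g * r by [].
  by clear -h1 h2 rl ru g0 g1; nra.
have nq : enorm q <= 101 / 100.
  rewrite enorm_le; last by clear; lra.
  by have := le_trans (ler_norm _) qn; move: (dot q q) => x; rewrite expr2; clear -g1; lra.
have err : enorm (w2 - b' *: q') <= U.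
  have -> : w2 - b' *: q' = - b' *: (q' - b'^-1 *: w2).
    by rewrite scalerBr !scaleNr scalerA mulfV// scale1r opprK addrC.
  rewrite enormZ normrN gtr0_norm//.
  apply: (@le_trans _ _ (b' * (g * r))); first by rewrite ler_pM2l.
  by rewrite mulrC -mulrA rb.
split=> //.
- rewrite -enorm_sqr; set x := enorm q' in qu ql *.
  clearbody x; rewrite ler_norml; apply/andP.
  by split; clear -qu ql g0 g1; nra.
- by move: bu w2n U0 Ul lam0; clear; lra.
- have -> : b' * dot q' q = dot w2 q - dot (w2 - b' *: q') q by rewrite !dotE; ring.
  have : `|dot (w2 - b' *: q') q| <= U * (101 / 100).
    by apply: le_trans (dot_le _ _) _; rewrite ler_pM ?enorm_ge0.
  move: w2q; move: (dot w2 q) (dot (w2 - _) q) => x y; rewrite !ler_norml; clear.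
  by move=> /andP[? ?] /andP[? ?]; apply/andP; split; lra.
- by have := enorm_ge0 (w2 - b' *: q'); move: err; move: (enorm _) => x; clear; lra.
Qed.

End Iteration.

(** * Invariants of the whole Lanczos loop *)

Section Loop.
Context {R : realType}.

Definition vec_before n (qp : 'cV[R]_n) l i := if i is i'.+1 then vec_at l i' else qp.

(** The residual clause skips only the iteration that exhausts the fuel, whose successor vector is
    not stored. At an early exit the clause does apply, and the missing successor is read as the
    default vector 0. *)
Definition local_recurrence n (A : 'M[R]_n) (g lam bm : R) (fuel : nat)
    (qp : 'cV[R]_n) (l : seq ('cV[R]_n * R * R)) :=
  forall i, (i < size l)%N ->
  [/\ `|dot (vec_at l i) (vec_at l i) - 1| <= 10 * g,
      `|beta_at l i| <= bm * lam,
      `|beta_at l i * dot (vec_at l i) (vec_before qp l i)| <= 50 * (g * bm * lam),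
      `|dot (vec_at l i) (A *m vec_at l i) - alpha_at l i| <= 60 * (g * bm * lam) &
      (i.+1 < fuel)%N ->
      enorm (A *m vec_at l i - (beta_at l i *: vec_before qp l i
        + alpha_at l i *: vec_at l i
        + beta_at l i.+1 *: vec_at l i.+1)) <= 60 * (g * bm * lam)].

Lemma lanczos_loopS n (F : fpu R) (mulA : 'cV[R]_n -> computation 'cV[R]_n)
    fuel qp q be w1 al w2 b' :
  w1 = value (faxpy F (value (mulA q)) be qp) -> al = value (fdot F w1 q) ->
  w2 = value (faxpy F w1 al q) -> b' = value (fnorm F w2) ->
  value (lanczos_loop F mulA fuel.+1 qp q be) =
  if b' == 0 then [:: (q, al, be)]
  else (q, al, be) :: value (lanczos_loop F mulA fuel q (value (fscale F w2 b')) b').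
Proof. by move=> -> -> -> ->; rewrite /=; case: eqP. Qed.

(** The bound b on the current beta is generalised in the induction: each iteration spends 7 of the
    reserve b + 7 fuel <= bm, so that bm serves as a uniform bound. *)
Lemma lanczos_loop_recurrence n (A : 'M[R]_n) (F : fpu R) (e g lam bm : R)
    (mulA : 'cV[R]_n -> computation 'cV[R]_n) fuel qp q be b :
  requirement1 e F -> 0 <= e -> 2 * n.+3%:R * e <= g -> 0 < lam ->
  1000 * (g * bm) <= 1 -> 1 <= bm ->
  (forall x, enorm (A *m x) <= lam * enorm x) ->
  (forall x, enorm (value (mulA x) - A *m x) <= g * lam * enorm x) ->
  1 <= b -> b + 7 * fuel%:R <= bm ->
  `|dot q q - 1| <= 10 * g -> enorm q <= 1 + 4 * g -> enorm qp <= 1 + 4 * g ->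
  `|be| <= b * lam -> `|be * dot q qp| <= 50 * (g * bm * lam) ->
  let l := value (lanczos_loop F mulA fuel qp q be) in
  [/\ (size l <= fuel)%N,
      (0 < fuel)%N -> [/\ (0 < size l)%N, vec_at l 0 = q & beta_at l 0 = be] &
      local_recurrence A g lam bm fuel qp l].
Proof.
move=> req1 e0 eg lam0 gbm bm1 Ale mulA_err.
have eg6 : 6 * e <= g.
  apply: le_trans eg; rewrite ler_wpM2r// -[6]/(2 * 3)%:R natrM ler_pM2l//.
  by rewrite ler_nat.
have eg1 : 2 * n.+1%:R * e <= g.
  by apply: le_trans eg; rewrite ler_wpM2r// ler_pM2l// ler_nat leqW.
have g0 : 0 <= g by clear -eg6 e0; lra.
have g1 : 1000 * g <= 1.
  have : g * 1 <= g * bm by rewrite ler_wpM2l.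
  by clear -gbm; lra.
elim: fuel qp q be b => [|fuel IH] qp q be b b1 bbm qn qn1 qpn bel orth.
  by split.
have U0 : 0 <= g * bm * lam.
  by rewrite !mulr_ge0 ?(ltW lam0)// (le_trans _ bm1).
have bm7 : b + 7 <= bm.
  by move: bbm; rewrite -[fuel.+1%:R]natr1; have : 0 <= fuel%:R :> R by []; clear; lra.
have bbm' : b * lam <= bm * lam by rewrite ler_wpM2r ?(ltW lam0)//; clear -bm7; lra.
have e1 : e <= 1 by clear -eg6 e0 g1; lra.
have ge : 3 * e <= g by clear -eg6 e0 g1; lra.
have g1' : g <= 1 by clear -g1 g0; lra.
pose w0 := value (mulA q); pose w1 := value (faxpy F w0 be qp).
pose al := value (fdot F w1 q); pose w2 := value (faxpy F w1 al q).
pose b' := value (fnorm F w2).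
rewrite (lanczos_loopS fuel (erefl w1) (erefl al) (erefl w2) (erefl b')).
have E1 : enorm (w1 - (w0 - be *: qp)) <= g * (enorm w0 + `|be| * enorm qp).
  apply: le_trans (faxpy_err req1 e0 _ _ _ e1) _.
  by rewrite ler_wpM2r ?addr_ge0 ?mulr_ge0 ?enorm_ge0.
have E2 : `|al - dot w1 q| <= g * (enorm w1 * enorm q).
  exact: (fdot_err req1 e0 _ _ eg1 g1').
have E3 : enorm (w2 - (w1 - al *: q)) <= g * (enorm w1 + `|al| * enorm q).
  apply: le_trans (faxpy_err req1 e0 _ _ _ e1) _.
  by rewrite ler_wpM2r ?addr_ge0 ?mulr_ge0 ?enorm_ge0.
have [alE w2n w2q resE] := lanczos_step_err lam0 g0 b1 bm7 gbm Ale qn qpn bel orth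
   (mulA_err q) E1 E2 E3.
have E4 : `|b' - enorm w2| <= g * enorm w2.
  apply: (fnorm_err req1 e0 _ eg); clear -g1 g0; lra.
case: eqP => [b'0|/eqP b'0].
  split=> // -[|[]]// _; rewrite /vec_at /beta_at /alpha_at /=; split=> //.
  - exact: le_trans bel bbm'.
  - move=> _; rewrite scaler0 addr0.
    (* The computed norm has relative error g < 1, so it can vanish only if the exact norm does; the
       residual then needs no successor term. *)
    have w20 : w2 = 0.
      apply/eqP; rewrite -enorm_eq0 eq_le enorm_ge0 andbT.
      move: E4; rewrite b'0 sub0r normrN ger0_norm ?enorm_ge0//.
      by have := enorm_ge0 w2; move: (enorm w2) => x; clear -g1; nra.
    move: resE; rewrite w20 subr0 => resE; apply: le_trans resE _.
    by clear -U0; lra.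
set q' := value (fscale F w2 b').
have E5 : enorm (q' - b'^-1 *: w2) <= g * (`|b'|^-1 * enorm w2).
  apply: le_trans (fscale_err req1 e0 _ b'0) _.
  rewrite ler_wpM2r ?mulr_ge0 ?enorm_ge0 ?invr_ge0//.
  by clear -eg6 e0 g1; lra.
have [q'n q'n1 b'n orth' res'] :=
  lanczos_normalize_err lam0 g0 b1 bm7 gbm qn w2n w2q E4 b'0 E5.
have bbm7 : b + 7 + 7 * fuel%:R <= bm.
  by move: bbm; rewrite -[fuel.+1%:R]natr1; clear; lra.
have b71 : 1 <= b + 7 by clear -b1; lra.
have [sl hd rec] := IH q q' b' (b + 7) b71 bbm7 q'n q'n1 qn1 b'n orth'.
set l := value _ in sl hd rec *.
split=> // -[|i]; rewrite /= ?ltnS => il.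
  rewrite /vec_at /beta_at /alpha_at /=; split=> //.
  - exact: le_trans bel bbm'.
  - move=> f0; have [_ v0 be0] := hd f0; rewrite -/(vec_at l 0) -/(beta_at l 0) v0 be0.
    have -> : A *m q - (be *: qp + al *: q + b' *: q')
      = A *m q - (be *: qp + al *: q) - w2 + (w2 - b' *: q').
      by rewrite opprD !addrA subrK.
    apply: le_trans (enormD _ _) _; move: resE res'; clear -U0.
    by move: (enorm _) (enorm _) => x y; lra.
have [h1 h2 h3 h4 h5] := rec i il.
split=> //; by case: i il h1 h2 h3 h4 h5.
Qed.

End Loop.

(** * Powers through an inexact eigendecomposition *)

Section Eigendecomposition.
Context {R : realType}.

Lemma iter_mulmx_le n (S : 'M[R]_n) (M : R) x q : 0 <= M ->
  (forall y, enorm (S *m y) <= M * enorm y) ->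
  enorm (iter q (mulmx S) x) <= M ^+ q * enorm x.
Proof.
move=> M0 SM; elim: q => [|q IH]; first by rewrite mul1r.
by rewrite iterS exprS -mulrA (le_trans (SM _))// ler_wpM2l.
Qed.

Lemma iter_mulmx_perturb n (S T : 'M[R]_n) (M eta : R) x q : 0 <= M -> 0 <= eta ->
  (forall y, enorm (S *m y) <= M * enorm y) ->
  (forall y, enorm (T *m y) <= M * enorm y) ->
  (forall y, enorm ((S - T) *m y) <= eta * M * enorm y) ->
  enorm (iter q (mulmx S) x - iter q (mulmx T) x) <= q%:R * eta * M ^+ q * enorm x.
Proof.
move=> M0 eta0 SM TM STM; elim: q => [|q IH]; first by rewrite subrr enorm0 !mul0r.
rewrite !iterS; set s := iter q _ _ in IH *; set t := iter q _ x in IH *.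
have -> : S *m s - T *m t = S *m (s - t) + (S - T) *m t.
  by rewrite mulmxBr mulmxBl addrA subrK.
apply: le_trans (enormD _ _) _.
apply: (@le_trans _ _ (M * (q%:R * eta * M ^+ q * enorm x) + eta * M * (M ^+ q * enorm x))).
  apply: lerD; first by rewrite (le_trans (SM _))// ler_wpM2l.
  by rewrite (le_trans (STM _))// ler_wpM2l ?mulr_ge0// iter_mulmx_le.
rewrite -[q.+1%:R]natr1 exprS le_eqVlt; apply/orP; left; apply/eqP; ring.
Qed.

Lemma sqrt_fnorm2_le m n (M : 'M[R]_(m, n)) c : 0 <= c ->
  (forall j, enorm (col j M) <= c) -> Num.sqrt (fnorm2 M) <= n%:R * c.
Proof.
move=> c0 Mc; rewrite -ler_sqr ?nnegrE ?sqrtr_ge0 ?mulr_ge0// sqr_sqrtr ?fnorm2_ge0//.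
rewrite fnorm2_col; apply: (@le_trans _ _ (\sum_(j < n) c ^+ 2)).
  by apply: ler_sum => j _; rewrite ler_sqr ?nnegrE ?enorm_ge0.
rewrite sumr_const card_ord -[_ *+ n]mulr_natl exprMn ler_wpM2r ?sqr_ge0//.
by rewrite -natrX ler_nat; case: n {M Mc} => // n; rewrite expnS expn1 leq_pmulr.
Qed.

Lemma enorm_delta n (j : 'I_n) : enorm (delta_mx j 0 : 'cV[R]_n) = 1.
Proof.
rewrite enormE /dot (bigD1 j)//= big1 ?addr0 => [|i ij]; rewrite !mxE ?eqxx ?mulr1 ?sqrtr1//.
by rewrite (negbTE ij) mul0r.
Qed.

Lemma near_isometry m n (V : 'M[R]_(m, n)) eps1 : 0 <= eps1 ->
  (forall x, enorm ((V^T *m V - 1%:M) *m x) <= eps1 * enorm x) ->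
  (forall x, enorm (V *m x) <= (1 + eps1) * enorm x) /\
  (forall x, enorm (V^T *m x) <= (1 + eps1) * enorm x).
Proof.
move=> e0 hG.
have hV x : enorm (V *m x) <= (1 + eps1) * enorm x.
  rewrite enorm_le; last by rewrite mulr_ge0 ?addr_ge0 ?enorm_ge0.
  rewrite dot_mulmx mulmxA.
  have -> : dot x (V^T *m V *m x) = dot x x + dot x ((V^T *m V - 1%:M) *m x).
    by rewrite mulmxBl mul1mx dotBr addrC subrK.
  apply: (@le_trans _ _ (dot x x + eps1 * dot x x)).
    rewrite lerD2l; apply: le_trans (ler_norm _) _; apply: le_trans (dot_le _ _) _.
    by rewrite -enorm_sqr expr2 mulrCA ler_wpM2l ?enorm_ge0.
  rewrite exprMn enorm_sqr; have := dot_ge0 x; move: (dot x x) => d d0.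
  by clear -d0 e0; nra.
split=> // x; apply: le_trans (enorm_trmulmx _ _) _.
by rewrite ler_wpM2r ?enorm_ge0// specnorm_le// addr_ge0.
Qed.

Lemma iter_diag K (L : 'rV[R]_K) (x : 'cV[R]_K) q i :
  iter q (mulmx (diag_mx L)) x i 0 = L 0 i ^+ q * x i 0.
Proof.
elim: q => [|q IH]; first by rewrite mul1r.
by rewrite iterS mul_diag_mx mxE IH exprS mulrA.
Qed.

(** V is not exactly orthogonal, so V D^q V^T differs from S^q with S = V D V^T: each further factor
    S inserts G = V^T V, at relative cost 2 eps1. Replacing S by T costs another eps1 per factor,
    which together gives 3q eps1. *)
Lemma eigendecomposition_power K (T V : 'M[R]_K) (L : 'rV[R]_K) (N eps1 : R) x q :
  0 < N -> 0 <= eps1 -> eps1 <= 1 / 10 -> (0 < q)%N ->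
  (forall y, enorm (T *m y) <= N * enorm y) ->
  (forall y, enorm ((V *m diag_mx L *m V^T - T) *m y) <= eps1 * N * enorm y) ->
  (forall y, enorm ((V^T *m V - 1%:M) *m y) <= eps1 * enorm y) ->
  let M := (1 + 10 * eps1) * N in
  (forall y, enorm (diag_mx L *m y) <= M * enorm y) /\
  enorm (V *m iter q (mulmx (diag_mx L)) (V^T *m x) - iter q (mulmx T) x)
    <= 3 * q%:R * eps1 * M ^+ q * enorm x.
Proof.
move=> N0 e0 e1 q0 TN SN GN M.
have [VN VtN] := near_isometry e0 GN.
set D := diag_mx L in SN *; set S := V *m D *m V^T in SN *; set G := V^T *m V in GN *.
have M0 : 0 < M by rewrite mulr_gt0//; clear -e0; lra.
have NM : (1 + eps1) * N <= M by rewrite /M ler_wpM2r ?(ltW N0)//; clear -e0; lra.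
have ME : M = (1 + 10 * eps1) * N by [].
clearbody M.
have SM y : enorm (S *m y) <= (1 + eps1) * N * enorm y.
  have -> : S *m y = T *m y + (S - T) *m y by rewrite mulmxBl addrC subrK.
  apply: le_trans (enormD _ _) _; have := TN y; have := SN y.
  by move: (enorm ((S - T) *m y)) (enorm (T *m y)) (enorm y) => a b c; clear; lra.
have GM y : enorm (G *m y) <= (1 + eps1) * enorm y.
  have -> : G *m y = y + (G - 1%:M) *m y by rewrite mulmxBl mul1mx addrC subrK.
  apply: le_trans (enormD _ _) _; have := GN y.
  by move: (enorm ((G - 1%:M) *m y)) (enorm y) => a b; clear; lra.
have ed0 : 0 <= 1 + eps1 by clear -e0; lra.
have DM y : enorm (D *m y) <= M * enorm y.
  set d := specnorm D; have d0 : 0 <= d by exact: specnorm_ge0.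
  suff dM : d <= M.
    by apply: le_trans (enorm_mulmx _ _) _; rewrite ler_wpM2r ?enorm_ge0.
  (* A self-bounding estimate from D = V^T S V - (G - 1) D G - D (G - 1): the norm d occurs on the
     right with the small factor eps1 (2 + eps1) and is solved for. *)
  have dN : d <= (1 + eps1) ^+ 3 * N + eps1 * (2 + eps1) * d.
    apply: specnorm_le => [|z].
      by rewrite addr_ge0 ?mulr_ge0 ?exprn_ge0 ?(ltW N0)//; clear -e0; lra.
    have -> : D *m z = V^T *m (S *m (V *m z)) - (G - 1%:M) *m (D *m (G *m z))
       - D *m ((G - 1%:M) *m z).
      rewrite !mulmxBl !mul1mx mulmxBr /S /G !mulmxA opprB addrCA subrr addr0.
      by rewrite opprB addrC subrK.
    have h1 : enorm (V^T *m (S *m (V *m z))) <= (1 + eps1) ^+ 3 * N * enorm z.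
      have -> : (1 + eps1) ^+ 3 * N * enorm z
        = (1 + eps1) * ((1 + eps1) * N * ((1 + eps1) * enorm z)) by ring.
      apply: le_trans (VtN _) _; rewrite ler_wpM2l//.
      by apply: le_trans (SM _) _; rewrite ler_wpM2l ?mulr_ge0 ?(ltW N0).
    have h2 : enorm ((G - 1%:M) *m (D *m (G *m z))) <= eps1 * (d * ((1 + eps1) * enorm z)).
      apply: le_trans (GN _) _; rewrite ler_wpM2l//.
      by apply: le_trans (enorm_mulmx _ _) _; rewrite ler_wpM2l.
    have h3 : enorm (D *m ((G - 1%:M) *m z)) <= d * (eps1 * enorm z).
      by apply: le_trans (enorm_mulmx _ _) _; rewrite ler_wpM2l.
    apply: le_trans (enormB _ _) _.
    have := enormB (V^T *m (S *m (V *m z))) ((G - 1%:M) *m (D *m (G *m z))).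
    move: h1 h2 h3; move: (enorm (V^T *m _)) (enorm (_ *m (D *m (G *m _)))).
    move: (enorm (D *m _)) (enorm (_ - _)) (enorm z) => a b c f h; clear; lra.
  rewrite ME; have e20 : 0 <= eps1 ^+ 2 by rewrite sqr_ge0.
  have h1 : (1 + eps1) ^+ 3 * N <= (1 - eps1 * (2 + eps1)) * ((1 + 10 * eps1) * N).
    rewrite mulrA ler_wpM2r ?(ltW N0)//; clear -e0 e1; nra.
  have h2 : 0 < 1 - eps1 * (2 + eps1) by clear -e0 e1; nra.
  by rewrite -(ler_pM2l h2); move: dN h1; clear; lra.
split=> //.
pose a j := V *m iter j (mulmx D) (V^T *m x).
have step j : enorm (iter j.+1 (mulmx S) x - a j.+1)
    <= j%:R * (2 * eps1) * M ^+ j.+1 * enorm x.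
  elim: j => [|j IH].
    by rewrite /a /= !mulmxA subrr enorm0 !mul0r.
  have -> : iter j.+2 (mulmx S) x - a j.+2 = S *m (iter j.+1 (mulmx S) x - a j.+1)
     + V *m (D *m ((G - 1%:M) *m iter j.+1 (mulmx D) (V^T *m x))).
    rewrite !iterS mulmxBr mulmxBl mul1mx !mulmxBr /a /S /G !iterS !mulmxA.
    by rewrite addrA subrK.
  apply: le_trans (enormD _ _) _.
  set z := iter j.+1 (mulmx D) _.
  have zM : enorm z <= M ^+ j.+1 * ((1 + eps1) * enorm x).
    apply: le_trans (iter_mulmx_le _ _ (ltW M0) DM) _.
    by rewrite ler_wpM2l ?exprn_ge0 ?(ltW M0).
  have h2 : enorm (V *m (D *m ((G - 1%:M) *m z)))
      <= (1 + eps1) * (M * (eps1 * (M ^+ j.+1 * ((1 + eps1) * enorm x)))).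
    apply: le_trans (VN _) _; rewrite ler_wpM2l//.
    apply: le_trans (DM _) _; rewrite ler_wpM2l ?(ltW M0)//.
    by apply: le_trans (GN _) _; rewrite ler_wpM2l.
  have h1 : enorm (S *m (iter j.+1 (mulmx S) x - a j.+1)) <=
      M * (j%:R * (2 * eps1) * M ^+ j.+1 * enorm x).
    apply: (@le_trans _ _ (M * enorm (iter j.+1 (mulmx S) x - a j.+1))).
      by apply: le_trans (SM _) _; rewrite ler_wpM2r ?enorm_ge0.
    by rewrite ler_wpM2l ?(ltW M0).
  apply: le_trans (lerD h1 h2) _.
  have h3 : (1 + eps1) * (1 + eps1) * (eps1 * M ^+ j.+2 * enorm x)
    <= 2 * (eps1 * M ^+ j.+2 * enorm x).
    rewrite ler_wpM2r ?(mulr_ge0 (mulr_ge0 e0 (exprn_ge0 _ (ltW M0))) (enorm_ge0 _))//.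
    by clear -e0 e1; nra.
  rewrite -[j.+1%:R]natr1; move: h3; rewrite ![M ^+ j.+2]exprS.
  by move: (M ^+ j.+1) (enorm x) => p r; clear; lra.
case: q q0 => // q _.
have T2 : enorm (iter q.+1 (mulmx S) x - iter q.+1 (mulmx T) x)
    <= q.+1%:R * eps1 * M ^+ q.+1 * enorm x.
  apply: iter_mulmx_perturb => //; first exact: ltW.
  - by move=> y; apply: le_trans (SM _) _; rewrite ler_wpM2r ?enorm_ge0.
  - move=> y; apply: le_trans (TN _) _; rewrite ler_wpM2r ?enorm_ge0//.
    by apply: le_trans NM; rewrite ler_peMl ?(ltW N0)//; clear -e0; lra.
  - move=> y; apply: le_trans (SN _) _; rewrite ler_wpM2r ?enorm_ge0// ler_wpM2l//.
    by apply: le_trans NM; rewrite ler_peMl ?(ltW N0)//; clear -e0; lra.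
have -> : V *m iter q.+1 (mulmx D) (V^T *m x) - iter q.+1 (mulmx T) x
   = (iter q.+1 (mulmx S) x - iter q.+1 (mulmx T) x) - (iter q.+1 (mulmx S) x - a q.+1).
  by rewrite opprB [RHS]addrC addrA subrK.
apply: le_trans (enormB _ _) _; apply: le_trans (lerD T2 (step q)) _.
have : 0 <= 2 * eps1 * M ^+ q.+1 * enorm x.
  by rewrite (mulr_ge0 (mulr_ge0 _ (exprn_ge0 _ (ltW M0))) (enorm_ge0 _))// mulr_ge0.
rewrite -[q.+1%:R]natr1; move: (M ^+ q.+1) (enorm x) => p r; clear; lra.
Qed.

(** The factor K in the rounding part comes from the Frobenius norms of V and V^T, which are bounded
    by 2K through the norms of the columns. *)
Lemma apply_fun_err K (F : fpu R) (e g : R) (evalf : R -> computation R) (C_f : R)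
    (T V : 'M[R]_K) (L : 'rV[R]_K) (N eps1 : R) (x : 'cV[R]_K) q :
  requirement1 e F -> 0 <= e -> 2 * K.+3%:R * e <= g -> g * K%:R <= 1 / 10 ->
  eval_spec e C_f (fun x => x ^+ q) evalf ->
  0 < N -> 0 <= eps1 -> eps1 <= 1 / 10 -> (0 < q)%N -> (0 < K)%N ->
  (forall y, enorm (T *m y) <= N * enorm y) ->
  (forall y, enorm ((V *m diag_mx L *m V^T - T) *m y) <= eps1 * N * enorm y) ->
  (forall y, enorm ((V^T *m V - 1%:M) *m y) <= eps1 * enorm y) ->
  (forall i : 'I_K, x i 0 = (i == 0%N :> nat)%:R) ->
  enorm (value (apply_fun F evalf V L) - iter q (mulmx T) x)
    <= (3 * q%:R * eps1 + 30 * (K%:R * g)) * ((1 + 10 * eps1) * N) ^+ q.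
Proof.
move=> req1 e0 Kg gK hf N0 e10 e11 q0 K0 TN SN GN xE.
have [DM] := eigendecomposition_power x N0 e10 e11 q0 TN SN GN.
have [VN VtN] := near_isometry e10 GN.
have MN0 : 0 <= (1 + 10 * eps1) * N by rewrite mulr_ge0 ?(ltW N0)//; clear -e10; lra.
set M := (1 + 10 * eps1) * N in DM MN0 *.
set D := diag_mx L in SN DM *.
have x1 : enorm x = 1.
  rewrite enormE /dot (bigD1 (Ordinal K0))//= big1 ?addr0 => [|i i0].
    by rewrite xE /= mulr1 sqrtr1.
  by rewrite !xE (_ : (i == 0%N :> nat) = false) ?mulr0//; apply: negbTE.
rewrite x1 mulr1 => main.
have K1 : 1 <= K%:R :> R by rewrite ler1n.
have eg6 : 6 * e <= g.
  apply: le_trans Kg; rewrite ler_wpM2r// -[6]/(2 * 3)%:R natrM ler_pM2l//.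
  by rewrite ler_nat.
have g0 : 0 <= g by clear -eg6 e0; lra.
have g1 : g <= 1 / 10 by apply: le_trans gK; rewrite ler_peMr.
have gle1 : g <= 1 by clear -g1; lra.
have eg1 : 2 * K.+1%:R * e <= g.
  by apply: le_trans Kg; rewrite ler_wpM2r// ler_pM2l// ler_nat leqW.
set kg := K%:R * g.
have kg0 : 0 <= kg by rewrite mulr_ge0.
have kgg : g <= kg by rewrite ler_peMl.
have kg1 : kg <= 1 / 10 by rewrite /kg mulrC.
have VF : Num.sqrt (fnorm2 V) <= K%:R * 2.
  apply: sqrt_fnorm2_le => // j; rewrite colE; apply: le_trans (VN _) _.
  by rewrite enorm_delta mulr1; clear -e11; lra.
have VtF : Num.sqrt (fnorm2 V^T) <= K%:R * 2.
  apply: sqrt_fnorm2_le => // j; rewrite colE; apply: le_trans (VtN _) _.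
  by rewrite enorm_delta mulr1; clear -e11; lra.
set P := M ^+ q in main *.
have P0 : 0 <= P by rewrite exprn_ge0.
pose u := value (fmulmx F V^T x).
pose w := value (mkcol (fun i => let* d := evalf (L 0 i) in fmul F d (u i 0))).
have -> : value (apply_fun F evalf V L) = value (fmulmx F V w).
  rewrite /w /u; have -> : x = value (mkcol (fun i : 'I_K => ret (i == 0%N :> nat)%:R)) => //.
  by apply/matrixP => i j; rewrite ord1 !mxE xE.
have uerr : enorm (u - V^T *m x) <= 2 * kg.
  apply: le_trans (fmulmx_err req1 e0 _ _ eg1 gle1) _.
  by rewrite x1 mulr1 /kg; have := ler_wpM2l g0 VtF; clear; lra.
have un : enorm u <= 2.
  apply: le_trans (le_enorm_diff _ (V^T *m x)) _; have := VtN x; rewrite x1 mulr1.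
  by move: uerr; move: (enorm _) (enorm _) => a b; clear -kg1 e11; lra.
have Lq i : `|L 0 i ^+ q| <= P.
  rewrite normrX lerXn2r ?nnegrE//.
  have := DM (delta_mx i 0); rewrite enorm_delta mulr1; apply: le_trans.
  apply: le_trans (coord_le _ i).
  by rewrite /D mul_diag_mx !mxE !eqxx mulr1.
have werr : enorm (w - iter q (mulmx D) u) <= 3 * e * P * enorm u.
  apply: enorm_pointwise => [|i]; first by rewrite !mulr_ge0.
  have [[d1 d1e E1] _] := hf (L 0 i).
  have [d2 d2e E2] := @fl_opP _ F e req1 Mul (value (evalf (L 0 i))) (u i 0) ltac:(by []).
  have -> : (w - iter q (mulmx D) u) i 0
     = fl_op F Mul (value (evalf (L 0 i))) (u i 0) - L 0 i ^+ q * u i 0.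
    by rewrite -iter_diag [LHS]mxE; congr (_ + _); rewrite [LHS]mxE.
  rewrite E2 /= E1.
  have -> : (1 + d2) * ((1 + d1) * L 0 i ^+ q * u i 0) - L 0 i ^+ q * u i 0
    = (d1 + d2 + d1 * d2) * L 0 i ^+ q * u i 0 by ring.
  rewrite 2!normrM ler_wpM2r// ler_pM//.
  have : `|d1 + d2 + d1 * d2| <= e + e + e * e.
    by rewrite (le_trans (ler_normD _ _))// lerD// ?(le_trans (ler_normD _ _)) ?lerD// normrM ler_pM.
  by clear -eg6 gle1 e0; nra.
have itD y : enorm (iter q (mulmx D) y) <= P * enorm y by apply: iter_mulmx_le.
have iterB y z : iter q (mulmx D) y - iter q (mulmx D) z = iter q (mulmx D) (y - z).
  by elim: q {q0 hf main Lq werr itD P P0} => // i IH; rewrite !iterS -mulmxBr IH.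
have w2 : enorm (w - iter q (mulmx D) (V^T *m x)) <= 3 * kg * P.
  have -> : w - iter q (mulmx D) (V^T *m x) = (w - iter q (mulmx D) u)
     + iter q (mulmx D) (u - V^T *m x) by rewrite -iterB addrA subrK.
  apply: le_trans (enormD _ _) _.
  have h1 := itD (u - V^T *m x).
  have h2 : P * enorm (u - V^T *m x) <= P * (2 * kg) by rewrite ler_wpM2l.
  have h3 : 3 * e * P * enorm u <= 3 * e * P * 2 by rewrite ler_wpM2l// !mulr_ge0.
  have h4 : 6 * e * P <= kg * P by rewrite ler_wpM2r// (le_trans eg6).
  move: h1 h2 h3 h4 werr; move: (enorm (iter q (mulmx D) (u - V^T *m x))).
  move: (enorm (w - iter q (mulmx D) u)) (enorm u) (enorm (u - V^T *m x)).
  by move=> a b c d; clear; lra.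
have wn : enorm w <= 2 * P.
  apply: le_trans (le_enorm_diff _ (iter q (mulmx D) (V^T *m x))) _.
  have h1 := itD (V^T *m x).
  have h2 : P * enorm (V^T *m x) <= P * ((1 + eps1) * 1) 
    by rewrite ler_wpM2l//; have := VtN x; rewrite x1.
  have h3 : kg * P <= 1 / 10 * P by rewrite ler_wpM2r.
  have h4 : eps1 * P <= 1 / 10 * P by rewrite ler_wpM2r.
  move: h1 h2 h3 h4 w2; move: (enorm (w - iter q (mulmx D) (V^T *m x))).
  move: (enorm (iter q (mulmx D) (V^T *m x))) (enorm (V^T *m x)).
  by move=> a b c; clear -P0; lra.
have oerr : enorm (value (fmulmx F V w) - V *m w) <= 4 * kg * P.
  apply: le_trans (fmulmx_err req1 e0 _ _ eg1 gle1) _.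
  have h : Num.sqrt (fnorm2 V) * enorm w <= K%:R * 2 * (2 * P).
    by rewrite ler_pM ?sqrtr_ge0 ?enorm_ge0.
  by have := ler_wpM2l g0 h; rewrite /kg; clear; lra.
have -> : value (fmulmx F V w) - iter q (mulmx T) x =
  (value (fmulmx F V w) - V *m w) + V *m (w - iter q (mulmx D) (V^T *m x))
  + (V *m iter q (mulmx D) (V^T *m x) - iter q (mulmx T) x).
  by rewrite mulmxBr !addrA !subrK.
apply: le_trans (enormD _ _) _; rewrite mulrDl addrC lerD//.
apply: le_trans (enormD _ _) _.
have h1 := VN (w - iter q (mulmx D) (V^T *m x)).
have h2 : (1 + eps1) * enorm (w - iter q (mulmx D) (V^T *m x)) <= 2 * (3 * kg * P).
  by rewrite ler_pM ?enorm_ge0//; clear -e10 e11; lra.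
have kP : 0 <= kg * P by rewrite mulr_ge0.
move: oerr h1 h2; move: (enorm (value (fmulmx F V w) - V *m w)).
move: (enorm (V *m (w - iter q (mulmx D) (V^T *m x)))).
move: (enorm (w - iter q (mulmx D) (V^T *m x))) => a b c.
by clear -kP; lra.
Qed.

End Eigendecomposition.

(** * Error of a complete Lanczos run *)

Section Run.
Context {R : realType}.

Lemma iter_mulmxZ n (A : 'M[R]_n) c q (x : 'cV[R]_n) :
  iter q (mulmx (c *: A)) x = c ^+ q *: iter q (mulmx A) x.
Proof.
elim: q => [|q IH]; first by rewrite scale1r.
by rewrite !iterS IH -scalemxAl -scalemxAr scalerA exprS.
Qed.

Lemma start_vector_err n (F : fpu R) (e g : R) (z : 'cV[R]_n) :
  requirement1 e F -> 0 <= e -> 2 * n.+3%:R * e <= g -> 1000 * g <= 1 -> z != 0 ->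
  let q1 := value (fscale F z (value (fnorm F z))) in
  [/\ `|dot q1 q1 - 1| <= 10 * g, enorm q1 <= 1 + 4 * g &
      enorm (q1 - (enorm z)^-1 *: z) <= 4 * g].
Proof.
move=> req1 e0 eg g1 z0 q1.
have eg' : e <= g.
  by apply: le_trans eg; rewrite ler_peMl// -natrM ler1n.
have g0 : 0 <= g by apply: le_trans eg'.
have nz : 0 < enorm z by rewrite enorm_gt0.
have g12 : g <= 1 / 2 by clear -g1; lra.
have := fnorm_err req1 e0 z eg g12; set b := value (fnorm F z) in q1 *.
rewrite ler_distl => /andP[bl bu]; clearbody b.
have b0 : 0 < b by apply: lt_le_trans bl; clear -nz g12 g0; nra.
have := fscale_err req1 e0 z (lt0r_neq0 b0); rewrite -/q1 (gtr0_norm b0).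
set r := b^-1 * enorm z => E.
have rb : r * b = enorm z by rewrite /r mulrAC mulVf ?mul1r// gt_eqF.
have r0 : 0 < r by rewrite mulr_gt0// invr_gt0.
have ru : r <= 1 + 2 * g.
  rewrite -(ler_pM2r b0) rb; move: (enorm z) bl nz => x bl x0.
  have h1 : 0 <= (1 + 2 * g) * (b - (x - g * x)) by rewrite mulr_ge0 ?subr_ge0 ?addr_ge0 ?mulr_ge0.
  have h2 : 0 <= x * (g * (1 - 2 * g)) by rewrite !mulr_ge0 ?(ltW x0)//; clear -g1 g0; lra.
  by move: h1 h2; clear; lra.
have rl : 1 - g <= r.
  rewrite -(ler_pM2r b0) rb; move: (enorm z) bu nz => x bu x0.
  have h1 : 0 <= (1 - g) * (x + g * x - b) by rewrite mulr_ge0 ?subr_ge0//; clear -g1 g0; lra.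
  have h2 : 0 <= x * (g * g) by rewrite !mulr_ge0 ?(ltW x0).
  by move: h1 h2; clear; lra.
have rE : enorm (b^-1 *: z) = r by rewrite enormZ gtr0_norm ?invr_gt0.
have E' : enorm (q1 - b^-1 *: z) <= g * (1 + 2 * g).
  apply: le_trans E _; apply: le_trans (_ : _ <= g * r) _; first by rewrite ler_wpM2r// ltW.
  by rewrite ler_wpM2l.
have qu : enorm q1 <= 1 + 4 * g.
  apply: le_trans (le_enorm_diff _ (b^-1 *: z)) _; rewrite rE.
  by move: E'; move: (enorm _) => a; clear -ru g1 g0; nra.
have ql : 1 - 3 * g <= enorm q1.
  have := le_enorm_diff (b^-1 *: z) q1; rewrite rE -(enormN (_ - _)) opprB.
  by move: E'; move: (enorm _) (enorm _) => a c; clear -rl g1 g0; nra.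
split=> //.
  rewrite -enorm_sqr; move: qu ql; move: (enorm q1) => x; clear -g0 g1 => qu ql.
  rewrite ler_norml; apply/andP; split; nra.
have -> : q1 - (enorm z)^-1 *: z = (q1 - b^-1 *: z) + (b^-1 - (enorm z)^-1) *: z.
  by rewrite scalerBl addrA subrK.
apply: le_trans (enormD _ _) _; rewrite enormZ -[X in _ * X](gtr0_norm nz) -normrM.
rewrite mulrBl -/r mulVf ?gt_eqF//.
have : `|r - 1| <= 2 * g.
  by rewrite ler_norml; apply/andP; split; clear -rl ru g0; lra.
by move: E'; move: (enorm _) `|_| => a c; clear -g0 g1; nra.
Qed.

Lemma jacmx_tridiag K (al be : nat -> R) : sym_tridiag (jacmx K al be).
Proof.
split; first exact: jacmx_sym.
move=> i j ij; rewrite mxE -val_eqE /=.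
by do 3 (case: eqP => [e'|_]; first by exfalso; lia).
Qed.

(** The comparison is with the exact power of the computed start vector q1, not of z/|z|. The error
    in q1 is then never multiplied by A^q; it only perturbs the overlap with the top singular
    vector. *)
Lemma lanczos_run_err n (A : 'M[R]_n) (F : fpu R) (e g lam h w eps1 c_ge C_ge C_f : R)
    (mulA : 'cV[R]_n -> computation 'cV[R]_n) (solver : eigensolver R)
    (evalf : R -> computation R) (z : 'cV[R]_n) (k q : nat) :
  requirement1 e F -> 0 <= e -> 2 * (n + k).+3%:R * e <= g -> 0 < lam ->
  1000 * (g * (1 + 7 * k%:R)) <= 1 ->
  60 * (g * (1 + 7 * k%:R)) <= 1 ->
  A^T = A -> (forall x, enorm (A *m x) <= lam * enorm x) ->
  (forall x, enorm (value (mulA x) - A *m x) <= g * lam * enorm x) ->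
  eval_spec e C_f (fun x => x ^+ q) evalf ->
  eigensolver_spec e c_ge C_ge solver ->
  0 < c_ge -> c_ge * k%:R ^+ 3 * ln k%:R * e <= eps1 -> 0 < eps1 -> eps1 <= 1 / 10 ->
  (0 < q)%N -> (0 < k)%N -> z != 0 ->
  0 < h -> 0 <= w -> k%:R * (h + w) <= 1 ->
  k%:R * (60 * (g * (1 + 7 * k%:R)) * (4 * k%:R + 2 * (1 + 7 * k%:R) + 5))
    * (1 + (1 + 7 * k%:R) ^+ 2 / h ^+ 2) <= w ->
  3 * q%:R * eps1 + 30 * (k%:R * g) <= 1 ->
  exists q1, [/\ `|dot q1 q1 - 1| <= 10 * g,
    enorm (q1 - (enorm z)^-1 *: z) <= 4 * g &
    enorm (value (lanczos F mulA solver eps1 evalf k z) - iter q (mulmx A) q1) <=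
    lam ^+ q * ((1 + 10 * eps1) * (1 + k%:R * (h + w))) ^+ q *
    (4 * k%:R * (\sum_(j < q.+1 | (k <= j)%N) chebc q j)
     + 120 * k%:R ^+ 3 * (g * (1 + 7 * k%:R)) + 6 * k%:R * q%:R * eps1
     + 64 * k%:R ^+ 2 * g)].
Proof.
move=> req1 e0 eg lam0 gbm gbm' Asym Ale mulA_err hf hs c_ge0 hge e10 e11 q0 k0 z0 h0 w0 hw1 hw hsm.
set bm := 1 + 7 * k%:R in gbm gbm' hw *.
have bm1 : 1 <= bm by rewrite /bm lerDl mulr_ge0.
have eg3 : 2 * n.+3%:R * e <= g.
  by apply: le_trans eg; rewrite ler_wpM2r// ler_pM2l// ler_nat !ltnS leq_addr.
have g0 : 0 <= g by apply: le_trans eg; rewrite !mulr_ge0.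
have g1 : 1000 * g <= 1.
  have : g * 1 <= g * bm by rewrite ler_wpM2l.
  by clear -gbm; lra.
set q1 := value (fscale F z (value (fnorm F z))).
have [q1n q1n1 q1z] := start_vector_err req1 e0 eg3 g1 z0.
exists q1; split=> //.
have [|||||||sl hd rec] := @lanczos_loop_recurrence R n A F e g lam bm mulA k 0 q1 0 1
  req1 e0 eg3 lam0 gbm bm1 Ale mulA_err.
- exact: lexx.
- exact: lexx.
- exact: q1n.
- exact: q1n1.
- by rewrite enorm0 addr_ge0// mulr_ge0.
- by rewrite normr0 mulr_ge0// ltW.
- by rewrite mul0r normr0 !mulr_ge0 ?(ltW lam0)// (le_trans _ bm1).
set l := value (lanczos_loop _ _ _ _ _ _) in sl hd rec.
have [K0 v0 be00] := hd k0.
set K := size l in sl K0.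
pose x0 : 'cV[R]_K := \col_i (i == 0%N :> nat)%:R.
have x0E i : x0 i 0 = (i == 0%N :> nat)%:R by rewrite mxE.
have Kk : K%:R <= k%:R :> R by rewrite ler_nat.
have Q0 : Qmx l *m x0 = q1.
  rewrite -[Qmx l]/(colmx K (vec_at l)) colmxE (bigD1 (Ordinal K0))//= big1 ?addr0.
    by rewrite x0E /= scale1r v0.
  by move=> i i0; rewrite x0E (_ : (i == 0%N :> nat) = false) ?scale0r//; apply: negbTE.
have x01 : enorm x0 = 1.
  rewrite enormE /dot (bigD1 (Ordinal K0))//= big1 ?addr0 => [|i i0].
    by rewrite x0E /= mulr1 sqrtr1.
  by rewrite !x0E (_ : (i == 0%N :> nat) = false) ?mulr0//; apply: negbTE.
have before i : beta_at l i *: vec_before 0 l i = beta_at l i *: vec_at l i.-1.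
  by case: i => [|i] //; rewrite be00 !scale0r.
have before_dot i : beta_at l i * dot (vec_at l i) (vec_before 0 l i)
    = beta_at l i * dot (vec_at l i) (vec_at l i.-1).
  by case: i => [|i] //; rewrite be00 !mul0r.
(* Past the end of the list the stored vector is 0, so the loop's residual has the truncated form
   required of the last column. *)
have after i : beta_at l i.+1 *: vec_at l i.+1 =
    if (i.+1 < K)%N then beta_at l i.+1 *: vec_at l i.+1 else 0.
  by case: ltnP => // iK; rewrite /vec_at nth_default//= scaler0.
set U := 60 * (g * bm) in gbm' hw.
have gbm0 : 0 <= g * bm by rewrite mulr_ge0// (le_trans _ bm1).
have U0 : 0 <= U by rewrite mulr_ge0.
have scale_le x : `|x| <= U * lam -> `|lam^-1 * x| <= U.
  by move=> xU; rewrite normrM gtr0_norm ?invr_gt0// ler_pdivrMl// mulrC.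
(* The run is rescaled by 1/lam to a contraction; the errors, bounded by multiples of g bm lam,
   become at most U. *)
pose al' i := lam^-1 * alpha_at l i; pose be' i := lam^-1 * beta_at l i.
have jacE : jacmx K al' be' = lam^-1 *: Tmx l.
  apply/matrixP => i j; rewrite !mxE /al' /be'.
  by case: ifP => // _; case: ifP => // _; case: ifP => // _; rewrite mulr0.
have Kw : K%:R * (h + w) <= k%:R * (h + w) by rewrite ler_wpM2r// addr_ge0// ltW.
have [|||i iK||||i iK|i iK|i iK|i iK ik||||||TN main] := @lanczos_power R n (lam^-1 *: A)
  (vec_at l) al' be' K k q bm U h w x0.
- by rewrite linearZ /= Asym.
- move=> x; rewrite -scalemxAl enormZ gtr0_norm ?invr_gt0// ler_pdivrMl//; exact: Ale.
- by rewrite /be' be00 mulr0.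
- by rewrite /be' normrM gtr0_norm ?invr_gt0// ler_pdivrMl// mulrC; case: (rec i iK).
- exact: U0.
- exact: gbm'.
- exact: sl.
- case: (rec i iK) => + _ _ _ _; move/le_trans; apply.
  by rewrite /U; have : g * 1 <= g * bm by [rewrite ler_wpM2l]; clear -g0; lra.
- case: (rec i iK) => _ _ + _ _; rewrite before_dot => X; rewrite /be' -mulrA; apply: scale_le.
  apply: le_trans X _; rewrite /U -[60 * _ * _]mulrA ler_wpM2r ?(mulr_ge0 gbm0 (ltW lam0))//.
  by clear; lra.
- case: (rec i iK) => _ _ _ + _ => X; rewrite -scalemxAl dotZr /al' -mulrBr.
  by apply: scale_le; rewrite /U -mulrA.
- case: (rec i iK) => _ _ _ _ /(_ ik); rewrite before after => X.
  rewrite /be' /al' -scalemxAl -!scalerA.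
  have -> : (if (i.+1 < K)%N then lam^-1 *: (beta_at l i.+1 *: vec_at l i.+1) else 0)
     = lam^-1 *: (if (i.+1 < K)%N then beta_at l i.+1 *: vec_at l i.+1 else 0).
    by case: ifP; rewrite ?scaler0.
  rewrite -!scalerDr -scalerBr enormZ gtr0_norm ?invr_gt0// ler_pdivrMl// mulrC.
  by rewrite /U -mulrA.
- exact: h0.
- exact: w0.
- exact: le_trans hw1.
- apply: le_trans hw; have bmh : 0 <= 1 + bm ^+ 2 / h ^+ 2.
    by rewrite addr_ge0// divr_ge0 ?sqr_ge0.
  rewrite ler_wpM2r//.
  have F0 : 0 <= 4 * K%:R + 2 * bm + 5.
    by have : 0 <= K%:R :> R by []; clear -bm1; lra.
  apply: ler_pM => //; first exact: mulr_ge0.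
  by rewrite ler_wpM2l//; move: Kk; clear; lra.
- exact: x0E.
set N := 1 + k%:R * (h + w).
have N1 : 1 <= N by rewrite lerDl mulr_ge0// addr_ge0// ltW.
have NK1 : 1 <= 1 + K%:R * (h + w) by rewrite lerDl mulr_ge0// addr_ge0// ltW.
have NK : 1 + K%:R * (h + w) <= N by rewrite lerD2l.
set T := Tmx l in jacE *.
have TNl y : enorm (T *m y) <= lam * N * enorm y.
  have := TN y; rewrite jacE -scalemxAl enormZ gtr0_norm ?invr_gt0// ler_pdivrMl//.
  move=> X; apply: le_trans X _; rewrite -mulrA ler_wpM2l ?(ltW lam0)//.
  by rewrite ler_wpM2r ?enorm_ge0.
have lamN : 0 < lam * N by rewrite mulr_gt0// (lt_le_trans _ N1).
have Tspec : specnorm T <= lam * N by apply: specnorm_le => //; exact: ltW.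
have Tsym : sym_tridiag T.
  exact: (jacmx_tridiag K (alpha_at l) (beta_at l)).
have hge' : c_ge * K%:R ^+ 3 * ln K%:R * e <= eps1.
  apply: le_trans hge; rewrite ler_wpM2r// ler_pM//.
  - by rewrite mulr_ge0 ?exprn_ge0// ltW.
  - by apply: ln_ge0; rewrite ler1n.
  - by rewrite ler_pM2l// lerXn2r ?nnegrE.
  - by rewrite ler_ln ?posrE ?ltr0n.
have [|hS hG _] := hs K T eps1 K0 Tsym e10 hge'; first by clear -e11; lra.
set V := (value (solver K T eps1)).1 in hS hG *.
set L := (value (solver K T eps1)).2 in hS hG *.
have Kg : 2 * K.+3%:R * e <= g.
  by apply: le_trans eg; rewrite ler_wpM2r// ler_pM2l// ler_nat !ltnS (leq_trans sl)// leq_addl.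
have kg0 : 0 <= k%:R * g by rewrite mulr_ge0.
have Kkg : K%:R * g <= k%:R * g by rewrite ler_wpM2r.
have gK : g * K%:R <= 1 / 10.
  have : 60 * (g * (7 * k%:R)) <= 60 * (g * bm).
    by rewrite ler_pM2l// ler_wpM2l// /bm lerDr.
  by move: Kkg gbm'; rewrite /U; clear -kg0; lra.
have SN y : enorm ((V *m diag_mx L *m V^T - T) *m y) <= eps1 * (lam * N) * enorm y.
  apply: le_trans (enorm_mulmx _ _) _; rewrite ler_wpM2r ?enorm_ge0//.
  by apply: le_trans hS _; rewrite ler_wpM2l// ltW.
have GN y : enorm ((V^T *m V - 1%:M) *m y) <= eps1 * enorm y.
  by apply: le_trans (enorm_mulmx _ _) _; rewrite ler_wpM2r ?enorm_ge0.
have := apply_fun_err req1 e0 Kg gK hf lamN (ltW e10) e11 q0 K0 TNl SN GN x0E.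
set o := value (apply_fun F evalf V L) => oerr.
set M := (1 + 10 * eps1) * (lam * N) in oerr.
have lamNM : lam * N <= M.
  by rewrite /M ler_peMl ?(ltW lamN)//; clear -e10; lra.
have M0 : 0 <= M by rewrite (le_trans (ltW lamN)).
have -> : value (lanczos F mulA solver eps1 evalf k z) = value (fmulmx F (Qmx l) o) by [].
set sg := 3 * q%:R * eps1 + 30 * (k%:R * g) in hsm.
have sg0 : 0 <= sg by rewrite addr_ge0 ?mulr_ge0 ?(ltW e10).
have oerr' : enorm (o - iter q (mulmx T) x0) <= sg * M ^+ q.
  apply: le_trans oerr _; rewrite ler_wpM2r ?exprn_ge0// lerD2l; move: Kkg; clear; lra.
have on : enorm o <= 2 * M ^+ q.
  apply: le_trans (le_enorm_diff _ (iter q (mulmx T) x0)) _.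
  have h1 : enorm (iter q (mulmx T) x0) <= M ^+ q * 1.
    rewrite -x01; apply: iter_mulmx_le => // y; apply: le_trans (TNl y) _.
    by rewrite ler_wpM2r ?enorm_ge0.
  have h2 : sg * M ^+ q <= 1 * M ^+ q by rewrite ler_wpM2r ?exprn_ge0.
  move: h1 h2 oerr'; move: (M ^+ q) (enorm (o - _)) (enorm (iter _ _ _)) => a b c.
  by clear; lra.
have v2 i : (i < K)%N -> enorm (vec_at l i) <= 2.
  move=> /rec [+ _ _ _ _]; move/(le_trans (ler_norm _)) => X.
  by rewrite enorm_le// expr2; move: X; clear -g1; lra.
have QF x : enorm (Qmx l *m x) <= K%:R * 2 * enorm x by apply: enorm_colmx.
have QF2 : Num.sqrt (fnorm2 (Qmx l)) <= K%:R * 2.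
  apply: sqrt_fnorm2_le => // j.
  rewrite (_ : col j (Qmx l) = vec_at l j) ?v2//.
  by apply/matrixP => a c; rewrite !mxE ord1.
have eg1 : 2 * K.+1%:R * e <= g.
  by apply: le_trans Kg; rewrite ler_wpM2r// ler_pM2l// ler_nat leqW.
have gle1 : g <= 1 by clear -g1 g0; lra.
have yerr : enorm (value (fmulmx F (Qmx l) o) - Qmx l *m o) <= 4 * (k%:R * g) * M ^+ q.
  apply: le_trans (fmulmx_err req1 e0 _ _ eg1 gle1) _.
  have h1 : Num.sqrt (fnorm2 (Qmx l)) * enorm o <= K%:R * 2 * (2 * M ^+ q).
    by rewrite ler_pM ?sqrtr_ge0 ?enorm_ge0.
  have := ler_wpM2l g0 h1; have : K%:R * g * M ^+ q <= k%:R * g * M ^+ q.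
    by rewrite ler_wpM2r ?exprn_ge0.
  by move: (M ^+ q) (Num.sqrt _ * _) => a b; clear; lra.
have Qerr : enorm (Qmx l *m (o - iter q (mulmx T) x0)) <= 2 * k%:R * sg * M ^+ q.
  apply: le_trans (QF _) _; rewrite -[X in _ <= X]mulrA ler_pM ?enorm_ge0 ?mulr_ge0//.
  by rewrite mulrC ler_pM2l.
set tl := \sum_(j < q.+1 | _) _ in main *.
have tl0 : 0 <= tl by apply: sumr_ge0 => j _; exact: chebc_ge0.
have core : enorm (iter q (mulmx A) q1 - Qmx l *m iter q (mulmx T) x0)
   <= lam ^+ q * N ^+ q * (4 * k%:R * tl + 2 * k%:R ^+ 2 * (k%:R * U)).
  have lq : 0 < lam ^+ q by rewrite exprn_gt0.
  move: main; rewrite jacE !iter_mulmxZ -[colmx K _]/(Qmx l) Q0 -scalemxAr -scalerBr enormZ.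
  rewrite exprVn gtr0_norm ?invr_gt0// ler_pdivrMl// => X; apply: le_trans X _.
  rewrite -[leRHS]mulrA ler_wpM2l ?(ltW lq)// ler_pM//.
  - by rewrite exprn_ge0// (le_trans _ NK1).
  - by apply: addr_ge0; apply: mulr_ge0 => //; apply: mulr_ge0 => //; apply: exprn_ge0.
  - by apply: lerXn2r => //; rewrite nnegrE; [exact: le_trans NK1|exact: le_trans N1].
  - apply: lerD; first by rewrite ler_wpM2r// ler_wpM2l.
    apply: ler_wpM2l; first by rewrite mulr_ge0// exprn_ge0.
    exact: ler_wpM2r.
have NM : lam ^+ q * N ^+ q <= M ^+ q.
  by rewrite -exprMn lerXn2r ?nnegrE// ltW.
have ME : M ^+ q = lam ^+ q * ((1 + 10 * eps1) * N) ^+ q.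
  by rewrite -exprMn /M; congr (_ ^+ _); ring.
rewrite -ME.
have -> : value (fmulmx F (Qmx l) o) - iter q (mulmx A) q1 =
  (value (fmulmx F (Qmx l) o) - Qmx l *m o) + Qmx l *m (o - iter q (mulmx T) x0)
  - (iter q (mulmx A) q1 - Qmx l *m iter q (mulmx T) x0).
  by rewrite mulmxBr opprB !addrA !subrK.
apply: le_trans (enormB _ _) _.
apply: le_trans (lerD (enormD _ _) (lexx _)) _.
apply: le_trans (lerD (lerD yerr Qerr) core) _.
set C := 4 * k%:R * tl + _.
have C0 : 0 <= C.
  by apply: addr_ge0; apply: mulr_ge0 => //; apply: mulr_ge0 => //; apply: exprn_ge0.
have : lam ^+ q * N ^+ q * C <= M ^+ q * C by rewrite ler_wpM2r.
have kkg : k%:R * g * M ^+ q <= k%:R ^+ 2 * g * M ^+ q.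
  by rewrite ler_wpM2r ?exprn_ge0// ler_wpM2r// expr2 ler_peMl ?ler1n.
(* The constants: 120 k^3 g bm = 2k^2 (k U), and 2k (3q eps1 + 30 k g) plus the 4 k g of the final
   product gives 6 k q eps1 and 64 k^2 g. *)
move: kkg; rewrite /C /sg /U; move: (M ^+ q) (lam ^+ q * N ^+ q) (g * bm) => a b c.
by clear; lra.
Qed.

End Run.

(** * Random signs *)

Section Coins.
Context {R : realType}.

Lemma coin_prT (I : finType) : coin_pr (fun _ : {ffun I -> bool} => true) = 1 :> R.
Proof.
rewrite /coin_pr sumr_const prodr_const card_ffun card_bool -[_ *+ _]mulr_natl.
by rewrite natrX -exprMn mulrCA mulfV ?mulr1 ?expr1n// pnatr_eq0.
Qed.

Lemma coin_pr_ge0 (I : finType) (E : pred {ffun I -> bool}) : 0 <= coin_pr E :> R.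
Proof. by apply: sumr_ge0 => s _; apply: prodr_ge0 => i _; rewrite divr_ge0. Qed.

Lemma coin_prC (I : finType) (E : pred {ffun I -> bool}) :
  coin_pr E = 1 - coin_pr (fun s => ~~ E s) :> R.
Proof.
apply/eqP; rewrite eq_sym subr_eq; apply/eqP.
by rewrite -(coin_prT I) /coin_pr [LHS](bigID E).
Qed.

Lemma le_coin_pr (I : finType) (E E' : pred {ffun I -> bool}) :
  (forall s, E s -> E' s) -> coin_pr E <= coin_pr E' :> R.
Proof.
move=> EE'; rewrite /coin_pr [leRHS](bigID E) /=.
have -> : \sum_(s | E' s && E s) \prod_(i : I) (1 / 2 : R)
    = \sum_(s | E s) \prod_(i : I) (1 / 2 : R).
  by apply: eq_bigl => s; case Es: (E s); rewrite ?andbF// EE'.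
by rewrite lerDl; apply: sumr_ge0 => s _; apply: prodr_ge0 => i _; rewrite divr_ge0.
Qed.

(** The involution preserves the uniform measure and maps the complement of E into E, so the
    complement is no more likely than E. *)
Lemma coin_pr_involution (I : finType) (E : pred {ffun I -> bool}) f :
  involutive f -> (forall s, E s || E (f s)) -> 1 / 2 <= coin_pr E :> R.
Proof.
move=> fK Ef; have : coin_pr (fun s => ~~ E s) <= coin_pr E :> R; last first.
  by rewrite [coin_pr E]coin_prC; lra.
rewrite [leRHS]/coin_pr (reindex_inj (inv_inj fK)); apply: le_coin_pr => s.
by have := Ef s; case: (E s).
Qed.

(** Independence of the trials: the power of a sum is expanded by distributivity, and a family of r
    sign patterns is curried into one pattern on pairs. *)
Lemma coin_pr_blocks (r n : nat) (E : pred {ffun 'I_n -> bool}) :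
  coin_pr (fun s : {ffun 'I_r * 'I_n -> bool} =>
     [forall i, E [ffun j => s (i, j)]]) = coin_pr E ^+ r :> R.
Proof.
have -> : coin_pr E ^+ r = \prod_(i < r) coin_pr E :> R by rewrite prodr_const card_ord.
rewrite [in RHS]/coin_pr; under [RHS]eq_bigr do rewrite big_mkcond.
rewrite bigA_distr_bigA /=.
pose join (f : {ffun 'I_r -> {ffun 'I_n -> bool}}) : {ffun 'I_r * 'I_n -> bool} :=
  [ffun ij => f ij.1 ij.2].
have joinE f i : [ffun j => join f (i, j)] = f i by apply/ffunP => j; rewrite !ffunE.
rewrite /coin_pr (reindex join) /=; last first.
  exists (fun s => [ffun i => [ffun j => s (i, j)]]) => [f|s] _.
    by apply/ffunP => i; rewrite ffunE joinE.
  by apply/ffunP => -[i j]; rewrite !ffunE.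
rewrite [LHS]big_mkcond; apply: eq_bigr => f _.
case: ifPn => [/forallP fE|].
  under [RHS]eq_bigr => i _ do rewrite -(joinE f i) fE.
  by rewrite !prodr_const card_prod !card_ord mulnC exprM.
rewrite negb_forall => /existsP[i fi].
by rewrite (bigD1 i)//= -{1}(joinE f i) (negbTE fi) mul0r.
Qed.

(** E fails only if all r trials fail, which by independence has probability at most 2^-r. *)
Lemma coin_pr_repeat (r n : nat) (good : pred {ffun 'I_n -> bool})
    (E : pred {ffun 'I_r * 'I_n -> bool}) (delta : R) :
  1 / 2 <= coin_pr good :> R -> (1 / 2) ^+ r <= delta ->
  (forall (s : {ffun 'I_r * 'I_n -> bool}) i, good [ffun j => s (i, j)] -> E s) ->
  1 - delta <= coin_pr E.
Proof.
move=> hg hr hE; rewrite coin_prC lerD2l lerN2; apply: le_trans hr.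
apply: (@le_trans _ _ (coin_pr (fun s => ~~ good s) ^+ r)).
  rewrite -coin_pr_blocks; apply: le_coin_pr => s Es; apply/forallP => i.
  by apply: contra Es; apply: hE.
rewrite lerXn2r ?nnegrE ?coin_pr_ge0 ?divr_ge0//.
by move: hg; rewrite coin_prC; lra.
Qed.

Definition flip n (i : 'I_n) (s : {ffun 'I_n -> bool}) : {ffun 'I_n -> bool} :=
  [ffun j => if j == i then ~~ s j else s j].

Lemma flipK n (i : 'I_n) : involutive (flip i).
Proof. by move=> s; apply/ffunP => j; rewrite !ffunE; case: eqP; rewrite ?negbK. Qed.

Definition signs n (s : {ffun 'I_n -> bool}) : 'cV[R]_n := \col_i (if s i then 1 else -1).

Lemma enorm_signs n s : enorm (signs (n := n) s) = Num.sqrt n%:R.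
Proof.
rewrite enormE /dot (eq_bigr (fun=> 1)) ?sumr_const ?card_ord// => i _.
by rewrite mxE; case: ifP; rewrite ?mulr1// mulrN1 opprK.
Qed.

Lemma dot_signs_flip n (v : 'cV[R]_n) (i : 'I_n) s :
  (`|v i 0| <= `|dot v (signs s)|) || (`|v i 0| <= `|dot v (signs (flip i s))|).
Proof.
have D t : dot v t = v i 0 * t i 0 + \sum_(j < n | j != i) v j 0 * t j 0.
  by rewrite /dot (bigD1 i).
rewrite !D.
have -> : \sum_(j < n | j != i) v j 0 * signs (flip i s) j 0
    = \sum_(j < n | j != i) v j 0 * signs s j 0.
  by apply: eq_bigr => j ji; rewrite !mxE ffunE (negbTE ji).
rewrite !mxE ffunE eqxx; move: (\sum_(_ < n | _) _) (v i 0) => t x.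
apply/orP; case: (leP (`|x|) `|x + t|) => [h|h].
  case: (s i) => /=; [by left; rewrite mulr1|by right; rewrite mulr1].
have : `|x| <= `|- x + t|.
  have := ler_normB (x + t) (- x + t); rewrite (_ : x + t - (- x + t) = x + x); last by ring.
  by rewrite -mulr2n normrMn mulr2n; lra.
case: (s i) => /= h'; [by right; rewrite mulrN1|by left; rewrite mulrN1].
Qed.

Lemma exists_large_coord n (v : 'cV[R]_n) : v != 0 ->
  exists i, enorm v <= Num.sqrt n%:R * `|v i 0|.
Proof.
move=> v0; apply/existsP; rewrite -[X in is_true X]negbK negb_exists.
apply/negP => /forallP h.
have n0 : (0 < n)%N by case: n v v0 h => // v; rewrite flatmx0 eqxx.
have : enorm v ^+ 2 < enorm v ^+ 2; last by rewrite ltxx.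
rewrite {1}enorm_sqr /dot.
have nn0 : 0 < n%:R :> R by rewrite ltr0n.
apply: (@lt_le_trans _ _ (\sum_(i < n) enorm v ^+ 2 / n%:R)); last first.
  by rewrite sumr_const card_ord -[_ *+ n]mulr_natl mulrCA mulfV ?mulr1 ?gt_eqF.
apply: ltr_sum => [|i _]; first by apply/hasP; exists (Ordinal n0); rewrite // mem_index_enum.
have := h i; rewrite -ltNge => hi.
rewrite ltr_pdivlMr// -expr2 -[v i 0 ^+ 2]real_normK ?num_real//.
have -> : `|v i 0| ^+ 2 * n%:R = (Num.sqrt n%:R * `|v i 0|) ^+ 2.
  by rewrite exprMn sqr_sqrtr// mulrC.
by rewrite ltr_sqr// ?nnegrE ?mulr_ge0 ?sqrtr_ge0 ?enorm_ge0.
Qed.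

End Coins.

(** * Running time *)

Section RunningTime.
Context {R : realType}.
Implicit Types F : fpu R.

Lemma time_bind S T (c : computation S) (f : S -> computation T) :
  time (bind c f) = (time c + time (f (value c)))%N.
Proof. by []. Qed.

Lemma time_mkcol n (f : 'I_n -> computation R) c :
  (forall i, (time (f i) <= c)%N) -> (time (mkcol f) <= n * c.+1)%N.
Proof.
move=> fc; apply: (@leq_trans (\sum_(i < n) c.+1)%N); first by apply: leq_sum => i _; apply: fc.
by rewrite sum_nat_const card_ord.
Qed.

Lemma time_fdot F n (u v : 'cV[R]_n) : time (fdot F u v) = (2 * n).+1.
Proof.
rewrite /fdot -[X in (2 * X)%N](size_enum_ord n).
elim/last_ind: (enum 'I_n) => [|s i IH] //.
by rewrite foldl_rcons size_rcons time_bind IH time_bind addn1 mulnS !addSn addnC.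
Qed.

Lemma time_fnorm F n (v : 'cV[R]_n) : time (fnorm F v) = (2 * n).+2.
Proof. by rewrite /fnorm /= time_fdot addn1. Qed.

Lemma time_faxpy F n (w v : 'cV[R]_n) a : (time (faxpy F w a v) <= 3 * n)%N.
Proof. by rewrite mulnC; apply: time_mkcol. Qed.

Lemma time_fscale F n (v : 'cV[R]_n) b : (time (fscale F v b) <= 2 * n)%N.
Proof. by rewrite mulnC; apply: time_mkcol. Qed.

Lemma time_fmulmx F m n (M : 'M[R]_(m, n)) v :
  (time (fmulmx F M v) <= m * (2 * n).+2)%N.
Proof. by apply: time_mkcol => i; rewrite time_fdot. Qed.

Lemma time_lanczos_loopS F n (mulA : 'cV[R]_n -> computation 'cV[R]_n)
    fuel qp q be w1 al w2 b' :
  w1 = value (faxpy F (value (mulA q)) be qp) -> al = value (fdot F w1 q) ->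
  w2 = value (faxpy F w1 al q) -> b' = value (fnorm F w2) ->
  time (lanczos_loop F mulA fuel.+1 qp q be) =
  (time (mulA q) + (time (faxpy F (value (mulA q)) be qp) + (time (fdot F w1 q)
   + (time (faxpy F w1 al q) + (time (fnorm F w2) + (1 + (if (b' == 0)%R then 0
   else time (fscale F w2 b')
     + (time (lanczos_loop F mulA fuel q (value (fscale F w2 b')) b') + 1))))))))%N.
Proof. by move=> -> -> -> ->; rewrite /=; case: eqP. Qed.

(** Per iteration: 6n for the two vector updates, 4n for the inner product and the norm, 2n for the
    scaling, and a constant for the test and the bookkeeping. *)
Lemma time_lanczos_loop F n (mulA : 'cV[R]_n -> computation 'cV[R]_n) tA :
  (forall x, (time (mulA x) <= tA)%N) -> forall fuel qp q be,
  (time (lanczos_loop F mulA fuel qp q be) <= fuel * (tA + 12 * n + 6))%N.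
Proof.
move=> hA; elim=> [//|fuel IH] qp q be.
rewrite (time_lanczos_loopS fuel (erefl _) (erefl _) (erefl _) (erefl _)).
set w0 := mulA q; set w1 := faxpy F _ _ _; set w2 := faxpy F _ _ _.
set q' := fscale F _ _; set b := value (fnorm F _).
have h0 : (time w0 <= tA)%N by apply: hA.
have h1 : (time w1 <= 3 * n)%N by apply: time_faxpy.
have h3 : (time w2 <= 3 * n)%N by apply: time_faxpy.
have h5 : (time q' <= 2 * n)%N by apply: time_fscale.
have h6 := IH q (value q') b; rewrite time_fdot time_fnorm.
move: (time w0) (time w1) (time w2) (time q') (time (lanczos_loop _ _ _ _ _ _)) h0 h1 h3 h5 h6.
move: (_ == _) => st; clear => t0 t1 t2 t3 t4 e0 e1 e2 e3 e4.
by case: st; lia.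
Qed.

Lemma size_lanczos_loop F n (mulA : 'cV[R]_n -> computation 'cV[R]_n) fuel qp q be :
  (size (value (lanczos_loop F mulA fuel qp q be)) <= fuel)%N /\
  ((0 < fuel)%N -> (0 < size (value (lanczos_loop F mulA fuel qp q be)))%N).
Proof.
elim: fuel qp q be => [//|fuel IH] qp q be.
rewrite (lanczos_loopS fuel (erefl _) (erefl _) (erefl _) (erefl _)).
set q' := value (fscale F _ _); set b := value (fnorm F _).
by case: ifP => // _; split=> //; case: (IH q q' b).
Qed.

Lemma time_apply_fun F (evalf : R -> computation R) K (V : 'M[R]_K) (L : 'rV[R]_K) c :
  (forall x, (time (evalf x) <= c)%N) ->
  (time (apply_fun F evalf V L) <= K + 2 * (K * (2 * K).+2) + K * c.+2)%N.
Proof.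
move=> hc; rewrite /apply_fun !time_bind.
set e1 := mkcol _; set u := fmulmx F _ _; set w := mkcol _; set o := fmulmx F _ _.
have h1 : (time e1 <= K * 1)%N by apply: time_mkcol.
have h2 : (time u <= K * (2 * K).+2)%N by apply: time_fmulmx.
have h3 : (time w <= K * c.+2)%N.
  by apply: time_mkcol => i; rewrite time_bind /= addn1 ltnS.
have h4 : (time o <= K * (2 * K).+2)%N by apply: time_fmulmx.
lia.
Qed.

Lemma time_random_lanczos n F (mulA : 'cV[R]_n -> computation 'cV[R]_n) tA
    (solver : eigensolver R) (e c_ge C_ge C_f eps1 : R) f (evalf : R -> computation R) k s :
  (forall x, (time (mulA x) <= tA)%N) -> (0 < k)%N -> (0 < n)%N ->
  eval_spec e C_f f evalf -> eigensolver_spec e c_ge C_ge solver ->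
  0 <= e -> 0 <= c_ge -> 0 < C_ge -> 0 < eps1 -> eps1 <= 1 / 2 ->
  c_ge * k%:R ^+ 3 * ln k%:R * e <= eps1 ->
  (time (random_lanczos F mulA solver eps1 evalf k s))%:R <=
  k%:R * tA%:R + 30 * n%:R * k%:R + (12 + C_f) * k%:R ^+ 2
  + C_ge * at1 (k%:R ^+ 2 * ln (k%:R / eps1) + k%:R * ln (k%:R / eps1) ^+ 2) :> R.
Proof.
move=> hA k0 n0 hf hs e0 c_ge0 C_ge0 e10 e11 hge.
rewrite /random_lanczos /lanczos /lanczos_iterations !time_bind.
set z := sign_vector s; set nx := fnorm F _; set q1 := fscale F _ _.
set lp := lanczos_loop F _ _ _ _ _.
have -> : value (bind (fnorm F (value z)) (fun nx => bind (fscale F (value z) nx)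
    (fun q1 => lanczos_loop F mulA k 0 q1 0))) = value lp by [].
have [sl sl0] := size_lanczos_loop F mulA k 0 (value q1) 0.
have {}sl0 := sl0 k0; rewrite -/lp in sl sl0.
set K := size (value lp) in sl sl0 *.
set l := value lp in K sl sl0 *.
set sv := solver _ _ _; set af := apply_fun _ _ _ _; set fm := fmulmx F (Qmx _) _.
have hz : (time z <= n * 2)%N by apply: time_mkcol.
have hnx : time nx = (2 * n).+2 by apply: time_fnorm.
have hq1 : (time q1 <= 2 * n)%N by apply: time_fscale.
have hlp : (time lp <= k * (tA + 12 * n + 6))%N by apply: time_lanczos_loop.
have hfm : (time fm <= n * (2 * K).+2)%N by apply: time_fmulmx.
(* Times are natural numbers, so the real bound C_f can be truncated, and the step count is then
   done entirely in [nat]. *)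
have [c cf hc] : exists2 c : nat, c%:R <= C_f & forall x, (time (evalf x) <= c)%N.
  have C_f0 : 0 <= C_f by have [_ h] := hf 0; apply: le_trans h.
  exists (Num.truncn C_f) => [|x]; first by rewrite Num.Theory.truncn_le.
  by have [_ h] := hf x; rewrite Num.Theory.truncn_ge_nat.
have haf : (time af <= K + 2 * (K * (2 * K).+2) + K * c.+2)%N by apply: time_apply_fun.
have hsv : (time sv)%:R <= C_ge * at1 (k%:R ^+ 2 * ln (k%:R / eps1) + k%:R * ln (k%:R / eps1) ^+ 2).
  have kK : 1 <= K%:R :> R by rewrite ler1n.
  have Kk : K%:R <= k%:R :> R by rewrite ler_nat.
  have e11' : eps1 <= 1 by lra.
  have hge' : c_ge * K%:R ^+ 3 * ln K%:R * e <= eps1.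
    apply: le_trans hge; rewrite ler_wpM2r// ler_pM//.
    - by rewrite mulr_ge0 ?exprn_ge0.
    - exact: ln_ge0.
    - by rewrite ler_wpM2l// lerXn2r ?nnegrE.
    - by rewrite ler_ln ?posrE ?ltr0n.
  have [_ _ h] := hs K (Tmx l) eps1 sl0
    (jacmx_tridiag K (alpha_at l) (beta_at l)) e10 hge' e11.
  apply: le_trans h _; rewrite ler_pM2l// /at1 ge_max le_max lexx /= le_max; apply/orP; right.
  have ln0 : 0 <= ln (K%:R / eps1).
    by apply: ln_ge0; rewrite ler_pdivlMr// mul1r (le_trans e11').
  have lnk : ln (K%:R / eps1) <= ln (k%:R / eps1).
    rewrite ler_ln ?posrE ?divr_gt0// ?ltr0n// ler_pM2r ?invr_gt0//.
  by rewrite lerD// ler_pM ?exprn_ge0// lerXn2r ?nnegrE// (le_trans ln0).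
have nat_bound : (time z + (time nx + (time q1 + time lp) + (time sv + (time af + time fm)))
   <= k * tA + 30 * n * k + (12 + c) * (k * k) + time sv)%N.
  have e1 : (n <= n * k)%N by rewrite leq_pmulr.
  have e2 : (k <= n * k)%N by rewrite leq_pmull.
  have e3 : (K * K <= k * k)%N by rewrite leq_mul.
  have e4 : (K <= k * k)%N by rewrite (leq_trans sl)// leq_pmulr.
  have e5 : (K * c <= k * k * c)%N by rewrite leq_mul.
  have e6 : (n * K <= n * k)%N by rewrite leq_mul.
  have e7 : (1 <= n * k)%N by rewrite muln_gt0 n0.
  move: hz hnx hq1 hlp hfm haf; move: (time z) (time nx) (time q1) (time lp) (time fm) (time af).
  move: (time sv) => t1 t2 t3 t4 t5 t6 t7.
  move: e1 e2 e3 e4 e5 e6 e7; move: (K) => K'; clear.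
  nia.
apply: (@le_trans _ _ (k * tA + 30 * n * k + (12 + c) * (k * k) + time sv)%N%:R).
  by rewrite ler_nat; exact: nat_bound.
have -> : (k * tA + 30 * n * k + (12 + c) * (k * k) + time sv)%N%:R
   = k%:R * tA%:R + 30 * n%:R * k%:R + (12 + c%:R) * k%:R ^+ 2 + (time sv)%:R :> R.
  by move: (time sv); clear => t; ring.
by apply: lerD => //; rewrite lerD2l ler_wpM2r ?exprn_ge0// lerD2l.
Qed.

End RunningTime.

(** * Accuracy for the chosen parameters *)

Section Accuracy.
Context {R : realType}.

(** The accounting rule of this section: a factor of size N^p uses up p of the G available negative
    powers of N. *)
Lemma absorb_power (N x : R) (p G : nat) d : 0 < N -> x <= N ^+ p -> (p + d)%N = G ->
  x * N ^- G <= N ^- d.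
Proof.
move=> N0 xN <-; rewrite exprD invfM mulrA ler_piMl ?invr_ge0 ?exprn_ge0 ?(ltW N0)//.
by rewrite ler_pdivrMr ?exprn_gt0// mul1r.
Qed.

(** Origin of the exponents. With h = N^-(A+8), k(h + h) <= N^-7, and q <= N^5 leaves room for the
    q-th power to stay below 2. The Jacobi condition multiplies g by at most N^(20 + 5A + 2H) =
    N^(7A + 36) and must end below h, which G = 8A + 64 achieves with room to spare. The extra A + 3
    in the machine precision pays for the dimension factors. *)
Lemma parameter_bounds (N : R) (A k q n : nat) (e eps1 : R) :
  let G := (8 * A + 64)%N in let H := (A + 8)%N in
  let g := N ^- G in let h := N ^- H in let bm := 1 + 7 * k%:R in
  2 <= N -> (2 <= A)%N -> (0 < k)%N -> (0 < q)%N -> (0 < n)%N ->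
  k%:R <= N ^+ A -> q%:R <= N ^+ 5 -> n%:R <= N ->
  0 <= e -> e <= N ^- (G + A + 3) -> 0 < eps1 -> eps1 <= N ^- (A + 20) ->
  [/\ 2 * (n + k).+3%:R * e <= g, 2 * n%:R ^+ 2 * e <= g,
      1000 * (g * bm) <= 1 & 8 * (g * n%:R) <= 1] /\
  [/\ eps1 <= 1 / 10, k%:R * (h + h) <= 1,
      k%:R * (60 * (g * bm) * (4 * k%:R + 2 * bm + 5)) * (1 + bm ^+ 2 / h ^+ 2) <= h
    & 3 * q%:R * eps1 + 30 * (k%:R * g) <= 1] /\
  ((1 + 10 * eps1) * (1 + k%:R * (h + h))) ^+ q <= 2 /\
  120 * k%:R ^+ 3 * (g * bm) + 6 * k%:R * q%:R * eps1 + 64 * k%:R ^+ 2 * g <= N ^- 7.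
Proof.
move=> G H g h bm N2 A2 k0 q0 n0 kN qN nN e0 eN ep0 epN.
have N1 : 1 <= N by lra.
have N0 : 0 < N by lra.
have Nx i : 0 < N ^+ i by rewrite exprn_gt0.
have Nx1 i : 1 <= N ^+ i by rewrite exprn_ege1.
have mono i j : (i <= j)%N -> N ^+ i <= N ^+ j by move=> ij; rewrite ler_weXn2l.
have two i : 2 ^+ i <= N ^+ i by rewrite lerXn2r ?nnegrE// ltW.
have k1 : 1 <= k%:R :> R by rewrite ler1n.
have K i : k%:R ^+ i <= N ^+ (A * i).
  by rewrite exprM lerXn2r ?nnegrE// ltW.
have P (x y : R) i j : 0 <= x -> x <= N ^+ i -> 0 <= y -> y <= N ^+ j -> x * y <= N ^+ (i + j).
  by move=> ? ? ? ?; rewrite exprD ler_pM.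
have lit (c : R) i : c <= 2 ^+ i -> c <= N ^+ i by move=> ci; apply: le_trans (two i).
have Ninv i : 0 < N ^- i by rewrite invr_gt0.
have invmono i j : (i <= j)%N -> N ^- j <= N ^- i by move=> ij; rewrite lef_pV2 ?posrE// mono.
have small i : N ^- i <= (2 ^+ i)^-1 by rewrite lef_pV2 ?posrE// exprn_gt0.
have bmk : bm <= 8 * k%:R by rewrite /bm; clear -k1; lra.
have bm0 : 1 <= bm by rewrite /bm; clear -k1; lra.
have g0 : 0 < g by exact: Ninv.
have h0 : 0 < h by exact: Ninv.
have AN : N <= N ^+ A by rewrite -[leLHS]expr1 mono// ltnW.
split; [split|split; [split|split]].
- have s : (n + k).+3%:R <= 4 * N ^+ A.
    rewrite -addn3 !natrD; move: (le_trans nN AN) kN.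
    have : 2 <= N ^+ A by apply: le_trans AN.
    by move: (N ^+ A) => x; clear; lra.
  apply: le_trans (_ : _ <= N ^+ 3 * N ^+ A * e) _.
    rewrite ler_wpM2r//; have := two 3; move: s; move: (_%:R) (N ^+ A) (Nx A) => x y y0 xy.
    have : 8 * y <= N ^+ 3 * y -> 2 * x <= N ^+ 3 * y by clear -xy; lra.
    by move=> X h8; apply: X; rewrite ler_wpM2r ?(ltW y0)//; apply: le_trans h8; rewrite -natrX.
  apply: le_trans (_ : _ <= N ^+ 3 * N ^+ A * N ^- (G + A + 3)) _.
    by rewrite ler_wpM2l// mulr_ge0// ltW.
  by apply: (@absorb_power N _ (3 + A)) => //; [rewrite exprD|clear; lia].
- apply: le_trans (_ : _ <= N ^+ 3 * N ^- (G + A + 3)) _.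
    apply: ler_pM => //; first by rewrite mulr_ge0// exprn_ge0.
    by rewrite [N ^+ 3]exprS ler_pM// ?exprn_ge0// lerXn2r// nnegrE// ltW.
  apply: le_trans (_ : _ <= N ^- (G + A)) _.
    by apply: (@absorb_power N _ 3) => //; clear; lia.
  by apply: invmono; rewrite leq_addr.
- apply: le_trans (_ : _ <= N ^+ 13 * N ^+ A * g) _.
    rewrite [g * bm]mulrC mulrA ler_wpM2r ?(ltW g0)//.
    apply: le_trans (_ : _ <= 8000 * k%:R) _; first by move: bmk; clear; lra.
    rewrite ler_pM//; apply: (lit); rewrite -natrX ler_nat//.
  rewrite -[leRHS]invr1 -(expr0 N).
  by apply: (le_trans (_ : _ <= N ^- (7 * A + 51))); [apply: (@absorb_power N _ (13 + A)) => //;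
    [rewrite exprD|rewrite /G; clear; lia] | exact: invmono].
- apply: le_trans (_ : _ <= N ^+ 4 * g) _.
    rewrite mulrCA mulrC ler_wpM2r ?(ltW g0)// (exprS _ 3) mulrC ler_pM//.
    by apply: (lit); rewrite -natrX ler_nat.
  rewrite -[leRHS]invr1 -(expr0 N).
  by apply: (le_trans (_ : _ <= N ^- (8 * A + 60))); [apply: (@absorb_power N _ 4) => //;
    rewrite /G; clear; lia | exact: invmono].
- apply: le_trans epN _; apply: le_trans (invmono 4 (A + 20)%N _) _; first by clear; lia.
  by apply: le_trans (small 4) _; clear; lra.
- rewrite -mulr2n -[h *+ 2]mulr_natl mulrA.
  apply: le_trans (_ : _ <= N ^+ (A + 1) * h) _.
    by rewrite ler_wpM2r ?(ltW h0)// exprD ler_pM.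
  rewrite -[leRHS]invr1 -(expr0 N).
  by apply: (le_trans (_ : _ <= N ^- 7)); [apply: (@absorb_power N _ (A + 1)) => //;
    rewrite /H; clear; lia | exact: invmono].
- have hi : h^-1 = N ^+ H by rewrite /h invrK.
  have B1 : 4 * k%:R + 2 * bm + 5 <= 25 * k%:R by move: bmk; clear -k1; lra.
  have B2 : 1 + bm ^+ 2 / h ^+ 2 <= 65 * (k%:R ^+ 2 * N ^+ (H * 2)).
    rewrite -exprVn hi -exprM.
    have : bm ^+ 2 <= 64 * k%:R ^+ 2.
      by rewrite (_ : 64 = 8 ^+ 2) -?exprMn ?lerXn2r ?nnegrE//; [lra|lra|rewrite -natrX].
    have : 1 <= k%:R ^+ 2 * N ^+ (H * 2) by rewrite mulr_ege1// exprn_ege1.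
    move: (bm ^+ 2) (k%:R ^+ 2) (N ^+ (H * 2)) (Nx (H * 2)%N) => x y z z0 h1 h2.
    have : x * z <= 64 * y * z by rewrite ler_wpM2r// ltW.
    by move: h1; clear; lra.
  apply: le_trans (_ : _ <= k%:R * (60 * (g * (8 * k%:R)) * (25 * k%:R))
     * (65 * (k%:R ^+ 2 * N ^+ (H * 2)))) _.
    apply: ler_pM => //.
    + by rewrite !mulr_ge0 ?(ltW g0)//; move: bm0; clear -k1; lra.
    + by rewrite addr_ge0// divr_ge0// sqr_ge0.
    + rewrite ler_wpM2l// ler_pM ?mulr_ge0 ?(ltW g0)//; [by move: bm0; clear; lra| |].
        by move: bm0; clear -k1; lra.
      by rewrite ler_wpM2l// ler_wpM2l// ltW.
  have -> : k%:R * (60 * (g * (8 * k%:R)) * (25 * k%:R)) * (65 * (k%:R ^+ 2 * N ^+ (H * 2)))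
    = (480 * 1625 * k%:R ^+ 5) * N ^+ (H * 2) * g by ring.
  apply: le_trans (_ : _ <= N ^+ (9 + 11 + A * 5 + H * 2) * g) _.
    rewrite ler_wpM2r ?(ltW g0)//; apply: (P); rewrite ?mulr_ge0 ?exprn_ge0 ?(ltW N0)//.
    apply: (P); rewrite ?mulr_ge0 ?exprn_ge0//.
    by apply: (P) => //; apply: (lit); rewrite -natrX ler_nat.
  apply: le_trans (_ : _ <= N ^- (A + 28)) _.
    by apply: absorb_power => //; rewrite /G /H; clear; lia.
  by apply: invmono; rewrite /H; clear; lia.
- have a1 : 3 * q%:R * eps1 <= 1 / 2.
    apply: le_trans (_ : _ <= N ^+ (2 + 5) * N ^- (A + 20)) _.
      apply: ler_pM => //; rewrite ?mulr_ge0 ?(ltW ep0)//; apply: (P) => //.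
      by apply: (lit); rewrite -natrX ler_nat.
    apply: le_trans (_ : _ <= N ^- (A + 13)) _.
      by apply: absorb_power => //; clear; lia.
    apply: le_trans (invmono 1%N _ _) _; first by clear; lia.
    by apply: le_trans (small 1%N) _; rewrite expr1; clear; lra.
  have a2 : 30 * (k%:R * g) <= 1 / 2.
    rewrite mulrA; apply: le_trans (_ : _ <= N ^+ (5 + A) * g) _.
      rewrite ler_wpM2r ?(ltW g0)//; apply: (P) => //.
      by apply: (lit); rewrite -natrX ler_nat.
    apply: le_trans (_ : _ <= N ^- (7 * A + 59)) _.
      by apply: absorb_power => //; rewrite /G; clear; lia.
    apply: le_trans (invmono 1%N _ _) _; first by clear; lia.
    by apply: le_trans (small 1%N) _; rewrite expr1; clear; lra.
  by move: a1 a2; clear; lra.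
- have kh0 : 0 <= k%:R * (h + h) by rewrite mulr_ge0// addr_ge0// ltW.
  have kh : k%:R * (h + h) <= N ^- 7.
    rewrite -mulr2n -[h *+ 2]mulr_natl mulrA.
    apply: le_trans (_ : _ <= N ^+ (A + 1) * h) _.
      by rewrite ler_wpM2r ?(ltW h0)// exprD ler_pM.
    by apply: absorb_power => //; rewrite /H; clear; lia.
  have kh1 : k%:R * (h + h) <= 1.
    by apply: le_trans kh _; rewrite invf_le1.
  have ep7 : 20 * eps1 <= N ^- 7.
    apply: le_trans (_ : _ <= N ^+ 5 * N ^- (A + 20)) _.
      by apply: ler_pM => //; rewrite ?(ltW ep0)//; apply: (lit); rewrite -natrX ler_nat.
    apply: le_trans (_ : _ <= N ^- (A + 15)) _.
      by apply: absorb_power => //; clear; lia.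
    by apply: invmono; clear; lia.
  move: (k%:R * (h + h)) kh0 kh kh1 => u kh0 kh kh1.
  have n70 := ltW (Ninv 7%N).
  apply: le_trans (_ : _ <= (1 + 2 * N ^- 7) ^+ q) _.
    have st : (1 + 10 * eps1) * (1 + u) <= 1 + 2 * N ^- 7.
      have : 10 * eps1 * u <= 10 * eps1 * 1 by rewrite ler_wpM2l// mulr_ge0// ltW.
      by move: kh ep7; move: (N ^- 7) => x; clear; lra.
    have st0 : 0 <= (1 + 10 * eps1) * (1 + u).
      by apply: mulr_ge0; apply: addr_ge0 => //; rewrite mulr_ge0// ltW.
    by apply: lerXn2r => //; rewrite nnegrE//; apply: le_trans st.
  have qq : 2 * q%:R * (2 * N ^- 7) <= 1.
    have -> : 2 * q%:R * (2 * N ^- 7) = (4 * q%:R) * N ^- 7 by ring.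
    apply: le_trans (_ : _ <= N ^+ (2 + 5) * N ^- 7) _.
      rewrite ler_wpM2r//; apply: (P) => //.
      by apply: (lit); rewrite -natrX ler_nat.
    by rewrite mulfV ?gt_eqF.
  have := growth_le (e := 2 * N ^- 7) _ qq; rewrite mulr_ge0// => /(_ isT).
  by move: qq; clear; lra.
- have b1 : 120 * k%:R ^+ 3 * (g * bm) <= N ^- 9.
    apply: le_trans (_ : _ <= N ^+ (10 + A * 4) * g) _.
      rewrite [g * bm]mulrC mulrA ler_wpM2r ?(ltW g0)//.
      apply: le_trans (_ : _ <= 960 * k%:R ^+ 4) _.
        have : k%:R ^+ 3 * bm <= k%:R ^+ 3 * (8 * k%:R) by rewrite ler_wpM2l// exprn_ge0.
        by rewrite [k%:R ^+ 4]exprSr; move: (k%:R ^+ 3) => x; clear; lra.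
      by apply: (P); rewrite ?exprn_ge0//; apply: (lit); rewrite -natrX ler_nat.
    apply: le_trans (_ : _ <= N ^- (4 * A + 54)) _.
      by apply: absorb_power => //; rewrite /G; clear; lia.
    by apply: invmono; clear; lia.
  have b2 : 6 * k%:R * q%:R * eps1 <= N ^- 9.
    apply: le_trans (_ : _ <= N ^+ (3 + A + 5) * N ^- (A + 20)) _.
      apply: ler_pM => //; rewrite ?mulr_ge0 ?(ltW ep0)//; apply: (P); rewrite ?mulr_ge0//.
      by apply: (P) => //; apply: (lit); rewrite -natrX ler_nat.
    apply: le_trans (_ : _ <= N ^- 12) _.
      by apply: absorb_power => //; clear; lia.
    exact: invmono.
  have b3 : 64 * k%:R ^+ 2 * g <= N ^- 9.
    apply: le_trans (_ : _ <= N ^+ (6 + A * 2) * g) _.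
      rewrite ler_wpM2r ?(ltW g0)//; apply: (P); rewrite ?exprn_ge0//.
      by apply: (lit); rewrite -natrX ler_nat.
    apply: le_trans (_ : _ <= N ^- (6 * A + 58)) _.
      by apply: absorb_power => //; rewrite /G; clear; lia.
    by apply: invmono; clear; lia.
  have c3 : 4 * N ^- 9 <= N ^- 7.
    by apply: (@absorb_power N 4 2) => //; apply: (lit); rewrite -natrX ler_nat.
  by move: b1 b2 b3 c3 (Ninv 9%N); move: (N ^- 9) => x; clear; lra.
Qed.

End Accuracy.

(** * Degree and exponent choices for the power method *)

Section PowerMethod.
Context {R : realType}.

(* Evaluate the Chebyshev expansion of x^q at x = (y + 1/y)/2 with
   y = 1 + sqrt Delta. *)
Lemma chebc_tail_le (N Delta C : R) (q k : nat) :
  2 <= N -> 0 < Delta -> Delta <= 1 / 2 -> 1 / Delta <= N ->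
  q%:R <= 4 / Delta * ln N + 1 -> 64 <= C ->
  C * (Num.sqrt (1 / Delta) * ln N) <= k%:R ->
  4 * k%:R * (\sum_(j < q.+1 | (k <= j)%N) chebc q j) <= N ^- 7.
Proof.
move=> N2 D0 D1 DN qle C64 kge.
have N0 : 0 < N by clear -N2; lra.
have Nx i : 0 < N ^+ i by rewrite exprn_gt0.
set t := Num.sqrt Delta.
have t0 : 0 < t by rewrite sqrtr_gt0.
have t2 : t ^+ 2 = Delta by rewrite sqr_sqrtr// ltW.
have t1 : t <= 1 by rewrite -sqrtr1 ler_wsqrtr//; clear -D1; lra.
have rt : Num.sqrt (1 / Delta) = t^-1 by rewrite div1r sqrtrV// ltW.
set bits := ln N in qle kge.
have expb : expR bits = N by rewrite lnK// posrE.
have bits0 : 0 <= bits by apply: ln_ge0; clear -N2; lra.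
have tk : C * bits <= t * k%:R.
  by rewrite -ler_pdivrMl// mulrCA -rt.
have tin : t^-1 <= N.
  by apply: le_trans DN; rewrite div1r lef_pV2 ?posrE// -t2 expr2 ler_piMr// ltW.
have qD : q%:R * Delta <= 4 * bits + 1 / 2.
  have := ler_wpM2r (ltW D0) qle; rewrite mulrDl mulrAC divfK ?gt_eqF// mul1r.
  by move/le_trans; apply; clear -D1; lra.
(* For y = 1 + t the point is at most 1 + Delta/2, and q Delta <= 4 ln N + 1/2 turns its q-th power
   into at most e^(1/4) N^2. *)
have head : ((1 + t + (1 + t)^-1) / 2) ^+ q <= 2 * N ^+ 2.
  apply: (@le_trans _ _ (expR (q%:R * (Delta / 2)))).
    rewrite expRM_natl lerXn2r ?nnegrE ?expR_ge0//.
      by rewrite divr_ge0 ?addr_ge0 ?invr_ge0 ?addr_ge0 ?(ltW t0).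
    apply: le_trans (expR_ge1Dx _).
    have y0 : 0 < 1 + t by clear -t0; lra.
    have : (1 + t)^-1 <= 1 - t + Delta.
      rewrite -t2 -(ler_pM2l y0) mulfV ?gt_eqF//.
      by have : 0 <= t ^+ 3 by [rewrite exprn_ge0// ltW]; clear; lra.
    by move: (_^-1) => z; clear; lra.
  apply: (@le_trans _ _ (expR (1 / 4 + 2%:R * bits))).
    by rewrite ler_expR; move: qD; clear; lra.
  rewrite expRD expRM_natl expb ler_wpM2r ?(ltW (Nx _))//.
  have : expR (- (1 / 4)) >= 1 - 1 / 4 :> R by have := expR_ge1Dx (- (1 / 4 : R)); clear; lra.
  rewrite expRN => h; have e0 := expR_gt0 (1 / 4 : R).
  have : (1 - 1 / 4) * expR (1 / 4) <= 1 :> R.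
    by rewrite -[leRHS](mulVf (lt0r_neq0 e0)) ler_pM2r.
  by move: (expR _) => z; clear; lra.
(* From 1 + t >= exp(t/2) the denominator is at least exp(tk/2). One half of the exponent yields the
   factor tk/4, which cancels the k in front of the tail; the other half yields N^16, since tk >= 64
   ln N. *)
have den : (t * k%:R / 4) * N ^+ 16 <= (1 + t) ^+ k.
  apply: (@le_trans _ _ (expR (k%:R * (t / 2)))); last first.
    rewrite expRM_natl lerXn2r ?nnegrE ?expR_ge0 ?addr_ge0 ?(ltW t0)//.
    have e0 := expR_gt0 (t / 2).
    have h : (1 - t / 2) * expR (t / 2) <= 1.
      rewrite -[leRHS](mulVf (lt0r_neq0 e0)) ler_pM2r// -expRN.
      by have := expR_ge1Dx (- (t / 2)); clear; lra.
    have h2 : 1 <= (1 + t) * (1 - t / 2).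
      by have : 0 <= t * (1 - t) by [rewrite mulr_ge0 ?subr_ge0 ?(ltW t0)]; clear; lra.
    have h3 : 0 < 1 - t / 2 by clear -t1; lra.
    rewrite -(ler_pM2l h3); apply: le_trans h _; rewrite mulrC; exact: h2.
  have -> : k%:R * (t / 2) = t * k%:R / 4 + t * k%:R / 4 by field.
  rewrite expRD; apply: ler_pM; first by rewrite divr_ge0// mulr_ge0// ltW.
  - exact: ltW.
  - by apply: le_trans (expR_ge1Dx (t * k%:R / 4)); rewrite lerDr.
  rewrite -expb -expRM_natl ler_expR; apply: le_trans (_ : _ <= C * bits / 4) _.
    have : 64 * bits <= C * bits by rewrite ler_wpM2r.
    by clear; lra.
  by move: tk; clear; lra.
have y1 : 1 <= 1 + t by clear -t0; lra.
have yk : 0 < (1 + t) ^+ k by rewrite exprn_gt0//; clear -t0; lra.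
have := chebc_tail q k y1; set tl := \sum_(j < _ | _) _ => tail.
apply: le_trans (_ : _ <= 4 * k%:R * (2 * (2 * N ^+ 2) / (1 + t) ^+ k)) _.
  rewrite ler_wpM2l ?mulr_ge0//; apply: le_trans tail _.
  by rewrite ler_wpM2r ?invr_ge0 ?(ltW yk)// ler_wpM2l.
have -> : 4 * k%:R * (2 * (2 * N ^+ 2) / (1 + t) ^+ k) = 16 * k%:R * N ^+ 2 / (1 + t) ^+ k by ring.
rewrite ler_pdivrMr//.
apply: le_trans (_ : _ <= N ^- 7 * ((t * k%:R / 4) * N ^+ 16)) _; last first.
  by rewrite ler_pM2l// invr_gt0.
have -> : N ^- 7 * (t * k%:R / 4 * N ^+ 16) = k%:R * N ^+ 2 * (t * N ^+ 7 / 4).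
  by field; rewrite gt_eqF.
have -> : 16 * k%:R * N ^+ 2 = k%:R * N ^+ 2 * 16 by ring.
have kN0 : 0 <= k%:R * N ^+ 2 by apply: mulr_ge0 => //; exact: ltW.
rewrite ler_wpM2l//.
have tN : 1 <= t * N by rewrite -ler_pdivrMl// mulr1.
have N6 : 64 <= N ^+ 6.
  by rewrite (_ : 64 = 2 ^+ 6) ?lerXn2r ?nnegrE// ?(ltW N0)// -natrX.
have : 1 * 64 <= t * N * N ^+ 6 by rewrite ler_pM.
have -> : t * N * N ^+ 6 = t * N ^+ 7 by rewrite -mulrA -exprS.
by move: (t * N ^+ 7) => z; clear; lra.
Qed.

(** By contradiction: a smaller ratio and log-convexity would give |a| <= 2 (1 - Delta/2)^(2q)
    |B|^(2q). The 4 in the choice of q makes this at most 2 N^-4 |B|^(2q), which is below the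
    assumed |B|^(2q)/(2n). *)
Lemma power_stretch m n (B : 'M[R]_(m, n)) (x : 'cV[R]_n) (N Delta : R) q :
  2 <= N -> n%:R <= N -> 0 < Delta -> Delta <= 1 / 2 -> (0 < n)%N ->
  4 / Delta * ln N <= q%:R -> 0 < specnorm B -> enorm x <= 2 ->
  specnorm B ^+ (2 * q) / (2 * n%:R) <= enorm (iter q (mulmx (B^T *m B)) x) ->
  (1 - Delta / 2) * specnorm B * enorm (iter q (mulmx (B^T *m B)) x)
    <= enorm (B *m iter q (mulmx (B^T *m B)) x).
Proof.
move=> N2 nN D0 D1 n0 qge s0 x2 age; set s := specnorm B in s0 age *.
have := gram_power_logconvex B x q; set a := iter _ _ _ in age *; move=> lc.
rewrite leNgt; apply/negP => lt.
have nR0 : 0 < n%:R :> R by rewrite ltr0n.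
have sq0 : 0 < s ^+ (2 * q) by rewrite exprn_gt0.
have a0 : 0 < enorm a by apply: lt_le_trans age; rewrite divr_gt0// mulr_gt0.
have N0 : 0 < N by clear -N2; lra.
have h1 : enorm a ^+ (2 * q).+1 <= 2 * ((1 - Delta / 2) * s * enorm a) ^+ (2 * q).
  apply: le_trans lc _; apply: ler_pM; rewrite ?enorm_ge0 ?exprn_ge0 ?enorm_ge0//.
  apply: lerXn2r; rewrite ?nnegrE ?enorm_ge0 ?(ltW lt)//.
  by rewrite !mulr_ge0 ?enorm_ge0 ?(ltW s0)//; clear -D1; lra.
have aq0 : 0 < enorm a ^+ (2 * q) by rewrite exprn_gt0.
move: h1; rewrite exprS !exprMn mulrA ler_pM2r// => h2.
have h3 : (1 - Delta / 2) ^+ (2 * q) <= N ^- 4.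
  apply: (@le_trans _ _ (expR ((2 * q)%:R * (- (Delta / 2))))).
    rewrite expRM_natl lerXn2r ?nnegrE ?expR_ge0//; first by clear -D1; lra.
    by apply: le_trans (expR_ge1Dx _); clear; lra.
  have -> : N ^- 4 = expR (- (4%:R * ln N)) by rewrite expRN expRM_natl lnK.
  rewrite ler_expR natrM; have := ler_wpM2r (ltW D0) qge.
  by rewrite mulrAC divfK ?gt_eqF//; clear; lra.
have h4 : (2 * n%:R)^-1 <= 2 * N ^- 4.
  rewrite -(ler_pM2l sq0); apply: le_trans age _; apply: le_trans h2 _.
  by rewrite mulrC mulrAC mulrC ler_wpM2l ?(ltW sq0)// mulrC ler_wpM2l.
have N4 : 8 * N <= N ^+ 4.
  rewrite exprSr ler_wpM2r ?(ltW N0)//.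
  by rewrite (_ : 8 = 2 ^+ 3) ?lerXn2r ?nnegrE// ?(ltW N0)// -natrX.
have : (2 * n%:R)^-1 * (2 * n%:R) * N ^+ 4 <= 2 * N ^- 4 * (2 * n%:R) * N ^+ 4.
  by rewrite ler_wpM2r ?exprn_ge0 ?(ltW N0)// ler_wpM2r// mulr_ge0.
rewrite mulVf ?gt_eqF ?mulr_gt0//.
have -> : 2 * N ^- 4 * (2 * n%:R) * N ^+ 4 = 4 * n%:R by field; rewrite gt_eqF.
by move: N4 nN nR0; move: (n%:R) (N ^+ 4) => z w; clear; lra.
Qed.

(** The error xi is paid twice, in the numerator and in the denominator; 2 xi fits into the Delta/2
    that the exact power leaves over. *)
Lemma stretch_perturb m n (B : 'M[R]_(m, n)) (a y : 'cV[R]_n) (Delta xi : R) :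
  0 < Delta -> Delta <= 1 / 2 -> 0 < specnorm B ->
  (1 - Delta / 2) * specnorm B * enorm a <= enorm (B *m a) ->
  enorm (y - a) <= xi -> 0 < enorm a -> 4 * xi <= Delta * enorm a ->
  (1 - Delta) * specnorm B <= stretch B y.
Proof.
move=> D0 D1 s0 ha hy a0 hxi; set s := specnorm B in s0 ha *.
have yl : enorm a - xi <= enorm y.
  by have := le_enorm_diff a y; rewrite -(enormN (_ - _)) opprB; move: hy; clear; lra.
have yu : enorm y <= enorm a + xi by have := le_enorm_diff y a; move: hy; clear; lra.
have xi0 : 0 <= xi by apply: le_trans hy; exact: enorm_ge0.
have y0 : 0 < enorm y.
  apply: lt_le_trans yl; have : Delta * enorm a <= 1 / 2 * enorm a by rewrite ler_wpM2r// ltW.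
  by move: hxi a0; clear; lra.
rewrite /stretch ler_pdivlMr//.
have By : enorm (B *m a) - s * xi <= enorm (B *m y).
  have := le_enorm_diff (B *m a) (B *m y); rewrite -mulmxBr -(enormN (B *m (a - y))) -mulmxN opprB.
  have := enorm_mulmx B (y - a); rewrite -/s.
  have : s * enorm (y - a) <= s * xi by rewrite ler_wpM2l// ltW.
  by clear; lra.
apply: le_trans By; move: ha; move: (enorm (B *m a)) => z ha.
have h1 : (1 - Delta) * s * enorm y <= (1 - Delta) * s * (enorm a + xi).
  by rewrite ler_wpM2l// mulr_ge0 ?(ltW s0)//; clear -D1; lra.
have h2 : s * (4 * xi) <= s * (Delta * enorm a) by rewrite ler_wpM2l// ltW.
have h3 : 0 <= Delta * (s * xi) by rewrite !mulr_ge0// ltW.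
by move: h1 h2 h3 ha; clear; lra.
Qed.

End PowerMethod.

(** * Choice of the constants and assembly *)

Section Assembly.
Context {R : realType}.

Lemma at1_ge1 (x : R) : 1 <= at1 x.
Proof. by rewrite /at1 le_max lexx. Qed.

Lemma le_at1 (x : R) : x <= at1 x.
Proof. by rewrite /at1 le_max lexx orbT. Qed.

Lemma natceil_bounds (x : R) : 0 <= x -> x <= (natceil x)%:R <= x + 1.
Proof.
move=> x0; have c0 : 0 <= Num.ceil x by rewrite ceil_ge0; lra.
have -> : (natceil x)%:R = (Num.ceil x)%:~R :> R.
  by rewrite /natceil -[in RHS](gez0_abs c0).
rewrite ceil_ge /=; have := ceilB1_lt x; rewrite intrD mulrN1z; lra.
Qed.

Lemma ln2_ge : 1 / 2 <= ln (2 : R).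
Proof.
rewrite -[1 / 2]expRK ler_ln ?posrE ?expR_gt0//.
have := expR_ge1Dx (- (1 / 2 : R)); rewrite expRN; have := expR_gt0 (1 / 2 : R).
move: (expR _) => z z0 h; have : (1 - 1 / 2) * z <= z^-1 * z.
  by rewrite ler_wpM2r// ltW.
by rewrite mulVf ?gt_eqF//; lra.
Qed.

Lemma ln2_le : ln (2 : R) <= 1.
Proof. by have := @le_ln1Dx R 1; apply; lra. Qed.

(** Converts binary precision into powers of N; the factor 2 in 2M <= c compensates the crude bound
    ln 2 >= 1/2. *)
Lemma powR2_le (N u c : R) (M : nat) : 2 <= N -> ln N <= u -> 0 <= u -> 2 * M%:R <= c ->
  2 `^ (- (c * u)) <= N ^- M.
Proof.
move=> N2 Nu u0 Mc; rewrite /powR gt_eqF//.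
have N0 : 0 < N by lra.
have -> : N ^- M = expR (- (M%:R * ln N)) by rewrite expRN expRM_natl lnK.
rewrite ler_expR mulNr lerN2.
have h1 : M%:R * ln N <= M%:R * u by rewrite ler_wpM2l.
have h2 : 2 * M%:R * u <= c * u by rewrite ler_wpM2r.
have cu : 0 <= c * u by apply: le_trans h2; rewrite !mulr_ge0.
have h3 : c * u * (1 / 2) <= c * u * ln 2 by rewrite ler_wpM2l// ln2_ge.
by move: h1 h2 h3; clear; lra.
Qed.

Lemma le_pow2 (x : R) : exists a : nat, x <= 2 ^+ a.
Proof.
exists (natceil (Num.max 0 x)).
have /natceil_bounds/andP[h _] : 0 <= Num.max 0 x by rewrite le_max lexx.
apply: le_trans (_ : _ <= Num.max 0 x) _; first by rewrite le_max lexx orbT.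
by apply: le_trans h _; rewrite -natrX ler_nat ltnW// ltn_expl.
Qed.

(** Since N >= 2, the constant 4 C_it <= 2^a is absorbed as N^a, and its <= N^2 gives k <= N^(a+2).
    As its >= 1/2, reading it as at least 1 costs only a factor 2. *)
Lemma problem_size (n : nat) (Delta C_it : R) (a : nat) :
  (0 < n)%N -> 0 < Delta -> Delta <= 1 / 2 -> 64 <= C_it -> 4 * C_it <= 2 ^+ a ->
  let N := n%:R / Delta in let its := Num.sqrt (1 / Delta) * ln N in
  let k := natceil (C_it * at1 its) in let q := natceil (4 / Delta * ln N) in
  [/\ 2 <= N, n%:R <= N, 1 / Delta <= N, 1 / 2 <= ln N & 1 / 2 <= its] /\
  [/\ (0 < k)%N, k%:R <= N ^+ (a + 2), k%:R <= 4 * C_it * its & C_it * its <= k%:R] /\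
  [/\ (0 < q)%N, q%:R <= N ^+ 5, 4 / Delta * ln N <= q%:R
    & q%:R <= 4 / Delta * ln N + 1].
Proof.
move=> n0 D0 D1 C64 Ca N its k q.
have n1 : 1 <= n%:R :> R by rewrite ler1n.
have Di : 2 <= 1 / Delta by rewrite ler_pdivlMr//; lra.
have NE : N = n%:R * (1 / Delta) by rewrite /N div1r.
have N2 : 2 <= N by rewrite NE; apply: (le_trans Di); rewrite ler_peMl//; lra.
have nN : n%:R <= N by rewrite NE ler_peMr//; lra.
have DN : 1 / Delta <= N by rewrite NE ler_peMl//; lra.
have N0 : 0 < N by lra.
have bits : 1 / 2 <= ln N by apply: le_trans ln2_ge _; rewrite ler_ln ?posrE.
have bitsN : ln N <= N by rewrite ltW// ln_sublinear.
have r1 : 1 <= Num.sqrt (1 / Delta) by rewrite -[leLHS]sqrtr1 ler_wsqrtr//; lra.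
have rN : Num.sqrt (1 / Delta) <= N.
  apply: le_trans DN; rewrite -[leRHS]sqr_sqrtr; last by lra.
  by rewrite expr2 ler_peMl//; lra.
have its1 : 1 / 2 <= its by rewrite /its; apply: (le_trans bits); rewrite ler_peMl//; lra.
have itsN : its <= N ^+ 2 by rewrite /its expr2 ler_pM//; lra.
have atits : at1 its <= 2 * its by rewrite /at1 ge_max; apply/andP; split; lra.
have itsat := le_at1 its; have a1 := at1_ge1 its.
have C0 : 0 <= C_it by lra.
have /natceil_bounds/andP[kl ku] : 0 <= C_it * at1 its by rewrite mulr_ge0//; lra.
have /natceil_bounds/andP[ql qu] : 0 <= 4 / Delta * ln N.
  by rewrite mulr_ge0 ?divr_ge0//; lra.
rewrite -/k in kl ku; rewrite -/q in ql qu.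
have Cits : C_it * its <= C_it * at1 its by rewrite ler_wpM2l.
have Cits2 : C_it * at1 its <= C_it * (2 * its) by rewrite ler_wpM2l.
have k4 : k%:R <= 4 * C_it * its.
  have : 64 * its <= C_it * its by rewrite ler_wpM2r//; lra.
  by move: ku Cits2 its1; clear; lra.
have k1 : C_it * 1 <= C_it * at1 its by rewrite ler_wpM2l.
split=> //; split; split=> //.
- by rewrite -(ltr_nat R); move: kl k1 C64; clear; lra.
- apply: le_trans k4 _; rewrite exprD ler_pM//; [by lra|by lra|].
  by apply: le_trans Ca _; rewrite lerXn2r ?nnegrE//; lra.
- by apply: le_trans kl.
- rewrite -(ltr_nat R); apply: lt_le_trans ql.
  by rewrite mulr_gt0 ?divr_gt0//; lra.
- apply: le_trans qu _.
  have : 4 / Delta * ln N <= 4 * N * N.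
    by rewrite ler_pM ?divr_ge0//; [lra|lra|move: DN; rewrite div1r; lra].
  have h2 : 8 <= N ^+ 3 by rewrite (_ : 8 = 2 ^+ 3) ?lerXn2r ?nnegrE//; [lra|rewrite -natrX].
  have h3 : 8 * (N * N) <= N ^+ 3 * (N * N) by rewrite ler_wpM2r// mulr_ge0//; lra.
  have h4 : 2 * 2 <= N * N by rewrite ler_pM//; lra.
  have -> : N ^+ 5 = N ^+ 3 * (N * N) by ring.
  by move: h3 h4; move: (N ^+ 3 * _) => z; clear; lra.
Qed.

(** Deterministic core for one sign vector. The facts about eps1 stand outside the overlap condition
    because the running time needs them for every sign vector. *)
Lemma good_run (m n : nat) (B : 'M[R]_(m, n)) (Delta C_it c_ge C_ge C_f : R) (a cg : nat)
   (e : R) (F : fpu R) (mulA : 'cV[R]_n -> computation 'cV[R]_n) (evalf : R -> computation R)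
   (solver : eigensolver R) (v : 'cV[R]_n) (i : 'I_n) (s : {ffun 'I_n -> bool}) :
  let A := (a + 2)%N in let G := (8 * A + 64)%N in
  let N := n%:R / Delta in let its := Num.sqrt (1 / Delta) * ln N in
  let k := natceil (C_it * at1 its) in let q := natceil (4 / Delta * ln N) in
  let C_1 : R := 2 * (A + 20)%:R in
  let eps1 := 2 `^ (- (C_1 * at1 (ln N))) in
  let C_eps : R := C_1 + 2 * (G + A + 3 + A * 4 + cg)%:R in
  B != 0 -> 0 < Delta -> Delta <= 1 / 2 -> 64 <= C_it -> 4 * C_it <= 2 ^+ a ->
  0 < c_ge -> c_ge <= 2 ^+ cg -> 0 < e -> e <= 2 `^ (- (C_eps * at1 (ln N))) ->
  requirement1 e F -> requirement2 e (B^T *m B) mulA ->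
  eval_spec e C_f (fun x => x ^+ q) evalf -> eigensolver_spec e c_ge C_ge solver ->
  (0 < eps1 /\ eps1 <= 1 / 2 /\ c_ge * k%:R ^+ 3 * ln k%:R * e <= eps1) /\
  (enorm v = 1 -> B^T *m B *m v = specnorm B ^+ 2 *: v ->
   1 <= Num.sqrt n%:R * `|v i 0| -> `|v i 0| <= `|dot v (signs s)| ->
   (1 - Delta) * specnorm B <= stretch B (value (random_lanczos F mulA solver eps1 evalf k s))).
Proof.
move=> A G N its k q C_1 eps1 C_eps B0 D0 D1 C64 Ca cge0 cgle e0 ele req1 req2 hf hs.
have n0 : (0 < n)%N.
  by case: n B B0 {i s v mulA req2 N its k q C_1 eps1 C_eps ele hf} => // B; rewrite thinmx0 eqxx.
have [[N2 nN DN bits its1] [[k0 kN k4 kge] [q0 qN qge qle]]] := problem_size n0 D0 D1 C64 Ca.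
rewrite -/N -/its -/k -/q -/A in N2 nN DN bits its1 k0 kN k4 kge q0 qN qge qle.
have N0 : 0 < N by clear -N2; lra.
set u := at1 (ln N) in eps1 ele *.
have u1 : 1 <= u := at1_ge1 _.
have uN : ln N <= u := le_at1 _.
have u0 : 0 <= u by apply: le_trans u1.
have ep0 : 0 < eps1 by rewrite powR_gt0.
have epN : eps1 <= N ^- (A + 20) by apply: powR2_le.
have C10 : 0 <= C_1 by rewrite mulr_ge0.
have eN : e <= N ^- (G + A + 3).
  apply: (le_trans ele); apply: powR2_le => //.
  by rewrite /C_eps -[leLHS]add0r lerD// ler_pM2l// ler_nat -[leqRHS]addnA leq_addr.
have A2 : (2 <= A)%N by rewrite leq_addl.
have [[p1 p2 p3 p4] [[p5 p6 p7 p8] [p9 p10]]] :=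
  parameter_bounds N2 A2 k0 q0 n0 kN qN nN (ltW e0) eN ep0 epN.
have hge : c_ge * k%:R ^+ 3 * ln k%:R * e <= eps1.
  have k1 : 1 <= k%:R :> R by rewrite ler1n.
  have lnk0 : 0 <= ln k%:R :> R by apply: ln_ge0.
  have lnk : ln k%:R <= k%:R :> R by rewrite ltW// ln_sublinear// ltr0n.
  apply: le_trans (_ : _ <= N ^+ (cg + A * 4) * e) _.
    rewrite ler_wpM2r ?(ltW e0)// exprD -mulrA; apply: ler_pM => //; first exact: ltW.
    - by rewrite mulr_ge0// exprn_ge0.
    - by apply: le_trans cgle _; rewrite lerXn2r ?nnegrE// ltW.
    - rewrite exprM (exprSr _ 3) ler_pM ?exprn_ge0//; first by rewrite lerXn2r ?nnegrE// exprn_ge0// ltW.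
      exact: le_trans lnk kN.
  (* C_eps contains C_1 as a summand, so the precision bound splits off the factor eps1; the
     remaining power of N pays for c_ge <= 2^cg and k^3 ln k <= N^(4A). *)
  have step : e <= eps1 * N ^- (cg + A * 4).
    apply: le_trans ele _; rewrite /C_eps mulrDl opprD powRD; last by rewrite pnatr_eq0 implybT.
    rewrite ler_wpM2l ?(ltW ep0)//; apply: powR2_le => //.
    by rewrite ler_wpM2l// ler_nat -[leqRHS]addnA [(A * 4 + cg)%N]addnC leq_addl.
  apply: le_trans (_ : _ <= N ^+ (cg + A * 4) * (eps1 * N ^- (cg + A * 4))) _.
    by rewrite ler_wpM2l// exprn_ge0// ltW.
  by rewrite mulrCA mulfV ?mulr1// gt_eqF// exprn_gt0.
split; first by split=> //; split=> //; move: p5; clear; lra.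
move=> v1 hv vi vs.
have s0 := specnorm_gt0 B0; set sg := specnorm B in s0 hv *.
have sg2 : 0 < sg ^+ 2 by rewrite exprn_gt0.
have Ale x : enorm (B^T *m B *m x) <= sg ^+ 2 * enorm x.
  rewrite -mulmxA; apply: le_trans (enorm_trmulmx _ _) _.
  by rewrite expr2 -mulrA ler_wpM2l ?(ltW s0)// enorm_mulmx.
have specA : specnorm (B^T *m B) <= sg ^+ 2 by apply: specnorm_le => //; exact: ltW.
set g := N ^- G in p1 p2 p3 p4 p7 p8 p10.
have g0 : 0 < g by rewrite invr_gt0 exprn_gt0.
have n1 : 1 <= n%:R :> R by rewrite ler1n.
have mulAerr x : enorm (value (mulA x) - B^T *m B *m x) <= g * sg ^+ 2 * enorm x.
  apply: le_trans (req2 x) _.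
  have pn : n%:R `^ (3 / 2) <= n%:R ^+ 2 :> R.
    by rewrite -powR_mulrn// ler_powR//; clear; lra.
  have h1 : 2 * n%:R `^ (3 / 2) * e <= g.
    by apply: le_trans p2; rewrite ler_wpM2r ?(ltW e0)// ler_wpM2l.
  have h2 : specnorm (B^T *m B) * enorm x <= sg ^+ 2 * enorm x by rewrite ler_wpM2r ?enorm_ge0.
  have -> : 2 * n%:R `^ (3 / 2) * specnorm (B^T *m B) * enorm x * e
    = (2 * n%:R `^ (3 / 2) * e) * (specnorm (B^T *m B) * enorm x) by ring.
  rewrite -[leRHS]mulrA; apply: ler_pM => //.
    by rewrite mulr_ge0 ?(ltW e0)// mulr_ge0 ?powR_ge0.
  by rewrite mulr_ge0 ?specnorm_ge0 ?enorm_ge0.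
set z : 'cV[R]_n := signs s.
have sn0 : 0 < Num.sqrt n%:R :> R by rewrite sqrtr_gt0 (lt_le_trans _ n1).
have z0 : z != 0 by rewrite -enorm_gt0 enorm_signs.
have p3' : 60 * (g * (1 + 7 * k%:R)) <= 1.
  have : 0 <= g * (1 + 7 * k%:R) by rewrite mulr_ge0 ?(ltW g0)// addr_ge0// mulr_ge0.
  by move: p3; clear; lra.
have h0 : 0 < N ^- (A + 8) by rewrite invr_gt0 exprn_gt0.
have [q1 [q1n q1z main]] := lanczos_run_err req1 (ltW e0) p1 sg2 p3 p3' (gram_sym B) Ale mulAerr
  hf hs cge0 hge ep0 p5 q0 k0 z0 h0 (ltW h0) p6 p7 p8.
rewrite -exprM in main.
set P := (_ * _) ^+ q in p9 main.
set xi := 4 * _ * _ + _ + _ + _ in main.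
have xile : xi <= 2 * N ^- 7.
  have tail := chebc_tail_le N2 D0 D1 DN qle C64 kge.
    by rewrite /xi; move: tail p10; clear; lra.
have g8 : 4 * g <= 1 / (2 * n%:R).
  rewrite ler_pdivlMr; last by rewrite mulr_gt0// (lt_le_trans _ n1).
  by move: p4; clear; lra.
have q12 : enorm q1 <= 2.
  rewrite enorm_le//; have := ler_norm (dot q1 q1 - 1).
  have : g * 1 <= g * (1 + 7 * k%:R) by rewrite ler_wpM2l ?(ltW g0)// lerDl mulr_ge0.
  by rewrite expr2; move: q1n p3; clear; lra.
(* One factor n^(-1/2) comes from the large coordinate of v, the other from |z| = sqrt n. Passing to
   the computed start vector costs at most half of this overlap. *)
have vz : n%:R^-1 <= `|dot v ((enorm z)^-1 *: z)|.
  rewrite dotZr normrM enorm_signs ger0_norm ?invr_ge0 ?(ltW sn0)//.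
  rewrite -[n%:R in leLHS](@sqr_sqrtr _ n%:R)// expr2 invfM ler_wpM2l ?invr_ge0 ?(ltW sn0)//.
  apply: (le_trans _ vs).
  by rewrite -[leLHS]mulr1 ler_pdivrMl.
have vq1 : 1 / (2 * n%:R) <= `|dot v q1|.
  have : `|dot v (q1 - (enorm z)^-1 *: z)| <= 4 * g.
    by apply: le_trans (dot_le _ _) _; rewrite v1 mul1r.
  rewrite dotBr distrC => h; have := ler_normD (dot v q1) (dot v ((enorm z)^-1 *: z) - dot v q1).
  rewrite [X in `|X| <= _ -> _]addrC subrK => h'.
  have e2 : n%:R^-1 = 2 * (1 / (2 * n%:R)) :> R by field; rewrite gt_eqF// (lt_le_trans _ n1).
  by move: vz h h' g8; rewrite e2; clear; lra.
set aq := iter q (mulmx (B^T *m B)) q1 in main *.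
have lamq : 0 < sg ^+ (2 * q) by rewrite exprn_gt0.
have aqge : sg ^+ (2 * q) / (2 * n%:R) <= enorm aq.
  have := dot_le v aq; rewrite v1 mul1r; apply: le_trans.
  rewrite (dot_iter_eigen _ _ (gram_sym B) hv) normrM -exprM ger0_norm ?(ltW lamq)//.
  by rewrite ler_wpM2l ?(ltW lamq)// -[leLHS]mul1r.
have aq0 : 0 < enorm aq by apply: lt_le_trans aqge; rewrite divr_gt0// mulr_gt0// (lt_le_trans _ n1).
have st := power_stretch N2 nN D0 D1 n0 qge s0 q12 aqge.
apply: (stretch_perturb D0 D1 s0 st main aq0).
have P0 : 0 <= P.
  by rewrite exprn_ge0// mulr_ge0// addr_ge0 ?mulr_ge0 ?addr_ge0 ?(ltW h0) ?(ltW ep0).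
have xiP : sg ^+ (2 * q) * P * xi <= sg ^+ (2 * q) * (4 * N ^- 7).
  rewrite -mulrA ler_wpM2l ?(ltW lamq)//.
  have n7 : 0 <= 2 * N ^- 7 by rewrite mulr_ge0// invr_ge0 exprn_ge0// ltW.
  apply: le_trans (ler_wpM2l P0 xile) _; apply: le_trans (ler_wpM2r n7 p9) _.
  by clear; lra.
(* Final comparison: because n = N Delta, the tolerance Delta |B|^(2q)/(2n) is |B|^(2q)/(2N), while
   four times the error is at most 16 N^-7 |B|^(2q); what remains is 32 <= N^6. *)
have aD : Delta * (sg ^+ (2 * q) / (2 * n%:R)) <= Delta * enorm aq by rewrite ler_wpM2l// ltW.
have scale (S M d : R) : M != 0 -> d != 0 -> d * (S / (2 * (M * d))) = S * (1 / (2 * M)).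
  by clear => M0 d0; field; rewrite M0.
have NN : n%:R = N * Delta by rewrite /N divfK// gt_eqF.
apply: le_trans aD; rewrite {}NN scale ?gt_eqF//.
apply: le_trans (_ : _ <= sg ^+ (2 * q) * (16 * N ^- 7)) _.
  by move: xiP; move: (sg ^+ (2 * q) * P * xi) (sg ^+ (2 * q)) (N ^- 7) => x y w; clear; lra.
rewrite ler_wpM2l ?(ltW lamq)// ler_pdivlMr; last exact: mulr_gt0.
have -> : 16 * N ^- 7 * (2 * N) = 32 * N ^- 6.
  have : N != 0 by rewrite gt_eqF.
  by move: (N); clear => M M0; field.
rewrite ler_pdivrMr ?exprn_gt0// mul1r; apply: le_trans (_ : _ <= 2 ^+ 6) _.
  by rewrite -natrX ler_nat.
by rewrite lerXn2r ?nnegrE// ltW.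
Qed.

(** Two terms do not literally occur in the target: n k is absorbed through c_mv n <= mv, and k^2
    through bits >= 1/2. *)
Lemma total_time_le (its bits c c' mv n k L C_f C_ge c_mv : R) :
  1 / 2 <= its -> 1 / 2 <= bits -> 0 <= k -> k <= c * its -> 0 <= L -> L <= c' * bits ->
  0 < c_mv -> 0 <= n -> c_mv * n <= mv -> 0 < C_f -> 0 < C_ge ->
  k * (2 * mv) + 30 * n * k + (12 + C_f) * k ^+ 2 + C_ge * at1 (k ^+ 2 * L + k * L ^+ 2) <=
  (2 * c + 30 * c / c_mv + 2 * (12 + C_f) * c ^+ 2 + C_ge * (1 + c ^+ 2 * c' + c * c' ^+ 2))
  * at1 (mv * its + its ^+ 2 * bits + its * bits ^+ 2).
Proof.
move=> its1 bits1 k0 kc L0 Lc cm n0 nm Cf Cg.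
have i0 : 0 < its by clear -its1; lra.
have b0 : 0 < bits by clear -bits1; lra.
have c0 : 0 <= c by rewrite -(pmulr_lge0 _ i0) (le_trans k0).
have c'0 : 0 <= c' by rewrite -(pmulr_lge0 _ b0) (le_trans L0).
have m0 : 0 <= mv by apply: le_trans nm; rewrite mulr_ge0// ltW.
have x1 : 0 <= mv * its by rewrite mulr_ge0// ltW.
have x2 : 0 <= its ^+ 2 * bits by rewrite mulr_ge0 ?exprn_ge0// ltW.
have x3 : 0 <= its * bits ^+ 2 by rewrite mulr_ge0 ?exprn_ge0// ltW.
set X := at1 (mv * _ + _ + _); have X1 : 1 <= X := at1_ge1 _.
have XX : mv * its + its ^+ 2 * bits + its * bits ^+ 2 <= X := le_at1 _.
have y1 : mv * its <= X by move: x1 x2 x3 XX; clear; lra.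
have y2 : its ^+ 2 * bits <= X by move: x1 x2 x3 XX; clear; lra.
have y3 : its * bits ^+ 2 <= X by move: x1 x2 x3 XX; clear; lra.
have k2 : k ^+ 2 <= c ^+ 2 * its ^+ 2.
  by rewrite -exprMn lerXn2r ?nnegrE// mulr_ge0// ltW.
have L2 : L ^+ 2 <= c' ^+ 2 * bits ^+ 2.
  by rewrite -exprMn lerXn2r ?nnegrE// mulr_ge0// ltW.
have t1 : k * (2 * mv) <= 2 * c * X.
  apply: le_trans (_ : _ <= c * its * (2 * mv)) _; first by rewrite ler_wpM2r// mulr_ge0.
  have -> : c * its * (2 * mv) = 2 * c * (mv * its) by ring.
  by rewrite ler_wpM2l// mulr_ge0.
have t2 : 30 * n * k <= 30 * c / c_mv * X.
  have nm' : n <= mv / c_mv by rewrite ler_pdivlMr// mulrC.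
  apply: le_trans (_ : _ <= 30 * (mv / c_mv) * (c * its)) _.
    by rewrite ler_pM ?mulr_ge0// ler_wpM2l.
  have -> : 30 * (mv / c_mv) * (c * its) = 30 * c / c_mv * (mv * its) by ring.
  by rewrite ler_wpM2l// divr_ge0 ?mulr_ge0// ltW.
have t3 : (12 + C_f) * k ^+ 2 <= 2 * (12 + C_f) * c ^+ 2 * X.
  have f0 : 0 <= 12 + C_f by clear -Cf; lra.
  apply: le_trans (_ : _ <= (12 + C_f) * (c ^+ 2 * its ^+ 2)) _; first by rewrite ler_wpM2l.
  have h : its ^+ 2 <= 2 * X.
    have : its ^+ 2 * (1 / 2) <= its ^+ 2 * bits by rewrite ler_wpM2l// exprn_ge0// ltW.
    by move: y2; clear; lra.
  have -> : 2 * (12 + C_f) * c ^+ 2 * X = (12 + C_f) * (c ^+ 2 * (2 * X)) by ring.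
  by rewrite ler_wpM2l// ler_wpM2l// exprn_ge0.
have t4 : C_ge * at1 (k ^+ 2 * L + k * L ^+ 2) <= C_ge * (1 + c ^+ 2 * c' + c * c' ^+ 2) * X.
  rewrite -mulrA ler_wpM2l ?(ltW Cg)//.
  have z1 : k ^+ 2 * L <= c ^+ 2 * c' * X.
    apply: le_trans (_ : _ <= c ^+ 2 * its ^+ 2 * (c' * bits)) _.
      by rewrite ler_pM ?exprn_ge0.
    have -> : c ^+ 2 * its ^+ 2 * (c' * bits) = c ^+ 2 * c' * (its ^+ 2 * bits) by ring.
    by rewrite ler_wpM2l// mulr_ge0 ?exprn_ge0.
  have z2 : k * L ^+ 2 <= c * c' ^+ 2 * X.
    apply: le_trans (_ : _ <= c * its * (c' ^+ 2 * bits ^+ 2)) _.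
      by rewrite ler_pM ?exprn_ge0.
    have -> : c * its * (c' ^+ 2 * bits ^+ 2) = c * c' ^+ 2 * (its * bits ^+ 2) by ring.
    by rewrite ler_wpM2l// mulr_ge0 ?exprn_ge0.
  have w1 : 0 <= c ^+ 2 * c' * X by rewrite !mulr_ge0 ?exprn_ge0//; apply: le_trans X1.
  have w2 : 0 <= c * c' ^+ 2 * X by rewrite !mulr_ge0 ?exprn_ge0//; apply: le_trans X1.
  rewrite /at1 ge_max; apply/andP; split; rewrite 2!mulrDl mul1r.
    by move: w1 w2 X1; clear; lra.
  by move: w1 w2 z1 z2 X1; clear; lra.
by rewrite !(mulrDl _ _ X) !lerD.
Qed.

Lemma half_power_le (delta : R) : 0 < delta -> delta < 1 ->
  (1 / 2) ^+ natceil (2 * at1 (ln (1 / delta))) <= delta.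
Proof.
move=> d0 d1; set l := ln (1 / delta).
have a1 := at1_ge1 l; have al := le_at1 l.
have /natceil_bounds/andP[rl _] : 0 <= 2 * at1 l by rewrite mulr_ge0// (le_trans _ a1).
set r := natceil _ in rl *.
have -> : delta = expR (- l) by rewrite /l div1r lnV ?posrE// opprK lnK.
have -> : (1 / 2 : R) = expR (- ln 2) by rewrite expRN lnK ?posrE// div1r.
rewrite -expRM_natl ler_expR mulrN lerN2.
have a0 : 0 <= 2 * at1 l by rewrite mulr_ge0// (le_trans _ a1).
have : 2 * at1 l * (1 / 2) <= r%:R * ln 2.
  by apply: ler_pM => //; [exact: divr_ge0|exact: ln2_ge].
by move: al; clear; lra.
Qed.

Lemma top_unit_vector m n (B : 'M[R]_(m, n)) : B != 0 ->
  exists v : 'cV[R]_n, exists i, [/\ enorm v = 1, B^T *m B *m v = specnorm B ^+ 2 *: v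
    & 1 <= Num.sqrt n%:R * `|v i 0|].
Proof.
move=> /top_singular_vector[w w0 hw].
have ew : 0 < enorm w by rewrite enorm_gt0.
have v1 : enorm ((enorm w)^-1 *: w) = 1.
  by rewrite enormZ ger0_norm ?invr_ge0 ?(ltW ew)// mulVf ?gt_eqF.
have v0 : (enorm w)^-1 *: w != 0 by rewrite -enorm_gt0 v1.
have [i hi] := exists_large_coord v0.
exists ((enorm w)^-1 *: w), i; split; [exact: v1| |by move: hi; rewrite v1].
by rewrite -scalemxAr hw !scalerA mulrC.
Qed.

(** The eigensolver's cost depends on ln(k/eps1); both ln k and ln(1/eps1) are multiples of ln N,
    which makes that cost polynomial in the iteration count and [bits]. *)
Lemma log_precision_bounds (N k u C_1 : R) (A : nat) :
  2 <= N -> 1 <= k -> k <= N ^+ A -> 0 <= C_1 -> 0 <= u -> u <= 2 * ln N ->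
  2 `^ (- (C_1 * u)) <= 1 ->
  0 <= ln (k / 2 `^ (- (C_1 * u))) <= (A%:R + 2 * C_1) * ln N.
Proof.
move=> N2 k1 kN C10 u0 uN e1.
have e0 : 0 < 2 `^ (- (C_1 * u)) :> R by rewrite powR_gt0.
apply/andP; split; first by apply: ln_ge0; rewrite ler_pdivlMr// mul1r (le_trans e1).
have N0 : 0 < N by clear -N2; lra.
have k0 : 0 < k by clear -k1; lra.
rewrite lnM ?posrE ?invr_gt0// lnV ?posrE// ln_powR mulNr opprK mulrDl.
apply: lerD.
  apply: le_trans (_ : _ <= ln (N ^+ A)) _; first by rewrite ler_ln ?posrE ?exprn_gt0.
  by rewrite lnXn// mulr_natl.
apply: le_trans (_ : _ <= C_1 * u) _; first by rewrite ler_piMr ?mulr_ge0// ln2_le.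
by rewrite -mulrA mulrCA ler_wpM2l.
Qed.

End Assembly.

Theorem theorem18 (R : realType) (c_ge C_ge C_f c_mv : R) :
  0 < c_ge -> 0 < C_ge -> 0 < C_f -> 0 < c_mv ->
  exists2 C_0 : R, 0 < C_0 & forall C_it : R, C_0 <= C_it ->
  exists C_1 C_eps C_time C_rep : R,
    [/\ 0 < C_1, 0 < C_eps, 0 < C_time & 0 < C_rep] /\
  forall (m n : nat) (B : 'M[R]_(m, n)) (Delta : R),
    B != 0 -> 0 < Delta -> Delta <= 1 / 2 ->
  let bits : R := ln (n%:R / Delta) in
  let q := natceil (4 / Delta * ln (n%:R / Delta)) in
  let its : R := Num.sqrt (1 / Delta) * ln (n%:R / Delta) in
  let k := natceil (C_it * at1 its) in
  let eps1 := 2 `^ (- (C_1 * at1 bits)) in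
  forall (eps_mach : R) (F : fpu R)
         (mulB : 'cV[R]_n -> computation 'cV[R]_m) (mulBt : 'cV[R]_m -> computation 'cV[R]_n)
         (mv : nat) (evalf : R -> computation R) (solver : eigensolver R),
    0 < eps_mach -> eps_mach <= 2 `^ (- (C_eps * at1 bits)) ->
    requirement1 eps_mach F ->
    requirement2 eps_mach (B^T *m B) (mul_gram mulB mulBt) ->
    (forall w, (time (mulB w) <= mv)%N) ->
    (forall w, (time (mulBt w) <= mv)%N) ->
    c_mv * n%:R <= mv%:R ->
    eval_spec eps_mach C_f (fun x => x ^+ q) evalf ->
    eigensolver_spec eps_mach c_ge C_ge solver ->
  let run (s : {ffun 'I_n -> bool}) :=
    random_lanczos F (mul_gram mulB mulBt) solver eps1 evalf k s in
  let y s := value (run s) in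
  [/\ (exists2 x : 'cV[R]_n, x != 0 & stretch B x = specnorm B) /\
      (forall x : 'cV[R]_n, x != 0 -> stretch B x <= specnorm B),
      1 / 2 <= coin_pr (fun s => (1 - Delta) * specnorm B <= stretch B (y s)) :> R,
      forall s, (time (run s))%:R
        <= C_time * at1 (mv%:R * its + its ^+ 2 * bits + its * bits ^+ 2)
    & forall delta : R, 0 < delta -> delta < 1 ->
      let r := natceil (C_rep * at1 (ln (1 / delta))) in
      let trial (s : {ffun 'I_r * 'I_n -> bool}) (i : 'I_r) :=
        y [ffun j => s (i, j)] in
      forall select : {ffun 'I_r * 'I_n -> bool} -> 'I_r,
        (forall s i, stretch B (trial s i) <= stretch B (trial s (select s))) ->
        1 - delta <=
          coin_pr (fun s => (1 - Delta) * specnorm B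
                              <= stretch B (trial s (select s))) :> R].
Proof.
move=> cge0 Cge0 Cf0 cmv0; exists 64 => // C_it C64.
(* Here a depends only on C_it and cg only on c_ge, so C_1 is a function of C_it, and C_eps of C_it
   and c_ge, before any matrix or Delta is given. *)
have [a Ca] := le_pow2 (4 * C_it); have [cg cgle] := le_pow2 c_ge.
pose A := (a + 2)%N; pose G := (8 * A + 64)%N.
pose C_1 : R := 2 * (A + 20)%:R.
pose C_eps : R := C_1 + 2 * (G + A + 3 + A * 4 + cg)%:R.
pose c := 4 * C_it; pose c' : R := A%:R + 2 * C_1.
have C10 : 0 < C_1 by rewrite mulr_gt0// ltr0n addnS.
have c0 : 0 < c by rewrite mulr_gt0// (lt_le_trans _ C64).
have c'0 : 0 <= c' by rewrite addr_ge0// mulr_ge0// ltW.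
exists C_1, C_eps,
  (2 * c + 30 * c / c_mv + 2 * (12 + C_f) * c ^+ 2 + C_ge * (1 + c ^+ 2 * c' + c * c' ^+ 2)), 2.
split.
  split=> //; first by rewrite ltr_pwDl// mulr_ge0.
  have cW : 0 <= c by exact: ltW.
  have CgW : 0 <= C_ge by exact: ltW.
  have CfW : 0 <= C_f by exact: ltW.
  have cmvW : 0 <= c_mv by exact: ltW.
  have h1 : 0 <= 30 * c / c_mv by apply: divr_ge0 => //; exact: mulr_ge0.
  have h2 : 0 <= 2 * (12 + C_f) * c ^+ 2.
    by apply: mulr_ge0; [apply: mulr_ge0 => //; exact: addr_ge0|exact: exprn_ge0].
  have h3 : 0 <= C_ge * (1 + c ^+ 2 * c' + c * c' ^+ 2).
    have h4 : 0 <= c ^+ 2 * c' by apply: mulr_ge0 => //; exact: exprn_ge0.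
    have h5 : 0 <= c * c' ^+ 2 by apply: mulr_ge0 => //; exact: exprn_ge0.
    by apply: mulr_ge0 => //; do 2! apply: addr_ge0 => //.
  by do 3! apply: ltr_wpDr => //; rewrite mulr_gt0.
move=> m n B Delta B0 D0 D1 bits q its k eps1 eps_mach F mulB mulBt mv evalf solver.
move=> e0 ele req1 req2 hB hBt hmv hf hs run y.
have [v [i [v1 hv vi]]] := top_unit_vector B0.
have n0 : (0 < n)%N by apply: leq_ltn_trans (leq0n i) (ltn_ord i).
have [[N2 nN DN bits1 its1] [[k0 kN k4 kge] [q0 qN qge qle]]] := problem_size n0 D0 D1 C64 Ca.
have good s := good_run v i s B0 D0 D1 C64 Ca cge0 cgle e0 ele req1 req2 hf hs.
have half : 1 / 2 <= coin_pr (fun s => (1 - Delta) * specnorm B <= stretch B (y s)) :> R.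
  (* The vector v and the coordinate i depend on B alone, so the flip at i is one fixed involution
     of the sign patterns. *)
  apply: (coin_pr_involution (flipK i)) => s.
  have [_ /(_ v1 hv vi) g1] := good s; have [_ /(_ v1 hv vi) g2] := good (flip i s).
  by case/orP: (dot_signs_flip v i s) => [/g1|/g2] h; apply/orP; [left|right].
split=> //.
- split; last exact: stretch_le.
  have v0 : v != 0 by rewrite -enorm_gt0 v1.
  by exists v => //; apply: top_singular_stretch.
- move=> s; have [[ep0 [ep2 epge]] _] := good s.
  have tA x : (time (mul_gram mulB mulBt x) <= mv + mv)%N by apply: leq_add.
  apply: le_trans (time_random_lanczos F s tA k0 n0 hf hs (ltW e0) (ltW cge0) Cge0 ep0 ep2 epge) _.
  have k1 : 1 <= k%:R :> R by rewrite ler1n.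
  have b1 := at1_ge1 bits.
  have b2 : at1 bits <= 2 * bits by rewrite /at1 ge_max; move: bits1; rewrite -/bits; clear; lra.
  have ep1 : eps1 <= 1 by move: ep2; rewrite -/bits -/eps1; clear; lra.
  have /andP[L0 L1] := log_precision_bounds N2 k1 kN (ltW C10) (le_trans ler01 b1) b2 ep1.
  rewrite natrD -mulr2n -[mv%:R *+ 2]mulr_natl.
  exact: total_time_le its1 bits1 (ler0n _ _) k4 L0 L1 cmv0 (ler0n _ _) hmv Cf0 Cge0.
- move=> delta d0 d1 r trial select hsel.
  apply: (coin_pr_repeat half (half_power_le d0 d1)) => s j; move/le_trans; apply; exact: hsel.
Qed.
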